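(* Consider the adaptive distributed estimation scheme described in the context, and assume (A.1)–(A.5) hold with $\tau_1=1$ and $a\ge 1$. Then for each agent $n$ the estimate sequence $\{\mathbf{x}_n(t)\}$ is strongly consistent. More precisely, for each $n$ and each $\tau\in[0,1/2)$, $$\mathbb{P}_{\theta^*}\Big(\lim_{t\to\infty}(t+1)^{\tau}\|\mathbf{x}_n(t)-\theta^*\|=0\Big)=1.$$
   Context: There are $N$ agents indexed $n=1,\dots,N$ and an unknown deterministic parameter $\theta^*\in\mathbb{R}^M$. All random objects are defined on a probability space with filtration $\{\mathcal{F}_t\}_{t\ge 0}$; $\mathbb{P}_{\theta^*}$ and $\mathbb{E}_{\theta^*}$ denote probability and expectation. Inequalities between random variables are understood almost surely. Observation model: agent $n$ observes, at times $t=0,1,2,\dots$, the vector $\mathbf{y}_n(t)=H_n\theta^*+\zeta_n(t)\in\mathbb{R}^{M_n}$. Here $H_n\in\mathbb{R}^{M_n\times M}$ is deterministic. For each $n$, $\{\zeta_n(t)\}_t$ is a zero-mean, temporally i.i.d. sequence with finite covariance $R_n$, which is nonsingular and unknown to the agents. Each $\zeta_n(t)$ is $\mathcal{F}_{t+1}$-measurable and independent of $\mathcal{F}_t$. For $n\neq l$ the noise sequences are mutually uncorrelated. Communication model: $\{L_t\}$ is a sequence of random $N\times N$ Laplacians of simple undirected graphs on $\{1,\dots,N\}$. The neighborhood of agent $n$ at time $t$ is $\Omega_n(t)=\{l:(L_t)_{nl}=-1\}$. Algorithm. The weights are $\alpha_t=a/(t+1)^{\tau_1}$ and $\beta_t=b/(t+1)^{\tau_2}$,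 and $\gamma_t>0$ with $\gamma_t\to0$. The estimates have deterministic initial values $\mathbf{x}_n(0)$ and evolve as $$\mathbf{x}_n(t+1)=\mathbf{x}_n(t)-\beta_t\sum_{l\in\Omega_n(t)}(\mathbf{x}_n(t)-\mathbf{x}_l(t))+\alpha_tK_n(t)(\mathbf{y}_n(t)-H_n\mathbf{x}_n(t)).$$ The gains are $K_n(t)=(G_n(t)+\gamma_tI_M)^{-1}H_n^T(Q_n(t)+\gamma_tI_{M_n})^{-1}$. The matrices $Q_n(t)$ start from a positive semidefinite initial value and are updated as $$Q_n(t+1)=\frac1t\sum_{s=0}^t\mathbf{y}_n(s)\mathbf{y}_n(s)^T-\Big(\frac1t\sum_{s=0}^{t-1}\mathbf{y}_n(s)\Big)\Big(\frac1t\sum_{s=0}^{t-1}\mathbf{y}_n(s)\Big)^T.$$ The matrices $G_n(t)$ start from positive semidefinite $G_n(0)$ and evolve as $$G_n(t+1)=G_n(t)-\beta_t\sum_{l\in\Omega_n(t)}(G_n(t)-G_l(t))+\alpha_t\big(H_n^T(Q_n(t)+\gamma_tI_{M_n})^{-1}H_n-G_n(t)\big).$$ Assumptions: (A.1) $\overline{\Sigma}_c=\frac1N\sum_nH_n^TR_n^{-1}H_n$ is invertible. (A.2) $\{L_t\}$ is i.i.d., $L_t$ is $\mathcal{F}_{t+1}$-measurable and independent of $\mathcal{F}_t$, and $\lambda_2(\mathbb{E}_{\theta^*}[L_t])>0$, where $\lambda_2$ is the second smallest eigenvalue. (A.3) $\{L_t\}$ and the noise sequences are mutually independent. (A.4)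 There is $\varepsilon_1>0$ with $\mathbb{E}_{\theta^*}\|\zeta_n(t)\|^{2+\varepsilon_1}<\infty$ for all $n$. (A.5) $a,b>0$, $0<\tau_2\le\tau_1\le1$, and $\tau_1>\tau_2+\frac1{2+\varepsilon_1}+\frac12$.
   Formalization: The update formula for Q_n(t+1) divides by zero at t=0, so Q_n(1) is undefined as written; here Q_n(1) is set equal to the initial value Q_n(0), and the formula is used as stated for t ≥ 1. *)

(* Defs.v *)
From HB Require Import structures.
From mathcomp Require Import all_boot all_order all_algebra.
From mathcomp Require Import all_classical all_reals all_analysis.
Set Implicit Arguments.
Unset Strict Implicit.
Unset Printing Implicit Defensive.
Import Order.TTheory GRing.Theory Num.Theory.
Local Open Scope classical_set_scope.
Local Open Scope ring_scope.

Section ProbabilityNotions.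
Context {d : measure_display} {T : measurableType d} {R : realType}.
Variable P : probability T R.

Definition vnorm {k : nat} (v : 'cV[R]_k) : R :=
  Num.sqrt (\sum_(i < k) v i 0 ^+ 2).

Definition is_filtration (F : nat -> set_system T) : Prop :=
  forall t, [/\ sigma_algebra setT (F t), F t `<=` measurable
             & F t `<=` F t.+1].

Definition mx_measurable_wrt {m n : nat} (G : set_system T)
  (X : T -> 'M[R]_(m, n)) : Prop :=
  forall i j (B : set R), measurable B ->
    G ((fun w => X w i j) @^-1` B).

(** "Rectangle" events {X in B} for entrywise Borel sets B: these form a
    pi-system generating sigma(X). *)
Definition rect_event {m n : nat} (X : T -> 'M[R]_(m, n))
  (B : 'I_m -> 'I_n -> set R) : set T :=
  [set w | forall i j, B i j (X w i j)].

Definition mx_borel {m n : nat} (B : 'I_m -> 'I_n -> set R) : Prop :=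
  forall i j, measurable (B i j).

(** X is independent of the sigma-algebra G (i.e. sigma(X) and G are
    independent; checked on the generating pi-system of rectangles). *)
Definition indep_of {m n : nat} (X : T -> 'M[R]_(m, n))
  (G : set_system T) : Prop :=
  forall B, mx_borel B -> forall A, G A ->
    P (A `&` rect_event X B) = (P A * P (rect_event X B))%E.

Definition adapted_indep {m n : nat} (F : nat -> set_system T)
  (X : nat -> T -> 'M[R]_(m, n)) : Prop :=
  forall t, mx_measurable_wrt (F t.+1) (X t) /\ indep_of (X t) (F t).

Definition ident_distr {m n : nat} (X : nat -> T -> 'M[R]_(m, n)) : Prop :=
  forall t s B, mx_borel B -> P (rect_event (X t) B) = P (rect_event (X s) B).

Definition Emx {m n : nat} (X : T -> 'M[R]_(m, n)) : 'M[R]_(m, n) :=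
  \matrix_(i, j) fine ('E_P[fun w => X w i j]).

End ProbabilityNotions.

Definition is_simple_laplacian {R : realType} {N : nat} (L : 'M[R]_N) : Prop :=
  forall i j, [/\ (i != j -> L i j = 0 \/ L i j = -1),
                 L i j = L j i
               & L i i = - \sum_(k < N | k != i) L i k].

Definition sorted_eigenvalues {R : realType} {N : nat} (A : 'M[R]_N)
  (s : seq R) : Prop :=
  sorted <=%R s /\ char_poly A = \prod_(x <- s) ('X - x%:P).

Definition lambda2_pos {R : realType} {N : nat} (A : 'M[R]_N) : Prop :=
  exists s, sorted_eigenvalues A s /\ 0 < nth 0 s 1.

Definition psd {R : realType} {k : nat} (A : 'M[R]_k) : Prop :=
  A^T = A /\ forall v : 'cV[R]_k, 0 <= (v^T *m A *m v) 0 0.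

Section Algorithm.
Context {R : realType} {T : Type}.
Variables (N M : nat) (Mn : 'I_N -> nat).
Variable H : forall n, 'M[R]_(Mn n, M).
Variable theta : 'cV[R]_M.
Variable zeta : forall n, nat -> T -> 'cV[R]_(Mn n).
Variable L : nat -> T -> 'M[R]_N.
Variables (alpha beta gamma : nat -> R).
Variable x0 : 'I_N -> 'cV[R]_M.
Variable G0 : 'I_N -> 'M[R]_M.
Variable Q0 : forall n, 'M[R]_(Mn n).

Definition yobs n t w : 'cV[R]_(Mn n) := H n *m theta + zeta n t w.

(** Q_n(t): Q_n(0) = Q0 n; Q_n(1) = Q0 n (the update formula has a 1/0 at t=0);
    for t >= 1,
    Q_n(t+1) = 1/t sum_{s=0}^t y y^T - (1/t sum_{s<t} y)(1/t sum_{s<t} y)^T. *)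
Definition Qest n t w : 'M[R]_(Mn n) :=
  if (t <= 1)%N then Q0 n
  else let k := t.-1 in
       let m := k%:R^-1 *: \sum_(s < k) yobs n s w in
       k%:R^-1 *: \sum_(s < k.+1) (yobs n s w *m (yobs n s w)^T) - m *m m^T.

Definition nbr t w (n l : 'I_N) : bool := L t w n l == -1.

Definition Kgain (G : 'I_N -> 'M[R]_M) n t w : 'M[R]_(M, Mn n) :=
  invmx (G n + (gamma t)%:M) *m (H n)^T *m invmx (Qest n t w + (gamma t)%:M).

Fixpoint state (t : nat) (w : T) : ('I_N -> 'cV[R]_M) * ('I_N -> 'M[R]_M) :=
  match t with
  | 0 => (x0, G0)
  | k.+1 =>
    let: (x, G) := state k w in
    ((fun n => x n - beta k *: \sum_(l < N | nbr k w n l) (x n - x l)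
               + alpha k *: (Kgain G n k w *m (yobs n k w - H n *m x n))),
     (fun n => G n - beta k *: \sum_(l < N | nbr k w n l) (G n - G l)
               + alpha k *: ((H n)^T *m invmx (Qest n k w + (gamma k)%:M) *m H n
                             - G n)))
  end.

Definition xest n t w : 'cV[R]_M := (state t w).1 n.
Definition Gest n t w : 'M[R]_M := (state t w).2 n.

End Algorithm.

Definition step {R : realType} (c tau : R) (t : nat) : R :=
  c / ((t.+1)%:R `^ tau).

(* Main.v *)
Require Import Defs.
From HB Require Import structures.
From mathcomp Require Import all_boot all_order all_algebra.
From mathcomp Require Import all_classical all_reals all_analysis.
From mathcomp Require Import measurable_realfun ring lra.
Import Order.TTheory GRing.Theory Num.Theory.
Local Open Scope classical_set_scope.
Local Open Scope ring_scope.
Set Implicit Arguments.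
Unset Strict Implicit.
Unset Printing Implicit Defensive.

(** A pathwise analysis through L^p moments and almost supermartingales.

    The sample covariances [Q_n(t)] converge to [R_n] by a strong law of large
    numbers under moments of order [q > 1].  Hence the inputs of the recursion
    for [G_n] converge; its network average is then an averaging recursion with
    limit [Sigma_c], and its disagreement part is contracted in mean by
    [I - beta_t E L_t], whose spectral gap dominates [alpha_t].  So [K_n(t)]
    converges to [Sigma_c^-1 H_n^T R_n^-1], and the average of [K_n(t) H_n]
    tends to the identity.

    For the errors [e_n = x_n - theta], split into the average and the
    disagreement.  After localization (gains within [eta] of their limits,
    truncated value at a restart time [t1]), both parts are bounded in
    [L^(2+eps1)], and the disagreement is [O(t^-(1-tau2))] there, hence
    [o(t^-(1/2))] almost surely by the condition on [tau2] and Borel-Cantelli.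
    The average error [m_t] satisfies
    [E(|m_(t+1)|^2 | F_t) <= (1 - rho/(t+1)) |m_t|^2 + summable], with [rho < 1]
    as close to [1] as wished since [a >= 1], so that [(t+1)^r |m_t|^2] is an
    almost supermartingale for [r <= rho], and thus bounded almost surely. *)

(** Two obstacles shape the argument. The gains contain inverses of random matrices whose moments
    are not controlled, so no expectation of the original errors is taken: every moment estimate
    concerns a restarted and truncated copy. And the graphs are connected only in the mean, so the
    disagreement contracts in expectation, not along paths. Its noise is charged at full size
    [alpha_t] through Minkowski's inequality; balancing this against the contraction [beta_t] gives
    the order [t^-(1-tau2)]. With [p = 2 + eps1], the [p]-th moments of [t^(1/2)] times the
    disagreement are summable when [p (1/2 - tau2) > 1], which is exactly the condition on [tau2]
    for [tau1 = 1]. Only the average error uses that the noise is independent of the past, and there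
    the noise costs [alpha_t^2]. Conditional expectations are not formed: each conditional
    inequality is tested on the events of [F_t]. Average and disagreement feed each other, so their
    moments have to be bounded together before any rate is available; a small-gain condition, met at
    late times since [alpha_t / beta_t] tends to [0], closes this loop. *)

Section RealSequences.
Context {R : realType}.
Implicit Types (x y s r rho : R) (t n : nat).

(** * Power weights, their series, and scalar averaging recursions *)

Lemma eqr_le (x y : R) : x = y -> x <= y.
Proof. by move=> ->. Qed.

(** Convexity of the exponential between [ln (1 + x)] and [0], with weight [rho]. *)
Lemma powR_le1D x rho : 0 <= x -> 0 <= rho <= 1 -> (1 + x) `^ rho <= 1 + rho * x.
Proof.
move=> x0 /andP[r0 r1].
have h1x : 0 < 1 + x by lra.
have := @convex_expR R (Itv01 r0 r1) (ln (1 + x) : R^o) (0 : R^o).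
rewrite !convRE /= mulr0 addr0 expR0 mulr1 lnK ?posrE //.
by rewrite /powR gt_eqF // => h; apply: (le_trans h); rewrite /unstable.onem; lra.
Qed.

Lemma powR_succ_le t rho : 0 <= rho <= 1 ->
  t.+2%:R `^ rho <= t.+1%:R `^ rho * (1 + rho / t.+1%:R) :> R.
Proof.
move=> hr.
have t0 : (0 : R) < t.+1%:R by [].
have -> : (t.+2%:R : R) = t.+1%:R * (1 + t.+1%:R^-1).
  by rewrite mulrDr mulr1 mulfV ?gt_eqF // -natr1.
have h0 : (0 : R) <= 1 + t.+1%:R^-1 by apply: addr_ge0 => //; rewrite invr_ge0 ltW.
rewrite (powRM _ (ltW t0) h0).
by rewrite ler_wpM2l ?powR_ge0 //; apply: powR_le1D => //.
Qed.

(** Because [u <= u ^ s] on [[0, 1]], applied to [u = (t+1)/(t+2)]. The factor [1 - 1/(t+2)] is the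
    loss that the contraction has to cover in [decay_step]. *)
Lemma powRN_succ_ge t s : 0 <= s <= 1 ->
  t.+1%:R `^ (- s) * (1 - t.+2%:R^-1) <= t.+2%:R `^ (- s) :> R.
Proof.
move=> /andP[s0 s1].
have t1 : (0 : R) < t.+1%:R by [].
have t2 : (0 : R) < t.+2%:R by [].
rewrite !powRN.
have -> : (1 - t.+2%:R^-1 : R) = t.+1%:R / t.+2%:R.
  have e : (t.+2%:R : R) = t.+1%:R + 1 by rewrite natr1.
  rewrite e; have : (0 : R) < t.+1%:R by [].
  by move: (t.+1%:R : R) => u u0; field; rewrite ?gt_eqF //; lra.
have h : (t.+1%:R / t.+2%:R : R) <= (t.+1%:R / t.+2%:R) `^ s.
  apply: ger1_powR => //; rewrite divr_gt0 //= ler_pdivrMr // mul1r ler_nat; exact: leqnSn.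
apply: (le_trans (ler_wpM2l _ h)); first by rewrite invr_ge0 powR_ge0.
have iv : (0 : R) <= t.+2%:R^-1 by rewrite invr_ge0 ltW.
rewrite (powRM _ (ltW t1) iv) mulrA mulVf ?gt_eqF ?powR_gt0 // mul1r.
by rewrite -(powR_inv1 (ltW t2)) powRAC powR_inv1 ?powR_ge0.
Qed.

Lemma ln1DV_ge (t : nat) : t.+2%:R^-1 <= ln (t.+2%:R / t.+1%:R) :> R.
Proof.
have t1 : (0 : R) < t.+1%:R by [].
have t2 : (0 : R) < t.+2%:R by [].
have e : (t.+2%:R / t.+1%:R : R) = (1 - t.+2%:R^-1)^-1.
  have e : (t.+2%:R : R) = t.+1%:R + 1 by rewrite natr1.
  rewrite e; have : (0 : R) < t.+1%:R by [].
  by move: (t.+1%:R : R) => u u0; field; rewrite ?gt_eqF //; lra.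
have p : (0 : R) < 1 - t.+2%:R^-1.
  by rewrite -invr_gt0 -e divr_gt0.
rewrite e lnV ?posrE // lerNr; apply: le_ln1Dx.
by rewrite ltrN2 -subr_gt0.
Qed.

(** A discrete integral comparison: [exp y >= 1 + y] at [y = r ln ((t+2)/(t+1))], with
    [ln ((t+2)/(t+1)) >= 1/(t+2)]. Summation bounds the series of [t^-(1+r)] explicitly. *)
Lemma powRN_telescope t r : 0 < r ->
  r * t.+2%:R `^ (- (1 + r)) <= t.+1%:R `^ (- r) - t.+2%:R `^ (- r) :> R.
Proof.
move=> r0.
have t1 : (0 : R) < t.+1%:R by [].
have t2 : (0 : R) < t.+2%:R by [].
have -> : (t.+1%:R : R) `^ (- r) = t.+2%:R `^ (- r) * (t.+2%:R / t.+1%:R) `^ r.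
  rewrite powRM ?ltW ?invr_gt0 // mulrA -powRD; last by rewrite (gt_eqF t2) implybT.
  rewrite addNr powRr0 mul1r -powR_inv1 ?ltW // -powRrM; congr powR; ring.
rewrite opprD [- 1 + _]addrC powRD; last by rewrite (gt_eqF t2) implybT.
rewrite powR_inv1 ?(ltW t2) // -[X in _ - X]mulr1 -mulrBr.
rewrite mulrCA ler_wpM2l ?powR_ge0 // lerBrDl /powR gt_eqF ?divr_gt0 //.
apply: le_trans (expR_ge1Dx _); rewrite lerD2l ler_wpM2l ?(ltW r0) //.
exact: ln1DV_ge.
Qed.

Lemma powR_series_bounded s : 1 < s ->
  exists C : R, 0 <= C /\ forall n, \sum_(0 <= t < n) t.+1%:R `^ (- s) <= C.
Proof.
move=> s1; have r0 : 0 < s - 1 by lra.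
exists (1 + (s - 1)^-1); split; first by rewrite addr_ge0 // invr_ge0 ltW.
case=> [|n]; first by rewrite big_geq // addr_ge0 // invr_ge0 ltW.
rewrite big_nat_recl // powR1 lerD2l.
suff : \sum_(0 <= i < n) i.+2%:R `^ (- s) <= (s - 1)^-1 * (1 - n.+1%:R `^ (- (s - 1))) :> R.
  move=> h; apply: (le_trans h); rewrite ler_piMr ?invr_ge0 ?(ltW r0) //.
rewrite -ler_pdivrMl ?invr_gt0 // invrK mulr_sumr.
elim: n => [|n IH]; first by rewrite big_geq // powR1 subrr.
rewrite big_nat_recr //=.
have := @powRN_telescope n (s - 1) r0.
have -> : 1 + (s - 1) = s by ring.
lra.
Qed.

Lemma bernoulli_le x n : 0 <= x <= 1 -> 1 - n%:R * x <= (1 - x) ^+ n.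
Proof.
move=> /andP[x0 x1]; elim: n => [|n IH]; first by rewrite expr0; lra.
rewrite exprS; apply: le_trans (ler_wpM2l _ IH); last by lra.
have h0 : 0 <= n%:R * x * x by rewrite !mulr_ge0.
by rewrite -natr1; lra.
Qed.

Lemma cvg_powRN s : 0 < s -> (fun t => t.+1%:R `^ (- s) : R) @ \oo --> 0.
Proof.
move=> s0; apply/cvgrPdist_lt => e e0.
have h : \forall t \near \oo, ((e^-1 + 1) `^ s^-1) < t.+1%:R :> R.
  exists (Num.truncn ((e^-1 + 1) `^ s^-1)) => // t /= ht.
  apply: (lt_le_trans (truncnS_gt _)); by rewrite ler_nat ltnS.
apply: filterS h => t ht.
rewrite sub0r normrN ger0_norm ?powR_ge0 // powRN.
have e1 : 0 < e^-1 by rewrite invr_gt0.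
rewrite -[ltRHS]invrK ltf_pV2 ?posrE ?powR_gt0 //.
apply: (@lt_le_trans _ _ (e^-1 + 1)); first lra.
have -> : e^-1 + 1 = ((e^-1 + 1) `^ s^-1) `^ s.
  rewrite -powRrM mulVf ?gt_eqF // powRr1 //; lra.
apply: ge0_ler_powR; rewrite ?nnegrE ?powR_ge0 //; exact: ltW.
Qed.

(** Once [|v| <= e/2], the excess [q] of [|y|] over [e/2] contracts by [1 - al t]; since
    [al t >= 1/(t+1)], the product [t * q t] no longer increases, so [q] is [O(1/t)]. The lemma
    serves the sample means as well as the network average of the matrices [G_n]. *)
Lemma averaging_cvg0 (al v y : nat -> R) (t1 : nat) :
  (forall t, (t1 <= t)%N -> t.+1%:R^-1 <= al t <= 1) ->
  (forall t, (t1 <= t)%N -> y t.+1 = (1 - al t) * y t + al t * v t) ->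
  v @ \oo --> 0 -> y @ \oo --> 0.
Proof.
move=> hal hy hv; apply/cvgrPdist_le => e e0.
have e2 : 0 < e / 2 by lra.
move/cvgrPdist_le: (hv) => /(_ _ e2)[t2 _ ht2].
pose T0 := (maxn t1 t2); pose q t := Num.max 0 (`|y t| - e / 2).
have qS t : (T0 <= t)%N -> q t.+1 <= (1 - al t) * q t.
  rewrite geq_max => /andP[/[dup] h1 /hal /andP[a1 a2] /ht2/=].
  rewrite sub0r normrN => hvt.
  have a0 : 0 <= al t by apply: le_trans a1; rewrite invr_ge0.
  rewrite /q ge_max mulr_ge0 ?subr_ge0 //=; last by rewrite le_max lexx.
  rewrite hy //; apply: (@le_trans _ _ ((1 - al t) * (`|y t| - e / 2))).
    apply: (@le_trans _ _ ((1 - al t) * `|y t| + al t * `|v t| - e / 2)).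
      rewrite lerD2r; apply: (le_trans (ler_normD _ _)).
      by rewrite !normrM (ger0_norm a0) (@ger0_norm _ (1 - al t)) // subr_ge0.
    have := ler_wpM2l a0 hvt; lra.
  by rewrite ler_wpM2l ?subr_ge0 // le_max lexx orbT.
have q0 t : 0 <= q t by rewrite le_max lexx.
have qB n : (T0 + n)%:R * q (T0 + n)%N <= T0%:R * q T0.
  elim: n => [|n IH]; first by rewrite addn0.
  rewrite addnS; apply: le_trans IH.
  have hn : (T0 <= T0 + n)%N by rewrite leq_addr.
  have /andP[a1 _] := hal _ (leq_trans (leq_maxl t1 t2) hn).
  have hp : (0 : R) < (T0 + n).+1%:R by [].
  apply: (le_trans (ler_wpM2l (ltW hp) (qS _ hn))).
  rewrite mulrA ler_wpM2r // mulrBr mulr1.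
  have : 1 <= (T0 + n).+1%:R * al (T0 + n)%N by rewrite -ler_pdivrMl // mulr1.
  by rewrite -natr1; lra.
have h : \forall t \near \oo, T0%:R * q T0 / (e / 2) < t%:R :> R.
  exists (Num.truncn (T0%:R * q T0 / (e / 2))).+1 => // t /= ht.
  by apply: (lt_le_trans (truncnS_gt _)); rewrite ler_nat.
near=> t; rewrite sub0r normrN.
have ht : (T0 <= t)%N by near: t; exists T0.
have := qB (t - T0)%N; rewrite subnKC // => hq.
have h3 : T0%:R * q T0 / (e / 2) < t%:R by near: t.
have t0 : 0 < t%:R :> R by apply: le_lt_trans h3; apply: divr_ge0; [exact: mulr_ge0|exact: ltW].
have : q t <= e / 2.
  rewrite -(ler_pM2l t0); apply: (le_trans hq).
  by rewrite -ler_pdivrMr // ltW.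
rewrite /q ge_max => /andP[_]; lra.
Unshelve. all: by end_near. Qed.

Lemma cvg0_le (u v : nat -> R) : (\forall t \near \oo, `|u t| <= v t) ->
  v @ \oo --> 0 -> u @ \oo --> 0.
Proof.
move=> uv /cvgrPdist_lt hv; apply/cvgrPdist_lt => e e0.
apply: filterS2 uv (hv e e0) => t h1; rewrite !sub0r !normrN => h2.
exact: (le_lt_trans h1 (le_lt_trans (ler_norm _) h2)).
Qed.

Lemma cvg0_cst : (fun _ : nat => 0 : R) @ \oo --> 0.
Proof. by apply/cvgrPdist_lt => e e0; apply: nearW => t; rewrite subrr normr0. Qed.

Lemma cvg0D (u v : nat -> R) : u @ \oo --> 0 -> v @ \oo --> 0 ->
  (fun t => u t + v t) @ \oo --> 0.
Proof. by move=> hu hv; rewrite -[0]addr0; exact: cvgD. Qed.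

Lemma cvg0Z (c : R) (u : nat -> R) : u @ \oo --> 0 -> (fun t => c * u t) @ \oo --> 0.
Proof. by move=> hu; rewrite -(mulr0 c); exact: cvgMr. Qed.

Lemma cvg0M (u v : nat -> R) : u @ \oo --> 0 -> v @ \oo --> 0 ->
  (fun t => u t * v t) @ \oo --> 0.
Proof. by move=> hu hv; rewrite -(mulr0 0); exact: cvgM. Qed.

Lemma cvg0_norm (u : nat -> R) : u @ \oo --> 0 -> (fun t => `|u t|) @ \oo --> 0.
Proof.
move=> /cvgrPdist_lt hu; apply/cvgrPdist_lt => e e0; apply: filterS (hu e e0) => t.
by rewrite !sub0r !normrN normr_id.
Qed.

Lemma cvg0_sum (I : Type) (r : seq I) (u : I -> nat -> R) :
  (forall i, u i @ \oo --> 0) -> (fun t => \sum_(i <- r) u i t) @ \oo --> 0.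
Proof.
move=> hu; elim: r => [|x r IH].
  by under eq_fun do rewrite big_nil; exact: cvg0_cst.
by under eq_fun do rewrite big_cons; exact: cvg0D.
Qed.

Lemma cvg0_ext (u v : nat -> R) : u =1 v -> u @ \oo --> 0 -> v @ \oo --> 0.
Proof. by move=> /funext ->. Qed.

End RealSequences.

(** * Frobenius inner product and norm *)

Section Frobenius.
Context {R : realType}.

Definition mxdot {m n : nat} (A B : 'M[R]_(m, n)) : R :=
  \sum_i \sum_j A i j * B i j.

Definition fnorm {m n : nat} (A : 'M[R]_(m, n)) : R := Num.sqrt (mxdot A A).

Lemma mxdotC m n (A B : 'M[R]_(m, n)) : mxdot A B = mxdot B A.
Proof. by apply: eq_bigr => i _; apply: eq_bigr => j _; rewrite mulrC. Qed.

Lemma mxdotDl m n (A B C : 'M[R]_(m, n)) : mxdot (A + B) C = mxdot A C + mxdot B C.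
Proof.
rewrite -big_split; apply: eq_bigr => i _; rewrite -big_split.
by apply: eq_bigr => j _; rewrite mxE mulrDl.
Qed.

Lemma mxdotZl m n c (A C : 'M[R]_(m, n)) : mxdot (c *: A) C = c * mxdot A C.
Proof.
rewrite mulr_sumr; apply: eq_bigr => i _; rewrite mulr_sumr.
by apply: eq_bigr => j _; rewrite mxE mulrA.
Qed.

Lemma mxdotDr m n (A B C : 'M[R]_(m, n)) : mxdot C (A + B) = mxdot C A + mxdot C B.
Proof. by rewrite mxdotC mxdotDl !(mxdotC _ C). Qed.

Lemma mxdotZr m n c (A C : 'M[R]_(m, n)) : mxdot C (c *: A) = c * mxdot C A.
Proof. by rewrite mxdotC mxdotZl (mxdotC C). Qed.

Lemma mxdot_ge0 m n (A : 'M[R]_(m, n)) : 0 <= mxdot A A.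
Proof. by apply: sumr_ge0 => i _; apply: sumr_ge0 => j _; rewrite -expr2 sqr_ge0. Qed.

Lemma sqr_entry_le_mxdot m n (A : 'M[R]_(m, n)) i j : A i j ^+ 2 <= mxdot A A.
Proof.
rewrite /mxdot (bigD1 i) //= (bigD1 j) //= -expr2 -addrA lerDl addr_ge0 //.
  by apply: sumr_ge0 => k _; rewrite -expr2 sqr_ge0.
by apply: sumr_ge0 => k _; apply: sumr_ge0 => l _; rewrite -expr2 sqr_ge0.
Qed.

Lemma fnorm_ge0 m n (A : 'M[R]_(m, n)) : 0 <= fnorm A.
Proof. exact: sqrtr_ge0. Qed.

Lemma fnorm_sqr m n (A : 'M[R]_(m, n)) : fnorm A ^+ 2 = mxdot A A.
Proof. by rewrite sqr_sqrtr // mxdot_ge0. Qed.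

Lemma ler_fnorm_entry m n (A : 'M[R]_(m, n)) i j : `|A i j| <= fnorm A.
Proof. by rewrite -sqrtr_sqr ler_wsqrtr // sqr_entry_le_mxdot. Qed.

Lemma quadratic_discr (a b c : R) : 0 <= c ->
  (forall t, 0 <= a - 2 * t * b + t ^+ 2 * c) -> b ^+ 2 <= a * c.
Proof.
move=> c0 h; have [c00|cn0] := eqVneq c 0.
  rewrite c00 mulr0; have [->|b0] := eqVneq b 0; first by rewrite expr0n.
  (* With [c = 0] and [b] nonzero the form is affine in [t], and this [t] gives it the value
     [-1]. *)
  have := h ((a + 1) / (2 * b)); rewrite c00 mulr0 addr0.
  have -> : 2 * ((a + 1) / (2 * b)) * b = a + 1 by field.
  lra.
have cp : 0 < c by rewrite lt0r cn0 c0.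
have := h (b / c).
have -> : a - 2 * (b / c) * b + (b / c) ^+ 2 * c = (a * c - b ^+ 2) / c by field.
by rewrite pmulr_lge0 ?invr_gt0 // subr_ge0.
Qed.

Lemma mxdot_CS m n (A B : 'M[R]_(m, n)) : mxdot A B ^+ 2 <= mxdot A A * mxdot B B.
Proof.
apply: quadratic_discr; first exact: mxdot_ge0.
move=> t; have := mxdot_ge0 (A + (- t) *: B).
rewrite mxdotDl !mxdotDr !mxdotZl !mxdotZr (mxdotC B A); lra.
Qed.

Lemma ler_mxdot m n (A B : 'M[R]_(m, n)) : mxdot A B <= fnorm A * fnorm B.
Proof.
apply: (le_trans (ler_norm _)); rewrite -sqrtrM ?mxdot_ge0 //.
by rewrite -sqrtr_sqr ler_wsqrtr // mxdot_CS.
Qed.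

Lemma ler_fnormD m n (A B : 'M[R]_(m, n)) : fnorm (A + B) <= fnorm A + fnorm B.
Proof.
rewrite -(@ler_pXn2r _ 2) ?nnegrE ?addr_ge0 ?fnorm_ge0 //.
rewrite sqrrD !fnorm_sqr mxdotDl !mxdotDr (mxdotC B A).
have := ler_mxdot A B; lra.
Qed.

Lemma fnormZ m n c (A : 'M[R]_(m, n)) : fnorm (c *: A) = `|c| * fnorm A.
Proof.
by rewrite /fnorm mxdotZl mxdotZr mulrA -expr2 sqrtrM ?sqr_ge0 // sqrtr_sqr.
Qed.

Lemma fnorm0 m n : fnorm (0 : 'M[R]_(m, n)) = 0.
Proof. by rewrite -(scale0r (0 : 'M[R]_(m, n))) fnormZ normr0 mul0r. Qed.

Lemma fnormN m n (A : 'M[R]_(m, n)) : fnorm (- A) = fnorm A.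
Proof. by rewrite -scaleN1r fnormZ normrN normr1 mul1r. Qed.

Lemma ler_fnormB m n (A B : 'M[R]_(m, n)) : fnorm (A - B) <= fnorm A + fnorm B.
Proof. by rewrite -(fnormN B) ler_fnormD. Qed.

Lemma ler_fnorm_sum m n (I : Type) (r : seq I) (Q : pred I) (F : I -> 'M[R]_(m, n)) :
  fnorm (\sum_(i <- r | Q i) F i) <= \sum_(i <- r | Q i) fnorm (F i).
Proof.
elim/big_ind2: _ => [|A x B y hA hB|//]; first by rewrite fnorm0.
by apply: (le_trans (ler_fnormD _ _)); apply: lerD.
Qed.

Lemma fnorm_tr m n (A : 'M[R]_(m, n)) : fnorm A^T = fnorm A.
Proof.
rewrite /fnorm /mxdot exchange_big; congr Num.sqrt.
by apply: eq_bigr => i _; apply: eq_bigr => j _; rewrite !mxE.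
Qed.

Lemma fnorm_vnorm n (v : 'cV[R]_n) : vnorm v = fnorm v.
Proof.
by rewrite /vnorm /fnorm /mxdot; congr Num.sqrt; apply: eq_bigr => i _;
  rewrite big_ord1 expr2.
Qed.

Lemma ler_fnormM m n p (A : 'M[R]_(m, n)) (B : 'M[R]_(n, p)) :
  fnorm (A *m B) <= fnorm A * fnorm B.
Proof.
rewrite -sqrtrM ?mxdot_ge0 // ler_wsqrtr //.
have -> : mxdot A A * mxdot B B = \sum_i \sum_k
    (\sum_j A i j * A i j) * (\sum_j B j k * B j k).
  rewrite /mxdot mulr_suml; apply: eq_bigr => i _.
  by rewrite [X in _ * X]exchange_big mulr_sumr.
apply: ler_sum => i _; apply: ler_sum => k _; rewrite -expr2 mxE.
have := mxdot_CS (row i A) (col k B)^T; rewrite /mxdot !big_ord1.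
by under eq_bigr do rewrite !mxE; under [X in _ <= X * _ -> _]eq_bigr do rewrite !mxE;
  under [X in _ <= _ * X -> _]eq_bigr do rewrite !mxE.
Qed.

Lemma fnorm_le_sum m n (A : 'M[R]_(m, n)) : fnorm A <= \sum_i \sum_j `|A i j|.
Proof.
rewrite [A in fnorm A]matrix_sum_delta.
apply: (le_trans (ler_fnorm_sum _ _ _)); apply: ler_sum => i _.
apply: (le_trans (ler_fnorm_sum _ _ _)); apply: ler_sum => j _.
rewrite fnormZ ler_piMr //.
rewrite /fnorm /mxdot (bigD1 i) //= (bigD1 j) //= !mxE !eqxx /= mulr1.
rewrite !big1 ?addr0 ?sqrtr1 // => [k /negbTE hk|k /negbTE hk].
  by rewrite big1 // => l _; rewrite mxE hk /= mulr0.
by rewrite mxE hk /= andbF mulr0.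
Qed.

End Frobenius.

(** * From a positive second eigenvalue to coercivity on sum-zero vectors *)

Section Spectral.
Context {R : realType}.

(** Geometric multiplicity of the eigenvalue [0] bounds the algebraic one. In a row basis [S] whose
    first [r] rows span the left kernel, the first [r] rows of [S (X - A)] are [X] times those of
    [S], so [X^r] comes out of the determinant, and [det S] is a unit. *)
Lemma char_poly_kernel_dvd n (A : 'M[R]_n) : 'X^(n - \rank A) %| char_poly A.
Proof.
set r := (n - \rank A)%N; pose K := kermx A; pose S := row_ebase K.
have Sunit : S \in unitmx by exact: row_ebase_unit.
have rK : \rank K = r by rewrite mxrank_ker.
have SA (i j : 'I_n) : (i < r)%N -> (S *m A) i j = 0.
  move=> ir.
  have h : pid_mx r *m S *m A = 0 :> 'M[R]_n.
    have -> : pid_mx r *m S = invmx (col_ebase K) *m K.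
      by rewrite -{2}(mulmx_ebase K) rK !mulmxA mulVmx ?col_ebase_unit // mul1mx.
    by rewrite -mulmxA mulmx_ker mulmx0.
  have := congr1 (fun B : 'M[R]_n => B i j) h.
  rewrite -mulmxA mxE (bigD1 i) //= mxE eqxx ir mul1r big1 ?addr0 ?mxE // => k ki.
  by rewrite mxE val_eqE eq_sym (negbTE ki) mul0r.
pose Sp := map_mx polyC S; pose B := Sp *m char_poly_mx A.
have BE i j : B i j = 'X * (S i j)%:P - ((S *m A) i j)%:P.
  rewrite /B /char_poly_mx mulmxBr !mxE; congr (_ - _).
    rewrite (bigD1 j) //= !mxE eqxx mulr1n big1 ?addr0 1?mulrC // => k kj.
    by rewrite !mxE (negbTE kj) mulr0n mulr0.
  by rewrite rmorph_sum; apply: eq_bigr => k _; rewrite !mxE rmorphM.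
pose D := diag_mx (\row_(i < n) (if (i < r)%N then 'X else 1 : {poly R})).
pose B' := \matrix_(i, j) (if (i < r)%N then (S i j)%:P else B i j).
have BD : B = D *m B'.
  apply/matrixP => i j; rewrite mul_diag_mx [RHS]mxE [X in X * _]mxE [X in _ * X]mxE.
  by case: ifP => ir; [rewrite BE SA // subr0|rewrite mul1r].
have detD : \det D = 'X^r.
  rewrite det_diag (eq_bigr (fun i : 'I_n => if (i < r)%N then 'X else 1)); last first.
    by move=> i _; rewrite mxE.
  rewrite -big_mkcond /= prodr_const; congr (_ ^+ _).
  rewrite -sum1_card (big_ord_narrow (leq_subr _ _)) /= sum1_card card_ord //.
have : 'X^r %| (\det S)%:P * char_poly A.
  by rewrite /char_poly -det_map_mx -det_mulmx -/B BD det_mulmx detD dvdp_mulr.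
by rewrite mul_polyC dvdpZr // -unitfE -unitmxE.
Qed.

Definition qform {n} (A : 'M[R]_n) (x y : 'cV[R]_n) : R := (x^T *m A *m y) 0 0.

Lemma qformDl n (A : 'M[R]_n) x y z : qform A (x + y) z = qform A x z + qform A y z.
Proof. by rewrite /qform linearD /= !mulmxDl mxE. Qed.

Lemma qformDr n (A : 'M[R]_n) x y z : qform A z (x + y) = qform A z x + qform A z y.
Proof. by rewrite /qform !mulmxDr mxE. Qed.

Lemma qformZl n (A : 'M[R]_n) c x z : qform A (c *: x) z = c * qform A x z.
Proof. by rewrite /qform linearZ /= -!scalemxAl mxE. Qed.

Lemma qformZr n (A : 'M[R]_n) c x z : qform A z (c *: x) = c * qform A z x.
Proof. by rewrite /qform -!scalemxAr mxE. Qed.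

Lemma qformC n (A : 'M[R]_n) x y : A^T = A -> qform A x y = qform A y x.
Proof.
move=> sA; rewrite /qform.
have -> : (x^T *m A *m y) 0 0 = (x^T *m A *m y)^T 0 0 by rewrite [RHS]mxE.
by rewrite !trmx_mul trmxK sA mulmxA.
Qed.

Lemma qform_CS n (A : 'M[R]_n) x y : A^T = A -> (forall v, 0 <= qform A v v) ->
  qform A x y ^+ 2 <= qform A x x * qform A y y.
Proof.
move=> sA pA; apply: quadratic_discr => // t.
have := pA (x + (- t) *: y).
rewrite qformDl !qformDr !qformZl !qformZr (qformC y x sA); lra.
Qed.

Lemma mxdot_col n (x y : 'cV[R]_n) : mxdot x y = (x^T *m y) 0 0.
Proof. by rewrite mxE; apply: eq_bigr => i _; rewrite big_ord1 mxE. Qed.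

(* Cauchy-Schwarz for the form [A], applied to [v] and [A^-1 v], gives
   [|v|^4 <= A(v, v) * |A^-1| * |v|^2]. *)
Lemma pd_coercive n (A : 'M[R]_n) : A^T = A -> (forall v, 0 <= qform A v v) ->
  (forall v, qform A v v = 0 -> v = 0) ->
  exists2 c : R, 0 < c & forall v, c * mxdot v v <= qform A v v.
Proof.
move=> sA pA dA.
have uA : A \in unitmx.
  rewrite -row_free_unit -kermx_eq0; apply/eqP/row_matrixP => i; rewrite row0.
  have h : row i (kermx A) *m A = 0 by rewrite -row_mul mulmx_ker row0.
  apply: trmx_inj; rewrite trmx0; apply: dA.
  by rewrite /qform trmxK h mul0mx mxE.
have siA : (invmx A)^T = invmx A by rewrite trmx_inv sA.
exists (fnorm (invmx A) + 1)^-1; first by rewrite invr_gt0 ltr_wpDl ?fnorm_ge0.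
move=> v; have [v0|v0] := eqVneq (mxdot v v) 0; first by rewrite v0 mulr0.
have vp : 0 < mxdot v v by rewrite lt0r v0 mxdot_ge0.
have F0 := fnorm_ge0 (invmx A).
rewrite ler_pdivrMl ?ltr_wpDl //.
have h1 : mxdot v v = qform A v (invmx A *m v).
  by rewrite mxdot_col /qform -!mulmxA (mulKVmx uA).
have h2 : qform A (invmx A *m v) (invmx A *m v) <= fnorm (invmx A) * mxdot v v.
  rewrite /qform -!mulmxA (mulKVmx uA) -mxdot_col.
  apply: (le_trans (ler_mxdot _ _)); rewrite -fnorm_sqr expr2 mulrA.
  by rewrite ler_wpM2r ?fnorm_ge0 // ler_fnormM.
have h3 := qform_CS v (invmx A *m v) sA pA.
rewrite -(ler_pM2r vp) -expr2 {1}h1; apply: (le_trans h3).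
rewrite [leRHS]mulrAC mulrC ler_wpM2r //; apply: (le_trans h2).
by rewrite ler_wpM2r ?mxdot_ge0 // lerDl.
Qed.

Lemma coprimep_X_prod_pos (s : seq R) : all (fun x => 0 < x) s ->
  coprimep 'X (\prod_(x <- s) ('X - x%:P)).
Proof.
move=> h; have eX : 'X - 0%:P = 'X :> {poly R} by rewrite subr0.
rewrite -[X in coprimep X _]eX coprimep_sym coprimep_XsubC rootE horner_prod prodf_seq_neq0.
apply/allP => x xs.
by rewrite hornerXsubC sub0r oppr_eq0 /= gt_eqF // (allP h).
Qed.

(* A second kernel vector, orthogonal to the constants, would make ['X^2] divide
   the characteristic polynomial and so the second eigenvalue vanish. *)
Lemma lambda2_pos_coercive n (A : 'M[R]_n) : A^T = A ->
  (forall v, 0 <= qform A v v) -> A *m const_mx 1 = 0 :> 'cV[R]_n -> lambda2_pos A ->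
  exists2 c : R, 0 < c &
    forall v : 'cV[R]_n, \sum_i v i 0 = 0 -> c * mxdot v v <= qform A v v.
Proof.
move=> sA pA A1 [s [[ss cs] s1]].
pose o : 'cV[R]_n := const_mx 1.
have ov (v : 'cV[R]_n) : (o^T *m v) 0 0 = \sum_i v i 0.
  by rewrite mxE; apply: eq_bigr => i _; rewrite !mxE mul1r.
(* The added form is the square of the coordinate sum: it vanishes on the vectors of interest and
   removes the constants from the kernel, so that [pd_coercive] applies on the whole space. *)
pose B := A + o *m o^T.
have qB v : qform B v v = qform A v v + (\sum_i v i 0) ^+ 2.
  rewrite /qform /B mulmxDr mulmxDl mxE; congr (_ + _).
  rewrite -mulmxA -mulmxA mulmxA mxE big_ord1 ov expr2; congr (_ * _).
  by rewrite -ov mxE mxE; apply: eq_bigr => i _; rewrite !mxE mulrC.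
have [|||c c0 hc] := @pd_coercive _ B.
- by rewrite /B linearD /= sA trmx_mul trmxK.
- by move=> v; rewrite qB addr_ge0 ?sqr_ge0.
- move=> v; rewrite qB => /eqP; rewrite paddr_eq0 ?sqr_ge0 // sqrf_eq0 => /andP[/eqP qv /eqP sv].
  apply/eqP/negP => /negP v0.
  have vA : v^T *m A = 0.
    apply/matrixP => i j; rewrite ord1 [RHS]mxE.
    have := qform_CS v (delta_mx j 0) sA pA; rewrite qv mul0r => h.
    have /eqP : qform A v (delta_mx j 0) ^+ 2 = 0 by apply/eqP; rewrite eq_le h sqr_ge0.
    by rewrite sqrf_eq0 => /eqP; rewrite /qform -colE mxE.
  have oA : o^T *m A = 0.
    by apply: trmx_inj; rewrite trmx_mul trmxK sA A1 trmx0.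
  have s2 : (1 < size s)%N.
    by rewrite ltnNge; apply/negP => hs; rewrite nth_default // ltxx in s1.
  have sz : size s = n.
    have := congr1 (fun p : {poly R} => size p) cs.
    by rewrite /= size_char_poly size_prod_XsubC => -[].
  have n0 : (0 < n)%N by rewrite -sz; apply: leq_trans s2.
  have rk : (2 <= n - \rank A)%N.
    rewrite -mxrank_ker.
    have sub : (o^T + v^T <= kermx A)%MS.
      by rewrite addsmx_sub; apply/andP; split; apply/sub_kermxP.
    apply: leq_trans (mxrankS sub).
    rewrite mxrank_disjoint_sum.
      rewrite !rank_rV -[X in (X < _)%N]/(1%N).
      have -> : v^T != 0 by rewrite -trmx0 (inj_eq trmx_inj).
      have -> // : o^T != 0.
      apply/eqP => /matrixP /(_ 0 (Ordinal n0)); rewrite !mxE => /eqP.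
      by rewrite oner_eq0.
    apply/eqP; rewrite -submx0; apply/rV_subP => x.
    rewrite sub_capmx => /andP[/sub_rVP[a xa] /sub_rVP[b xb]].
    have xx : x *m x^T = 0.
      rewrite {1}xa xb linearZ /= trmxK -scalemxAl -scalemxAr.
      have -> : o^T *m v = 0 by apply/matrixP => i j; rewrite !ord1 ov sv mxE.
      by rewrite !scaler0.
    rewrite submx0; apply/eqP/rowP => j; rewrite mxE; apply/eqP.
    rewrite -sqrf_eq0 eq_le sqr_ge0 andbT.
    have := congr1 (fun C : 'M[R]_1 => C 0 0) xx; rewrite !mxE => <-.
    rewrite (bigD1 j) //= mxE -expr2 lerDl sumr_ge0 // => k _.
    by rewrite mxE -expr2 sqr_ge0.
  have dv : 'X^2 %| char_poly A.
    by apply: dvdp_trans (char_poly_kernel_dvd A); rewrite dvdp_exp2l.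
  case: s ss cs s1 s2 sz => [//|x0 [//|x1 s']] ss cs s1 _ _.
  have pos : all (fun x => 0 < x) (x1 :: s').
    move: ss s1 => /= /andP[_ ps] x1p; rewrite x1p /=.
    move: ps; rewrite (path_sortedE le_trans) => /andP[ha _].
    by apply: sub_all ha => y /(lt_le_trans x1p).
  (* The list is sorted, so all roots from the second on are positive and [X] is coprime to their
     product; then [X^2] would divide the linear factor [X - x0]. *)
  move: dv; rewrite cs big_cons Gauss_dvdpl; last first.
    by rewrite coprimep_expl // coprimep_X_prod_pos.
  move=> /dvdp_leq; rewrite polyXsubC_eq0 size_polyXn size_XsubC.
  by move=> /(_ isT).
- exists c => // v sv; have := hc v; by rewrite qB sv expr0n addr0.
Qed.

End Spectral.

(** * Quadratic forms of graph Laplacians *)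

Section Laplacian.
Context {R : realType}.

(** The Dirichlet energy of the graph with edge weights [- L i j], summed over the columns of [Z]:
    the pure squares drop out by zero row sums and, through symmetry, zero column sums. Real weights
    are allowed because the mean Laplacian no longer has entries [0] and [-1]. *)
Lemma laplacian_qform n q (L : 'M[R]_n) (Z : 'M[R]_(n, q)) :
  L^T = L -> (forall i, \sum_j L i j = 0) ->
  mxdot Z (L *m Z) =
    2^-1 * \sum_k \sum_i \sum_j (- L i j) * (Z i k - Z j k) ^+ 2.
Proof.
move=> sL rL; rewrite /mxdot exchange_big mulr_sumr; apply: eq_bigr => k _.
have -> : \sum_i \sum_j - L i j * (Z i k - Z j k) ^+ 2 =
   \sum_i \sum_j (- L i j * Z i k ^+ 2) + \sum_i \sum_j (- L i j * Z j k ^+ 2)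
   + 2 * \sum_i \sum_j Z i k * (L i j * Z j k).
  rewrite mulr_sumr -!big_split; apply: eq_bigr => i _.
  by rewrite /= mulr_sumr -!big_split; apply: eq_bigr => j _ /=; ring.
rewrite [X in X + _ + _]big1; last first.
  by move=> i _; rewrite -mulr_suml sumrN rL oppr0 mul0r.
rewrite exchange_big [X in _ + X + _]big1; last first.
  move=> i _; rewrite -mulr_suml sumrN.
  by rewrite (eq_bigr (fun j => L i j)) ?rL ?oppr0 ?mul0r // => j _; rewrite -{1}sL mxE.
rewrite !add0r mulrA mulVf ?mul1r ?pnatr_eq0 //.
by apply: eq_bigr => i _; rewrite mxE mulr_sumr.
Qed.

Lemma simple_laplacian_sym n (L : 'M[R]_n) : is_simple_laplacian L -> L^T = L.
Proof. by move=> hL; apply/matrixP => i j; rewrite mxE; case: (hL j i). Qed.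

Lemma simple_laplacian_row n (L : 'M[R]_n) : is_simple_laplacian L ->
  forall i, \sum_j L i j = 0.
Proof. by move=> hL i; case: (hL i i) => _ _ h; rewrite (bigD1 i) //= h addNr. Qed.

Lemma simple_laplacian_entry n (L : 'M[R]_n) : is_simple_laplacian L ->
  forall i j, `|L i j| <= n%:R.
Proof.
move=> hL i j; have [<-|ij] := eqVneq i j; last first.
  case: (hL i j) => /(_ ij) [] -> _ _; rewrite ?normrN ?normr0 ?normr1 //.
  by rewrite ler1n; apply: leq_ltn_trans (ltn_ord i).
case: (hL i i) => _ _ ->; rewrite normrN; apply: (le_trans (ler_norm_sum _ _ _)).
apply: (@le_trans _ _ (\sum_(k < n) 1)); last by rewrite sumr_const card_ord.
rewrite [leLHS]big_mkcond /=; apply: ler_sum => k _; case: ifP => // ki.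
by case: (hL i k) => + _ _; rewrite eq_sym => /(_ ki) [] ->; rewrite ?normrN ?normr0 ?normr1.
Qed.

Lemma simple_laplacian_offdiag n (L : 'M[R]_n) : is_simple_laplacian L ->
  forall i j, i != j -> 0 <= - L i j.
Proof.
by move=> hL i j ij; case: (hL i j) => /(_ ij) [] -> _ _; rewrite ?oppr0 ?opprK.
Qed.

Lemma laplacian_qform_ge0 n q (L : 'M[R]_n) (Z : 'M[R]_(n, q)) :
  L^T = L -> (forall i, \sum_j L i j = 0) ->
  (forall i j, i != j -> 0 <= - L i j) -> 0 <= mxdot Z (L *m Z).
Proof.
move=> sL rL oL; rewrite laplacian_qform // mulr_ge0 ?invr_ge0 //.
apply: sumr_ge0 => k _; apply: sumr_ge0 => i _; apply: sumr_ge0 => j _.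
have [->|ij] := eqVneq i j; first by rewrite subrr expr0n mulr0.
by rewrite mulr_ge0 ?sqr_ge0 ?oL.
Qed.

Lemma simple_laplacian_qform_ge0 n q (L : 'M[R]_n) (Z : 'M[R]_(n, q)) :
  is_simple_laplacian L -> 0 <= mxdot Z (L *m Z).
Proof.
move=> hL; apply: laplacian_qform_ge0; [exact: simple_laplacian_sym|exact: simple_laplacian_row|].
exact: simple_laplacian_offdiag.
Qed.

Lemma sqr_sum_le n (u : 'I_n -> R) : (\sum_j u j) ^+ 2 <= n%:R * \sum_j u j ^+ 2.
Proof.
have := mxdot_CS (const_mx 1 : 'rV[R]_n) (\row_j u j); rewrite /mxdot !big_ord1.
under eq_bigr do rewrite !mxE mul1r.
under [X in _ <= X * _ -> _]eq_bigr do rewrite !mxE mul1r.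
under [X in _ <= _ * X -> _]eq_bigr do rewrite !mxE -expr2.
by rewrite sumr_const card_ord.
Qed.

(** An operator bound [L^2 <= 2 n L] without eigenvalues: Cauchy-Schwarz in each row, and edge
    weights [0] or [1] equal their squares, so squaring returns the Dirichlet energy. *)
Lemma simple_laplacian_sqr n q (L : 'M[R]_n) (Z : 'M[R]_(n, q)) :
  is_simple_laplacian L ->
  mxdot (L *m Z) (L *m Z) <= 2 * n%:R * mxdot Z (L *m Z).
Proof.
move=> hL; rewrite laplacian_qform; [|exact: simple_laplacian_sym|exact: simple_laplacian_row].
rewrite mulrA [2 * _]mulrC mulfK ?pnatr_eq0 // /mxdot exchange_big mulr_sumr.
apply: ler_sum => k _; rewrite mulr_sumr; apply: ler_sum => i _; rewrite -expr2.
have -> : (L *m Z) i k = \sum_j (- L i j) * (Z i k - Z j k).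
  rewrite mxE; under [RHS]eq_bigr do rewrite mulrBr mulNr.
  rewrite sumrB sumrN -mulr_suml simple_laplacian_row // mul0r oppr0 sub0r -sumrN.
  by apply: eq_bigr => j _; rewrite mulNr opprK.
apply: (le_trans (sqr_sum_le _)); rewrite ler_wpM2l //; apply: ler_sum => j _.
have [->|ij] := eqVneq i j; first by rewrite subrr !mulr0 expr0n mulr0.
by case: (hL i j) => /(_ ij) [] -> _ _; rewrite exprMn ?oppr0 ?opprK ?expr0n ?expr1n ?mul0r.
Qed.

(** The first-order gain is [2 b] times the energy, and the second-order term costs at most
    [2 n b^2] times the energy, hence at most half of that gain. *)
Lemma simple_laplacian_step n q (L : 'M[R]_n) (Z : 'M[R]_(n, q)) (b : R) :
  is_simple_laplacian L -> 0 <= b -> 2 * n%:R * b <= 1 ->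
  mxdot (Z - b *: (L *m Z)) (Z - b *: (L *m Z)) <= mxdot Z Z - b * mxdot Z (L *m Z).
Proof.
move=> hL b0 b1; rewrite -scaleNr mxdotDl !mxdotDr !mxdotZl !mxdotZr (mxdotC (L *m Z) Z).
have q0 := simple_laplacian_qform_ge0 Z hL.
have h := simple_laplacian_sqr Z hL.
have h1 := ler_wpM2l b0 h; have h2 := ler_wpM2l b0 h1.
have h3 := ler_wpM2r (mulr_ge0 b0 q0) b1.
lra.
Qed.

End Laplacian.

(** * Real-valued expectations, summability, and almost supermartingales *)

Section Expectation.
Context {d : measure_display} {T : measurableType d} {R : realType}.
Variable P : probability T R.
Implicit Types (f g : T -> R) (c : R).

Definition Lint f := P.-integrable setT (EFin \o f).
(** A real number in all cases, since [fine] sends an infinite integral to [0]; this is why the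
    arithmetic rules ask for [Lint]. *)
Definition Er f : R := fine (\int[P]_w (f w)%:E).

Lemma Lint_meas f : Lint f -> measurable_fun setT f.
Proof. by move=> /integrableP[/measurable_EFinP]. Qed.

Lemma ErE f : Lint f -> (\int[P]_w (f w)%:E = (Er f)%:E)%E.
Proof. by move=> hf; rewrite fineK // integrable_fin_num. Qed.

Lemma LintD f g : Lint f -> Lint g -> Lint (fun w => f w + g w).
Proof. by move=> hf hg; apply: eq_integrable (integrableD measurableT hf hg). Qed.

Lemma LintZ c f : Lint f -> Lint (fun w => c * f w).
Proof. by move=> hf; apply: eq_integrable (integrableZl measurableT c hf). Qed.

Lemma LintB f g : Lint f -> Lint g -> Lint (fun w => f w - g w).
Proof. by move=> hf hg; apply: eq_integrable (integrableB measurableT hf hg). Qed.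

Lemma Lint_cst c : Lint (fun=> c).
Proof. exact: finite_measure_integrable_cst. Qed.

Lemma Lint_le f g : measurable_fun setT f -> (forall w, `|f w| <= g w) -> Lint g -> Lint f.
Proof.
move=> mf fg; apply: le_integrable => //; first exact/measurable_EFinP.
by move=> w _ /=; rewrite lee_fin (le_trans (fg w)) // ler_norm.
Qed.

Lemma Lint_norm f : Lint f -> Lint (fun w => `|f w|).
Proof.
by move=> hf; exact: (integrable_norm hf).
Qed.

Lemma Lint_sum (I : Type) (r : seq I) (Q : pred I) (h : I -> T -> R) :
  (forall i, Lint (h i)) -> Lint (fun w => \sum_(i <- r | Q i) h i w).
Proof.
move=> hh; elim: r => [|x r IH].
  by under [X in Lint X]eq_fun do rewrite big_nil; exact: Lint_cst.
under [X in Lint X]eq_fun do rewrite big_cons; case: (Q x) => //.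
exact: LintD.
Qed.

Lemma Er_ge0 f : (forall w, 0 <= f w) -> 0 <= Er f.
Proof. by move=> f0; apply: fine_ge0; apply: integral_ge0 => w _; rewrite lee_fin. Qed.

Lemma Er_le f g : Lint f -> Lint g -> (forall w, f w <= g w) -> Er f <= Er g.
Proof.
move=> hf hg fg; rewrite -lee_fin -!ErE //.
by apply: le_integral => // w _; rewrite lee_fin.
Qed.

Lemma ErD f g : Lint f -> Lint g -> Er (fun w => f w + g w) = Er f + Er g.
Proof.
move=> hf hg; apply: EFin_inj; rewrite EFinD -!ErE //; last exact: LintD.
by rewrite -integralD_EFin.
Qed.

Lemma ErZ c f : Lint f -> Er (fun w => c * f w) = c * Er f.
Proof.
move=> hf; apply: EFin_inj; rewrite EFinM -!ErE //; last exact: LintZ.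
by rewrite -integralZl.
Qed.

Lemma ErB f g : Lint f -> Lint g -> Er (fun w => f w - g w) = Er f - Er g.
Proof.
move=> hf hg; rewrite -[- Er g]mulN1r -ErZ // -ErD //; last exact: LintZ.
by congr Er; apply/funext => w; rewrite mulN1r.
Qed.

Lemma Er_cst c : Er (fun=> c) = c.
Proof. by rewrite /Er integral_cst //= probability_setT mule1. Qed.

Lemma Er_sum (I : Type) (r : seq I) (Q : pred I) (h : I -> T -> R) :
  (forall i, Lint (h i)) ->
  Er (fun w => \sum_(i <- r | Q i) h i w) = \sum_(i <- r | Q i) Er (h i).
Proof.
move=> hh; elim: r => [|x r IH].
  by under [X in Er X]eq_fun do rewrite big_nil; rewrite big_nil Er_cst.
under [X in Er X]eq_fun do rewrite big_cons.
rewrite big_cons; case: (Q x) => //.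
by rewrite ErD // ?IH //; exact: Lint_sum.
Qed.

Lemma Lint_bounded f c : measurable_fun setT f -> (forall w, `|f w| <= c) -> Lint f.
Proof. by move=> mf fc; apply: Lint_le (Lint_cst c). Qed.

Lemma Lint_sqr_mul f g : measurable_fun setT f -> measurable_fun setT g ->
  Lint (fun w => f w ^+ 2) -> Lint (fun w => g w ^+ 2) -> Lint (fun w => f w * g w).
Proof.
move=> mf mg hf hg; apply: Lint_le (LintD hf hg); first exact: measurable_funM.
move=> w; rewrite normrM -(real_normK (num_real (f w))) -(real_normK (num_real (g w))).
have := sqr_ge0 (`|f w| - `|g w|); rewrite sqrrB mulr2n.
have := mulr_ge0 (normr_ge0 (f w)) (normr_ge0 (g w)); lra.
Qed.

Lemma measurable_indicT (A : set T) : measurable A ->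
  measurable_fun setT (\1_A : T -> R).
Proof. by move=> mA; exact: measurable_indic. Qed.

Lemma Lint_indicM (A : set T) f : measurable A -> Lint f -> Lint (fun w => \1_A w * f w).
Proof.
move=> mA hf; apply: Lint_le (Lint_norm hf).
  by apply: measurable_funM; [exact: measurable_indicT|exact: Lint_meas].
by move=> w; rewrite normrM ler_piMl // indicE; case: (_ \in _); rewrite ?normr0 ?normr1.
Qed.

Lemma Er_indic (A : set T) : measurable A -> (P A = (Er (\1_A : T -> R))%:E)%E.
Proof.
move=> mA; rewrite -ErE; first by rewrite integral_indic // setIT.
apply: (@Lint_bounded _ 1); first exact: measurable_indicT.
by move=> w; rewrite indicE; case: (_ \in _); rewrite ?normr0 ?normr1.
Qed.

Lemma Lint_ge0_lty f : measurable_fun setT f -> (forall w, 0 <= f w) ->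
  (\int[P]_w (f w)%:E < +oo)%E -> Lint f.
Proof.
move=> mf f0 h; apply/integrableP; split; first exact/measurable_EFinP.
by under eq_integral do rewrite /= ger0_norm //.
Qed.

(** Borel-Cantelli in integrated form: by monotone convergence the series of the [X n] has a finite
    expectation, hence is finite almost everywhere, and its terms tend to [0]. *)
Lemma ae_cvg0_of_summable (X : nat -> T -> R) (C : R) :
  (forall n w, 0 <= X n w) -> (forall n, Lint (X n)) ->
  (forall n, \sum_(0 <= k < n) Er (X k) <= C) ->
  {ae P, forall w, X ^~ w @ \oo --> 0}.
Proof.
move=> X0 XL XC.
pose g w := (\sum_(k <oo) (X k w)%:E)%E.
have mX n : measurable_fun setT (EFin \o X n) by case/integrableP: (XL n).
have gint : P.-integrable setT g.
  apply/integrableP; split.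
    have X0' k w : setT w -> xpredT k -> (0 <= (X k w)%:E)%E by rewrite lee_fin.
    exact: (ge0_emeasurable_sum X0' (fun k _ => mX k)).
  have -> : (\int[P]_x `|g x| = \int[P]_x g x)%E.
    apply: eq_integral => w _; rewrite gee0_abs //.
    by apply: nneseries_ge0 => n _ _; rewrite lee_fin.
  rewrite /g integral_nneseries //; last by move=> n w _; rewrite lee_fin.
  apply: (@le_lt_trans _ _ C%:E); last exact: ltry.
  apply: lime_le; first by apply: is_cvg_nneseries => n _ _; apply: integral_ge0 => w _; rewrite lee_fin.
  apply: nearW => n; rewrite (eq_bigr (fun k => (Er (X k))%:E)); last by move=> k _; rewrite -ErE.
  by rewrite sumEFin lee_fin.
apply: filterS (integrable_ae measurableT gint) => w /(_ I) gw.
apply: cvg_series_cvg_0; apply: nondecreasing_is_cvgn.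
  apply/nondecreasing_seqP => n; rewrite /series /= big_nat_recr //= lerDl //.
exists (fine (g w)) => _ [n _ <-]; rewrite -lee_fin fineK // /series /= -sumEFin.
by apply: nneseries_lim_ge => k _ _; rewrite lee_fin.
Qed.

(* Doob's maximal inequality, obtained by stopping at the first passage above
   the level [l] *)
Lemma almost_supermartingale_bounded (F : nat -> set_system T) (W : nat -> T -> R)
    (c : nat -> R) (C : R) :
  is_filtration F ->
  (forall t (B : set R), measurable B -> F t (W t @^-1` B)) ->
  (forall t w, 0 <= W t w) -> (forall t, Lint (W t)) ->
  (forall t, 0 <= c t) -> (forall n, \sum_(0 <= k < n) c k <= C) ->
  (forall t (A : set T), F t A ->
     Er (fun w => \1_A w * W t.+1 w) <= Er (fun w => \1_A w * W t w) + c t) ->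
  {ae P, forall w, exists K : R, forall t, W t w <= K}.
Proof.
move=> filF adW W0 WL c0 cC step.
pose A (l : R) n := [set w | forall k, (k <= n)%N -> W k w < l].
have FA l n : F n (A l n).
  elim: n => [|n IH].
    rewrite (_ : A l 0%N = W 0%N @^-1` `]-oo, l[%classic); first exact: adW.
    apply/seteqP; split => w /=; rewrite in_itv /=; first exact.
    by move=> h k; rewrite leqn0 => /eqP ->.
  rewrite (_ : A l n.+1 = A l n `&` W n.+1 @^-1` `]-oo, l[%classic).
    have [sF _ _] := filF n.+1; have [_ _ inc] := filF n.
    have := @measurableI _ (g_sigma_algebraType (F n.+1)).
    rewrite /measurable /= (sigma_algebra_id sF); apply; first exact: inc.
    exact: adW.
  apply/seteqP; split => w /=; rewrite in_itv /=.
    by move=> h; split; [move=> k kn; apply: h; rewrite (leq_trans kn)|exact: h].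
  move=> [h1 h2] k; rewrite leq_eqVlt => /orP[/eqP -> //|]; exact: h1.
have mA l n : measurable (A l n) by have [_ sub _] := filF n; apply: sub.
pose K := Er (W 0%N) + C.
have L1 (B : set T) : measurable B -> Lint (\1_B : T -> R).
  move=> mB; apply: (@Lint_bounded _ 1); first exact: measurable_indicT.
  by move=> w; rewrite indicE; case: (_ \in _); rewrite ?normr0 ?normr1.
(* The left side bounds from below the expectation of [W] stopped at its first passage: at least [l]
   where the passage has occurred, [W n] elsewhere. Since [A l n] lies in [F n], the hypothesis
   [step] applies to the part not yet stopped. *)
have key l n : 0 < l ->
   l * (1 - Er (\1_(A l n))) + Er (fun w => \1_(A l n) w * W n w) <=
   Er (W 0%N) + \sum_(0 <= k < n) c k.
  move=> l0; elim: n => [|n IH].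
    rewrite big_geq // addr0 -[X in X - _](Er_cst 1) -ErB ?Lint_cst ?L1 //.
    rewrite -ErZ; last by apply: LintB; [exact: Lint_cst|exact: L1].
    rewrite -ErD; last 2 first.
      by apply: LintZ; apply: LintB; [exact: Lint_cst|exact: L1].
      exact: Lint_indicM.
    apply: Er_le => //.
      apply: LintD; last exact: Lint_indicM.
      by apply: LintZ; apply: LintB; [exact: Lint_cst|exact: L1].
    move=> w; rewrite indicE; case: (boolP (w \in _)) => /=.
      by move=> _; rewrite subrr mulr0 add0r mul1r.
    rewrite notin_setE /A /= => h; rewrite subr0 mulr1 mul0r addr0 leNgt.
    by apply/negP => h'; apply: h => k; rewrite leqn0 => /eqP ->.
  rewrite big_nat_recr //= addrA.
  apply: le_trans (lerD IH (lexx (c n))).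
  rewrite -addrA; apply: (@le_trans _ _ (l * (1 - Er (\1_(A l n))) + Er (fun w => \1_(A l n) w * W n.+1 w))); last first.
    by rewrite lerD2l; apply: step.
  have -> : l * (1 - Er \1_(A l n.+1)) = l * (1 - Er \1_(A l n)) + l * (Er \1_(A l n) - Er \1_(A l n.+1)) by ring.
  rewrite -addrA lerD2l -ErB ?L1 // -ErZ; last by apply: LintB; exact: L1.
  rewrite -ErD; last 2 first.
    by apply: LintZ; apply: LintB; exact: L1.
    exact: Lint_indicM.
  apply: Er_le.
    apply: LintD; last exact: Lint_indicM.
    by apply: LintZ; apply: LintB; exact: L1.
    exact: Lint_indicM.
  move=> w; rewrite !indicE.
  case: (boolP (w \in A l n.+1)) => /=; rewrite ?notin_setE ?inE => h1;
   case: (boolP (w \in A l n)) => /=; rewrite ?notin_setE ?inE => h2.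
  - by rewrite subrr mulr0 add0r.
  - by case: h2 => k kn; apply: h1; rewrite (leq_trans kn).
  - rewrite subr0 mulr1 mul0r addr0 mul1r leNgt; apply/negP => h3; apply: h1 => k.
    by rewrite leq_eqVlt => /orP[/eqP -> //|]; exact: h2.
  - by rewrite subrr mulr0 !mul0r addr0.
pose B l := \bigcup_n ~` A l n.
have mB l : measurable (B l) by apply: bigcup_measurable => n _; exact: measurableC.
have PB l : 0 < l -> (P (B l) <= (K / l)%:E)%E.
  move=> l0.
  have cv : P \o (fun n => ~` A l n) @ \oo --> P (B l).
    apply: nondecreasing_cvg_mu; [by move=> n; exact: measurableC|exact: mB|].
    apply/nondecreasing_seqP => n; apply/subsetPset; apply: subsetC => w h k kn.
    by apply: h; rewrite (leq_trans kn).
  rewrite -(cvg_lim _ cv) //; apply: lime_le; first by apply: cvgP cv.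
  apply: nearW => n /=; rewrite probability_setC // Er_indic // -EFinB lee_fin.
  rewrite ler_pdivlMr // mulrC.
  have := key l n l0; have := cC n.
  have : 0 <= Er (fun w => \1_(A l n) w * W n w).
    by apply: Er_ge0 => w; rewrite mulr_ge0 // indicE.
  rewrite /K; lra.
(* A path without an upper bound passes every integer level, and passing the level [l] has
   probability at most [K / l]. *)
exists (\bigcap_k B k.+1%:R); split.
- by apply: bigcap_measurable => // k _; exact: mB.
- apply/eqP; rewrite eq_le measure_ge0 andbT; apply/lee_addgt0Pr => e e0; rewrite add0e.
  have K0 : 0 <= K.
    by rewrite addr_ge0 ?Er_ge0 //; have := cC 0%N; rewrite big_geq.
  pose k := Num.truncn (K / e).
  have hk : K / k.+1%:R <= e.
    rewrite ler_pdivrMr // mulrC -ler_pdivrMr // ltW //; exact: truncnS_gt.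
  apply: (@le_trans _ _ (P (B k.+1%:R))).
    apply: le_measure; rewrite ?inE //.
      by apply: bigcap_measurable => // j _; exact: mB.
    by move=> w /(_ k); apply.
  by apply: (le_trans (PB k.+1%:R _)) => //; rewrite lee_fin.
- move=> w /= h k _; apply: contrapT => hB; apply: h; exists k.+1%:R => t.
  apply: ltW; apply: contrapT => ht; apply: hB; exists t => //= hA.
  by apply: ht; apply: hA.
Qed.

End Expectation.

(** The carrier [T] is retyped with the sigma-algebra generated by [G], so that all closure rules
    for measurable functions hold for a sub-sigma-algebra as well. *)
Notation gmeas G f := (@measurable_fun _ _ (g_sigma_algebraType G) _ setT f) (only parsing).

Section SubSigmaAlgebra.
Context {d : measure_display} {T : measurableType d} {R : realType}.
Implicit Types (G : set_system T) (f : T -> R).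

Lemma gmeas_preimage G f :
  (forall B : set R, measurable B -> G (f @^-1` B)) -> gmeas G f.
Proof.
by move=> h _ B mB; rewrite setTI; apply: sub_sigma_algebra; apply: h.
Qed.

Lemma preimage_gmeas G f : sigma_algebra setT G -> gmeas G f ->
  forall B : set R, measurable B -> G (f @^-1` B).
Proof.
move=> sG mf B mB; have := mf measurableT B mB.
by rewrite setTI /measurable /= (sigma_algebra_id sG).
Qed.

Lemma gmeasS G1 G2 f :
  G1 `<=` G2 -> gmeas G1 f -> gmeas G2 f.
Proof.
move=> G12 mf _ B mB; have := mf measurableT B mB.
by apply: (sub_sigma_algebra2 G12).
Qed.

Lemma gmeas_measurable G f :
  G `<=` measurable -> gmeas G f -> measurable_fun setT f.
Proof.
move=> Gm mf _ B mB; have := mf measurableT B mB.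
rewrite !setTI; move: (f @^-1` B).
by apply: smallest_sub => //; exact: sigma_algebra_measurable.
Qed.

Lemma measurable_id_gsigma G : G `<=` measurable ->
  @measurable_fun _ _ T (g_sigma_algebraType G) setT id.
Proof.
move=> Gm _ B mB; rewrite setTI preimage_id.
by move: B mB; apply: smallest_sub => //; exact: sigma_algebra_measurable.
Qed.

Definition mxmeas {m n : nat} (X : T -> 'M[R]_(m, n)) :=
  forall i j, measurable_fun setT (fun w => X w i j).

End SubSigmaAlgebra.

Notation gmxmeas G X := (@mxmeas _ (g_sigma_algebraType G) _ _ _ X) (only parsing).

(** * Independence and equality of laws, at the level of expectations *)

Section Independence.
Context {d : measure_display} {T : measurableType d} {R : realType}.
Variable P : probability T R.

(** Independence identifies the joint law of [(phi, psi)] with the product of the marginal laws, by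
    uniqueness of product measures; Tonelli gives integrability and Fubini the factorization. The
    targets are arbitrary so that [phi] and [psi] can both be the identity of [T], read with values
    in two sub-sigma-algebras. *)
Lemma indep_maps_Er d1 d2 (T1 : measurableType d1) (T2 : measurableType d2)
    (phi : T -> T1) (psi : T -> T2) (f : T1 -> R) (g : T2 -> R) :
  measurable_fun setT phi -> measurable_fun setT psi ->
  (forall A B, measurable A -> measurable B ->
     P (phi @^-1` A `&` psi @^-1` B) = P (phi @^-1` A) * P (psi @^-1` B))%E ->
  measurable_fun setT f -> measurable_fun setT g ->
  Lint P (f \o phi) -> Lint P (g \o psi) ->
  Lint P (fun w => f (phi w) * g (psi w)) /\
  Er P (fun w => f (phi w) * g (psi w)) = Er P (f \o phi) * Er P (g \o psi).
Proof.
move=> mphi mpsi ind mf mg Lf Lg.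
pose phi' : {mfun T >-> T1} := HB.pack phi (isMeasurableFun.Build _ _ _ _ phi mphi).
pose psi' : {mfun T >-> T2} := HB.pack psi (isMeasurableFun.Build _ _ _ _ psi mpsi).
pose m1 : probability T1 R := distribution P phi'.
pose m2 : probability T2 R := distribution P psi'.
pose Phi w := (phi w, psi w).
have mPhi : measurable_fun setT Phi by exact: measurable_fun_pair.
pose Phi' : {mfun T >-> (T1 * T2)%type} := HB.pack Phi (isMeasurableFun.Build _ _ _ _ Phi mPhi).
pose m' : probability (T1 * T2)%type R := distribution P Phi'.
have m'E X : measurable X -> (m1 \x m2)%E X = m' X.
  by apply: product_measure_unique => A B mA mB; apply: ind.
pose h (z : T1 * T2) := (f z.1 * g z.2)%:E.
have mh : measurable_fun setT h.
  by apply/measurable_EFinP; apply: measurable_funM; apply: measurableT_comp.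
have i1 : m1.-integrable setT (EFin \o f).
  by apply: (@integrable_pushforward _ _ _ _ _ phi) => //; exact/measurable_EFinP.
have i2 : m2.-integrable setT (EFin \o g).
  by apply: (@integrable_pushforward _ _ _ _ _ psi) => //; exact/measurable_EFinP.
have E1 : (\int[m1]_x (f x)%:E = (Er P (f \o phi))%:E)%E.
  by rewrite -ErE // /m1 (@integral_distribution _ _ _ _ _ P phi' (EFin \o f)) //; exact/measurable_EFinP.
have E2 : (\int[m2]_x (g x)%:E = (Er P (g \o psi))%:E)%E.
  by rewrite -ErE // /m2 (@integral_distribution _ _ _ _ _ P psi' (EFin \o g)) //; exact/measurable_EFinP.
have hint : (m1 \x m2)%E.-integrable setT h.
  apply/integrable12ltyP => //.
  pose C := fine (\int[m2]_y `|(g y)%:E|)%E.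
  have CE : (\int[m2]_y `|(g y)%:E| = C%:E)%E.
    rewrite fineK // ge0_fin_numE; last by apply: integral_ge0.
    by case/integrableP: i2.
  have C0 : 0 <= C by apply: fine_ge0; apply: integral_ge0.
  rewrite (eq_integral (fun x => C%:E * `|(f x)%:E|)%E); last first.
    move=> x _; rewrite -CE muleC.
    rewrite -ge0_integralZl_EFin //; last by apply: measurableT_comp => //; exact/measurable_EFinP.
    by apply: eq_integral => y _; rewrite /h /= -EFinM normrM.
  rewrite ge0_integralZl_EFin //; last by apply: measurableT_comp => //; exact/measurable_EFinP.
  case/integrableP: i1 => _ fi; apply: lte_mul_pinfty => //.
have hP : P.-integrable setT (h \o Phi).
  apply/integrableP; split; first exact: measurableT_comp.
  have <- : (\int[pushforward P Phi]_y `|h y| = \int[P]_x `|(h \o Phi) x|)%E.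
    rewrite ge0_integral_pushforward //; exact: measurableT_comp.
  case/integrableP: hint => _; rewrite (eq_measure_integral m') //.
  by move=> A mA _; exact: m'E.
split; first exact: hP.
apply: EFin_inj; rewrite -ErE //.
transitivity (\int[m']_z h z)%E.
  by rewrite /m' (@integral_distribution _ _ _ _ _ P Phi' h).
rewrite -(eq_measure_integral m' (m1 := (m1 \x m2)%E)); last by move=> A mA _; exact: m'E.
rewrite -integral12_prod_meas1 // /fubini_F.
rewrite (eq_integral (fun x => (Er P (g \o psi))%:E * (f x)%:E)%E); last first.
  move=> x _; rewrite -E2 muleC -integralZl //.
rewrite integralZl // E1 -EFinM; congr EFin; exact: mulrC.
Qed.

Definition mx_events {m n} (X : T -> 'M[R]_(m, n)) : set_system T :=
  [set C | exists2 B, mx_borel B & C = rect_event X B].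

Lemma mx_events_measurable m n (X : T -> 'M[R]_(m, n)) :
  mxmeas X -> mx_events X `<=` measurable.
Proof.
move=> mX _ [B mB ->].
rewrite (_ : rect_event X B = \bigcap_(i in [set: 'I_m]) \bigcap_(j in [set: 'I_n])
    ((fun w => X w i j) @^-1` B i j)); last first.
  by apply/seteqP; split => w /= h i; [move=> _ j _; exact: h|move=> j; exact: (h i I j I)].
apply: fin_bigcap_measurable => // i _; apply: fin_bigcap_measurable => // j _.
by rewrite -[X in measurable X]setTI; apply: mX => //; exact: mB.
Qed.

Lemma gmeas_entry m n (X : T -> 'M[R]_(m, n)) i j : gmeas (mx_events X) (fun w => X w i j).
Proof.
apply: gmeas_preimage => B mB.
exists (fun i' j' => if (i' == i) && (j' == j) then B else setT).
  by move=> i' j'; case: ifP.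
apply/seteqP; split => w /=.
  by move=> h i' j'; case: ifP => // /andP[/eqP -> /eqP ->].
by move=> /(_ i j); rewrite !eqxx.
Qed.

(** For fixed [A] the finite measures [P (A & .)] and [P A * P (.)] agree on the rectangles, a
    pi-system, hence on the sigma-algebra it generates. *)
Lemma indep_of_events m n (X : T -> 'M[R]_(m, n)) (G : set_system T) :
  G `<=` measurable ->
  mxmeas X -> indep_of P X G ->
  forall A B, G A -> <<s mx_events X >> B -> (P (A `&` B) = P A * P B)%E.
Proof.
move=> Gm mX ind A B GA.
have mA : measurable A by exact: Gm.
pose r : {nonneg R} := NngNum (fine_ge0 (measure_ge0 P A)).
have rE : (r%:num%:E = P A)%E by rewrite /= fineK // fin_num_measure.
have := @g_sigma_algebra_measure_unique _ R T (mx_events X) (mx_events_measurable mX) (fun=> setT)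
   _ _ (mrestr P mA) (mscale r P).
rewrite /mrestr /mscale /=.
move=> H sB; rewrite setIC -rE; apply: H => //.
- by move=> _; exists (fun _ _ => setT) => //; apply/seteqP; split.
- by rewrite bigcup_const //; exists 0%N.
- move=> _ _ [B1 mB1 ->] [B2 mB2 ->]; exists (fun i j => B1 i j `&` B2 i j).
    by move=> i j; apply: measurableI.
  apply/seteqP; split => w /=; first by move=> [h1 h2] i j; split.
  by move=> h; split => i j; case: (h i j).
- by move=> _ [B1 mB1 ->]; rewrite /mrestr /mscale /= setIC ind // fineK // fin_num_measure.
- by move=> _; rewrite /mrestr setTI -rE ltry.
Qed.

Lemma indep_Er m n (X : T -> 'M[R]_(m, n)) (G : set_system T) (f g : T -> R) :
  sigma_algebra setT G -> G `<=` measurable ->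
  mxmeas X -> indep_of P X G ->
  gmeas G f -> gmeas (mx_events X) g -> Lint P f -> Lint P g ->
  Lint P (fun w => f w * g w) /\ Er P (fun w => f w * g w) = Er P f * Er P g.
Proof.
move=> sG Gm mX ind mf mg Lf Lg.
apply: (@indep_maps_Er _ _ (g_sigma_algebraType G) (g_sigma_algebraType (mx_events X)) id id f g) => //.
- exact: measurable_id_gsigma.
- by apply: measurable_id_gsigma; exact: mx_events_measurable.
- move=> A B mA mB; rewrite !preimage_id; apply: (indep_of_events Gm mX ind) => //.
  by move: mA; rewrite /measurable /= (sigma_algebra_id sG).
Qed.

Lemma ident_distr_Er m n (X : nat -> T -> 'M[R]_(m, n)) (h : R -> R) t s i j :
  (forall t, mxmeas (X t)) ->
  ident_distr P X -> measurable_fun setT h ->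
  Lint P (fun w => h (X s w i j)) ->
  Lint P (fun w => h (X t w i j)) /\
  Er P (fun w => h (X t w i j)) = Er P (fun w => h (X s w i j)).
Proof.
move=> mX id_X mh Ls.
pose V t : {mfun T >-> R} := HB.pack (fun w => X t w i j) (isMeasurableFun.Build _ _ _ _ (fun w => X t w i j) (mX t i j)).
have dE (B : set R) : measurable B -> distribution P (V t) B = distribution P (V s) B.
  move=> mB.
  pose B' i' j' := if (i' == i) && (j' == j) then B else [set: R].
  have bB : mx_borel B' by move=> i' j'; rewrite /B'; case: ifP.
  have E u : V u @^-1` B = rect_event (X u) B'.
    apply/seteqP; split => w /=.
      by move=> hw i' j'; rewrite /B'; case: ifP => // /andP[/eqP -> /eqP ->].
    by move=> /(_ i j); rewrite /B' !eqxx.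
  by rewrite /distribution /pushforward !E; exact: id_X.
have mhE : measurable_fun setT (EFin \o h) by exact/measurable_EFinP.
have Ls' : (distribution P (V s)).-integrable setT (EFin \o h).
  exact: (@integrable_pushforward _ _ _ _ _ (V s)).
have L : Lint P (fun w => h (X t w i j)).
  apply/integrableP; split; first exact: measurableT_comp (mhE) (mX t i j).
  have := @ge0_integral_distribution _ _ _ _ _ P (V t) (fun z => `|(h z)%:E|)%E.
  move=> <- //; last by apply: measurableT_comp.
  case/integrableP: Ls' => _; rewrite (eq_measure_integral (distribution P (V t))) //.
  by move=> A mA _; exact: esym (dE _ mA).
split => //; apply: EFin_inj; rewrite -!ErE //.
rewrite -[LHS](@integral_distribution _ _ _ _ _ P (V t) (EFin \o h)) //.
rewrite -[RHS](@integral_distribution _ _ _ _ _ P (V s) (EFin \o h)) //.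
by apply: eq_measure_integral => A mA _; exact: dE.
Qed.

End Independence.

(** * Moment bounds of order [p] *)

Section LpBounds.
Context {d : measure_display} {T : measurableType d} {R : realType}.
Variable P : probability T R.
Implicit Types (f g : T -> R) (c p : R).

(** Minkowski's inequality before integration: [(x + y)/(c + e)] is the mean of [x/c] and [y/e] with
    weights proportional to [c] and [e], and [u^p] is convex. If the [p]-th moments of [x] and [y]
    are at most [c^p] and [e^p], the expectation of the right side is at most [(c + e)^p]. *)
Lemma powRD_le_convex p (x y c e : R) : 1 <= p -> 0 <= x -> 0 <= y -> 0 < c -> 0 < e ->
  (x + y) `^ p <= (c + e) `^ p * (c / (c + e) / c `^ p * x `^ p + e / (c + e) / e `^ p * y `^ p).
Proof.
move=> p1 x0 y0 c0 e0; have ce : 0 < c + e by rewrite addr_gt0.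
have t0 : 0 <= c / (c + e) by rewrite divr_ge0 // ltW.
have t1 : c / (c + e) <= 1 by rewrite ler_pdivrMr // mul1r lerDl ltW.
have xc0 : 0 <= x / c by rewrite divr_ge0 // ltW.
have ye0 : 0 <= y / e by rewrite divr_ge0 // ltW.
have := @convex_powR R p p1 (Itv01 t0 t1) (x / c) (y / e).
rewrite !inE /= !in_itv /= !andbT => /(_ xc0 ye0).
rewrite convRE [X in X `^ _ <= _ -> _]convRE /= => h.
have -> : x + y = (c + e) * (c / (c + e) * (x / c) + unstable.onem (c / (c + e)) * (y / e)).
  by rewrite /unstable.onem; field; rewrite !gt_eqF.
rewrite powRM ?(ltW ce) //; last first.
  by apply: addr_ge0; apply: mulr_ge0; rewrite // /unstable.onem subr_ge0.
rewrite ler_wpM2l ?powR_ge0 //; apply: (le_trans h).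
have iv z : 0 < z -> z^-1 `^ p = (z `^ p)^-1.
  by move=> z0; rewrite -(powR_inv1 (ltW z0)) powRAC powR_inv1 ?powR_ge0.
have -> : unstable.onem (c / (c + e)) = e / (c + e).
  by rewrite /unstable.onem; field; rewrite gt_eqF.
rewrite !powRM ?invr_ge0 ?(ltW c0) ?(ltW e0) // !iv //.
by apply: eqr_le; congr (_ + _); ring.
Qed.

(** An upper bound on the [L^p] norm without the [p]-th root. The recursions below are run on the
    bounds [c], not on the norms themselves. *)
Definition Lpb p f c :=
  [/\ measurable_fun setT f, Lint P (fun w => `|f w| `^ p)
    & Er P (fun w => `|f w| `^ p) <= c `^ p].

Lemma measurable_normpow p f : measurable_fun setT f ->
  measurable_fun setT (fun w => `|f w| `^ p).
Proof.
move=> mf; apply: (measurableT_comp (measurable_powR p)).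
exact: measurableT_comp.
Qed.

Lemma Lpb_mono p f c c' : 0 <= p -> 0 <= c -> c <= c' -> Lpb p f c -> Lpb p f c'.
Proof.
move=> p0 c0 cc' [mf Lf Ef]; split => //; apply: (le_trans Ef).
by apply: ge0_ler_powR => //; rewrite nnegrE // (le_trans c0).
Qed.

Lemma Lpb_le p f g c : 0 <= p -> measurable_fun setT g ->
  (forall w, `|g w| <= `|f w|) -> Lpb p f c -> Lpb p g c.
Proof.
move=> p0 mg gf [mf Lf Ef].
have h w : `|g w| `^ p <= `|f w| `^ p by apply: ge0_ler_powR => //; rewrite nnegrE.
have Lg : Lint P (fun w => `|g w| `^ p).
  apply: Lint_le Lf; first exact: measurable_normpow.
  by move=> w; rewrite ger0_norm ?powR_ge0.
by split; [exact: mg|exact: Lg|apply: (le_trans (Er_le Lg Lf h) Ef)].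
Qed.

Lemma LpbZ p f k c : 0 <= k -> 0 <= c -> Lpb p f c -> Lpb p (fun w => k * f w) (k * c).
Proof.
move=> k0 c0 [mf Lf Ef].
have E : (fun w => `|k * f w| `^ p) = (fun w => k `^ p * `|f w| `^ p).
  by apply/funext => w; rewrite normrM (ger0_norm k0) powRM.
split; rewrite ?E; [exact: measurable_funM|exact: LintZ|].
by rewrite ErZ // powRM // ler_wpM2l // powR_ge0.
Qed.

Lemma LpbD p f g c e : 1 <= p -> 0 < c -> 0 < e -> Lpb p f c -> Lpb p g e ->
  Lpb p (fun w => f w + g w) (c + e).
Proof.
move=> p1 c0 e0 [mf Lf Ef] [mg Lg Eg].
have p0 : 0 <= p by lra.
pose k1 := (c + e) `^ p * (c / (c + e) / c `^ p).
pose k2 := (c + e) `^ p * (e / (c + e) / e `^ p).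
have h w : `|f w + g w| `^ p <= k1 * `|f w| `^ p + k2 * `|g w| `^ p.
  apply: (@le_trans _ _ ((`|f w| + `|g w|) `^ p)).
    by apply: ge0_ler_powR; rewrite ?nnegrE ?addr_ge0 // ler_normD.
  apply: (le_trans (powRD_le_convex p1 (normr_ge0 _) (normr_ge0 _) c0 e0)).
  by rewrite /k1 /k2 mulrDr !mulrA.
have mfg : measurable_fun setT (fun w => f w + g w) by exact: measurable_funD.
have Lk : Lint P (fun w => k1 * `|f w| `^ p + k2 * `|g w| `^ p).
  by apply: LintD; apply: LintZ.
have Lfg : Lint P (fun w => `|f w + g w| `^ p).
  apply: Lint_le Lk; first exact: measurable_normpow.
  by move=> w; rewrite ger0_norm ?powR_ge0.
split => //; apply: (le_trans (Er_le Lfg Lk h)).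
rewrite ErD ?ErZ //; [|exact: LintZ|exact: LintZ].
have cp : 0 < c `^ p by rewrite powR_gt0.
have ep : 0 < e `^ p by rewrite powR_gt0.
have k10 : 0 <= k1 by rewrite mulr_ge0 ?powR_ge0 // !divr_ge0 ?powR_ge0 ?addr_ge0 // ltW.
have k20 : 0 <= k2 by rewrite mulr_ge0 ?powR_ge0 // !divr_ge0 ?powR_ge0 ?addr_ge0 // ltW.
apply: (le_trans (lerD (ler_wpM2l k10 Ef) (ler_wpM2l k20 Eg))).
rewrite /k1 /k2 -!mulrA mulVf ?gt_eqF // mulVf ?gt_eqF // !mulr1 -mulrDr -mulrDl.
by rewrite mulfV ?mulr1 // gt_eqF // addr_gt0.
Qed.

Lemma Lpb_cst p c : 0 <= c -> Lpb p (fun=> c) c.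
Proof.
move=> c0; split; [exact: measurable_cst|exact: Lint_cst|].
by rewrite Er_cst ger0_norm.
Qed.

(** The extra [e] is the bound for the empty sum, since [LpbD] divides by its bounds and needs them
    positive. *)
Lemma Lpb_sum p (I : Type) (r : seq I) (f : I -> T -> R) (c : I -> R) (e : R) :
  1 <= p -> 0 < e -> (forall i, 0 < c i) -> (forall i, Lpb p (f i) (c i)) ->
  Lpb p (fun w => \sum_(i <- r) f i w) (e + \sum_(i <- r) c i).
Proof.
move=> p1 e0 c0 fc; have p0 : 0 <= p by lra.
elim: r => [|x r IH].
  under eq_fun do rewrite big_nil; rewrite big_nil addr0.
  by apply: (@Lpb_mono _ _ 0) => //; [exact: ltW|exact: Lpb_cst].
under eq_fun do rewrite big_cons.
rewrite big_cons addrCA; apply: LpbD => //.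
by apply: ltr_wpDr => //; apply: sumr_ge0 => i _; exact: ltW.
Qed.

(** From [u^2 <= 1 + u^p] at [u = |f| / c]; the factor [2] is the price for avoiding Jensen's
    inequality. *)
Lemma Lpb_sqr p f c : 2 <= p -> 0 < c -> Lpb p f c ->
  Lint P (fun w => f w ^+ 2) /\ Er P (fun w => f w ^+ 2) <= 2 * c ^+ 2.
Proof.
move=> p2 c0 [mf Lf Ef]; have cp : 0 < c `^ p by rewrite powR_gt0.
have h w : f w ^+ 2 <= c ^+ 2 + c ^+ 2 / c `^ p * `|f w| `^ p.
  pose u := `|f w| / c; have u0 : 0 <= u by rewrite divr_ge0 // ltW.
  have fu : `|f w| = c * u by rewrite /u mulrC divfK // gt_eqF.
  rewrite -(real_normK (num_real (f w))) fu exprMn powRM ?(ltW c0) //.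
  have -> : c ^+ 2 / c `^ p * (c `^ p * u `^ p) = c ^+ 2 * u `^ p.
    by rewrite mulrA divfK // gt_eqF.
  rewrite -[X in X + _]mulr1 -mulrDr ler_wpM2l ?sqr_ge0 //.
  have [u1|u1] := leP u 1.
    have : u ^+ 2 <= 1 by rewrite expr_le1.
    have := powR_ge0 u p; lra.
  rewrite -powR_mulrn //; have : u `^ 2%:R <= u `^ p by apply: ler_powR => //; exact: ltW.
  lra.
have Lr : Lint P (fun w => c ^+ 2 + c ^+ 2 / c `^ p * `|f w| `^ p).
  by apply: LintD; [exact: Lint_cst|exact: LintZ].
have Lf2 : Lint P (fun w => f w ^+ 2).
  apply: Lint_le Lr; first exact: measurable_funX.
  by move=> w; rewrite ger0_norm ?sqr_ge0.
split => //; apply: (le_trans (Er_le Lf2 Lr h)).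
rewrite ErD ?Er_cst ?ErZ //; [|exact: Lint_cst|exact: LintZ].
have : c ^+ 2 / c `^ p * Er P (fun w => `|f w| `^ p) <= c ^+ 2.
  rewrite -[leRHS](@divfK _ (c `^ p)) ?gt_eqF // ler_wpM2l // divr_ge0 ?sqr_ge0 //.
  exact: ltW.
lra.
Qed.

End LpBounds.

Lemma filtration_le d (T : measurableType d) (F : nat -> set_system T) s t :
  is_filtration F -> (s <= t)%N -> F s `<=` F t.
Proof.
move=> filF; elim: t => [|t IH]; first by rewrite leqn0 => /eqP ->.
rewrite leq_eqVlt => /orP[/eqP -> //|st]; apply: subset_trans (IH st) _.
by case: (filF t).
Qed.

(** * Weighted supermartingales and a strong law of large numbers *)

Section LawOfLargeNumbers.
Context {d : measure_display} {T : measurableType d} {R : realType}.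
Variable P : probability T R.

Lemma gmeas_indic (G : set_system T) (A : set T) : G A -> gmeas G (\1_A : T -> R).
Proof. by move=> GA; apply: measurable_indic; apply: sub_sigma_algebra. Qed.

(** Pythagoras tested on an event: in the expanded square the cross term is the one that [orth]
    cancels. This replaces a conditional variance computation. *)
Lemma Er_indic_sqrD (A : set T) (g v : T -> R) (al C : R) :
  measurable A -> measurable_fun setT g -> measurable_fun setT v ->
  Lint P (fun w => g w ^+ 2) -> Lint P (fun w => v w ^+ 2) ->
  Er P (fun w => v w ^+ 2) <= C -> Er P (fun w => \1_A w * g w * v w) = 0 ->
  Er P (fun w => \1_A w * (g w + al * v w) ^+ 2) <=
    Er P (fun w => \1_A w * g w ^+ 2) + al ^+ 2 * C.
Proof.
move=> mA mg mv Lg Lv EC orth.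
have L1 : Lint P (fun w => \1_A w * g w ^+ 2) by exact: Lint_indicM.
have L3 : Lint P (fun w => \1_A w * v w ^+ 2) by exact: Lint_indicM.
have L2 : Lint P (fun w => \1_A w * g w * v w).
  have -> : (fun w => \1_A w * g w * v w) = (fun w => \1_A w * (g w * v w)).
    by apply/funext => w; rewrite mulrA.
  by apply: Lint_indicM => //; exact: Lint_sqr_mul.
have -> : (fun w => \1_A w * (g w + al * v w) ^+ 2) =
    (fun w => (\1_A w * g w ^+ 2 + 2 * al * (\1_A w * g w * v w)) + al ^+ 2 * (\1_A w * v w ^+ 2)).
  by apply/funext => w; ring.
rewrite ErD; [|by apply: LintD => //; exact: LintZ|exact: LintZ].
rewrite ErD //; last exact: LintZ.
rewrite !ErZ // orth mulr0 addr0 lerD2l ler_wpM2l ?sqr_ge0 //.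
apply: le_trans EC; apply: Er_le => // w.
by rewrite ler_piMl ?sqr_ge0 // indicE; case: (_ \in _).
Qed.

(** The weight gains a factor [1 + r/(t+1)] per step, which the decay [1 - rho/(t+1)] cancels as
    [r <= rho]; what remains is the noise [t^-(s-r)], summable by [1 < s - r]. Time is shifted by
    [t1] because integrability is only assumed from there on. *)
Lemma weighted_supermartingale_bounded (F : nat -> set_system T) (V : nat -> T -> R)
    (t1 : nat) (r rho s K : R) :
  is_filtration F -> (forall t, gmeas (F t) (V t)) -> (forall t w, 0 <= V t w) ->
  (forall t, (t1 <= t)%N -> Lint P (V t)) -> 0 <= r -> r <= 1 -> r <= rho -> 0 <= K ->
  1 < s - r ->
  (forall t A, (t1 <= t)%N -> F t A -> Er P (fun w => \1_A w * V t.+1 w) <=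
     (1 - rho / t.+1%:R) * Er P (fun w => \1_A w * V t w) + K * t.+1%:R `^ (- s)) ->
  {ae P, forall w, exists B : R, forall n, (n + t1).+1%:R `^ r * V (n + t1)%N w <= B}.
Proof.
move=> filF gV V0 LV r0 r1 rrho K0 s1 hV.
have [S [S0 hS]] := powR_series_bounded s1.
have K20 : 0 <= 2 * K by rewrite mulr_ge0.
apply: (@almost_supermartingale_bounded _ _ _ P (fun n => F (n + t1)%N)
  (fun n w => (n + t1).+1%:R `^ r * V (n + t1)%N w)
  (fun n => 2 * K * n.+1%:R `^ (- (s - r))) (2 * K * S)).
- by move=> n; exact: filF.
- move=> n E mE; apply: preimage_gmeas => //; first by case: (filF (n + t1)%N).
  by apply: measurable_funM; [exact: measurable_cst|exact: gV].
- by move=> n w; rewrite mulr_ge0 ?powR_ge0.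
- by move=> n; apply: LintZ; apply: LV; exact: leq_addl.
- by move=> n; rewrite mulr_ge0 // powR_ge0.
- by move=> n; rewrite -mulr_sumr ler_wpM2l.
move=> n E FE; rewrite addSn; have nt : (t1 <= n + t1)%N by exact: leq_addl.
set t := (n + t1)%N in FE nt *.
have mE : measurable E by case: (filF t) => _ h _; exact: h.
have e u : (t1 <= u)%N -> Er P (fun w => \1_E w * (u.+1%:R `^ r * V u w)) =
    u.+1%:R `^ r * Er P (fun w => \1_E w * V u w).
  move=> tu; rewrite -ErZ; last by apply: Lint_indicM => //; exact: LV.
  by congr Er; apply/funext => w; rewrite mulrCA.
rewrite !e ?leqW //.
have := hV t E nt FE.
have E0 u : 0 <= Er P (fun w => \1_E w * V u w).
  by apply: Er_ge0 => w; rewrite mulr_ge0 // indicE; case: (_ \in _).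
move: (E0 t) (E0 t.+1).
set x := Er P (fun w => \1_E w * V t w); set y := Er P (fun w => \1_E w * V t.+1 w).
set D := K * _ => x0 y0 hy.
have t0 : 0 < t.+1%:R :> R by [].
have D0 : 0 <= D by rewrite mulr_ge0 ?powR_ge0.
have w0 : 0 <= t.+1%:R `^ r :> R by exact: powR_ge0.
have h2 : t.+2%:R `^ r <= t.+1%:R `^ r * (1 + r / t.+1%:R) :> R.
  by apply: powR_succ_le; rewrite r0.
apply: (@le_trans _ _ (t.+1%:R `^ r * (1 + r / t.+1%:R) * ((1 - rho / t.+1%:R) * x + D))).
  apply: (@le_trans _ _ (t.+2%:R `^ r * ((1 - rho / t.+1%:R) * x + D))).
    by rewrite ler_wpM2l ?powR_ge0.
  by rewrite ler_wpM2r // (le_trans y0).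
rewrite mulrDr; apply: lerD.
  rewrite -(mulrA (_ `^ r)) ler_wpM2l // [leLHS]mulrA ler_piMl //.
  (* Lowering [rho] to [r] turns the product into [1 - (r/(t+1))^2 <= 1]. *)
  apply: (@le_trans _ _ ((1 + r / t.+1%:R) * (1 - r / t.+1%:R))).
    apply: ler_wpM2l; first by rewrite addr_ge0 // divr_ge0.
    by rewrite lerD2l lerN2 ler_wpM2r // invr_ge0.
  by rewrite mulrC -subr_sqr expr1n gerBl sqr_ge0.
have h3 : 1 + r / t.+1%:R <= 2 :> R.
  rewrite -[2]/(1 + 1) lerD2l ler_pdivrMr // mul1r (le_trans r1) //.
  by rewrite ler1n.
apply: (@le_trans _ _ (t.+1%:R `^ r * 2 * D)).
  by rewrite ler_wpM2r // ler_wpM2l.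
have -> : t.+1%:R `^ r * 2 * D = 2 * K * (t.+1%:R `^ r * t.+1%:R `^ (- s)) by rewrite /D; ring.
rewrite -powRD ?pnatr_eq0 ?implybT // ler_wpM2l //.
have -> : r - s = - (s - r) by ring.
rewrite !powRN lef_pV2 ?posrE ?powR_gt0 //.
apply: ge0_ler_powR; rewrite ?nnegrE //; first by apply: ltW; apply: lt_trans s1.
by rewrite ler_nat ltnS leq_addr.
Qed.

Lemma cvg0_of_sqr_weighted (u : nat -> R) (rho K : R) : 0 < rho ->
  (forall t, t.+1%:R `^ rho * u t ^+ 2 <= K) -> u @ \oo --> 0.
Proof.
move=> r0 h.
have h2 t : u t ^+ 2 <= K * t.+1%:R `^ (- rho).
  have tp : 0 < t.+1%:R `^ rho :> R by rewrite powR_gt0.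
  by rewrite powRN ler_pdivlMr // mulrC.
have c0 : (fun t => K * t.+1%:R `^ (- rho)) @ \oo --> 0.
  by rewrite -(mulr0 K); apply: cvgMr; exact: cvg_powRN.
have sq : (fun t => u t ^+ 2) @ \oo --> 0.
  by apply: cvg0_le c0; apply: nearW => t; rewrite ger0_norm ?sqr_ge0.
apply/cvgrPdist_lt => e e0.
move/cvgrPdist_lt: sq => /(_ (e ^+ 2) (exprn_gt0 2 e0)); apply: filterS => t.
rewrite !sub0r !normrN (ger0_norm (sqr_ge0 _)) -(real_normK (num_real (u t))).
by rewrite ltr_pXn2r ?nnegrE // ltW.
Qed.

Section SLLN.
Variables (F : nat -> set_system T) (Y : nat -> T -> R) (q C mu : R).
Hypotheses (filF : is_filtration F) (q1 : 1 < q) (q2 : q <= 2).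
Hypothesis adY : forall t, gmeas (F t.+1) (Y t).
Hypothesis indY : forall t (f : T -> R) (h : R -> R), gmeas (F t) f ->
  measurable_fun setT h -> Lint P f -> Lint P (fun w => h (Y t w)) ->
  Er P (fun w => f w * h (Y t w)) = Er P f * Er P (fun w => h (Y t w)).
Hypothesis LYq : forall t, Lint P (fun w => `|Y t w| `^ q).
Hypothesis EYq : forall t, Er P (fun w => `|Y t w| `^ q) <= C.
Hypothesis LY : forall t, Lint P (Y t).
Hypothesis EY : forall t, Er P (Y t) = mu.

Let trunc (t : nat) (y : R) : R := if `|y| <= t.+1%:R then y else 0.
Let m (t : nat) : R := Er P (fun w => trunc t (Y t w)).
Let Z (t : nat) (w : T) : R := trunc t (Y t w) - m t.
Let M (n : nat) (w : T) : R := n%:R^-1 * \sum_(s < n) Z s w.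

Let mtrunc t : measurable_fun setT (trunc t).
Proof.
apply: measurable_fun_ifT => //.
by apply: measurable_fun_ler => //; apply: measurableT_comp.
Qed.

Let trunc_bound t y : `|trunc t y| <= t.+1%:R.
Proof. by rewrite /trunc; case: ifP => //; rewrite normr0. Qed.

Let subF t : F t `<=` measurable. Proof. by case: (filF t). Qed.
Let sigF t : sigma_algebra setT (F t). Proof. by case: (filF t). Qed.

Let mY t : measurable_fun setT (Y t).
Proof. exact (gmeas_measurable (@subF t.+1) (@adY t)). Qed.

Let Ltrunc t : Lint P (fun w => trunc t (Y t w)).
Proof. by apply: (@Lint_bounded _ _ _ _ _ t.+1%:R) => [|w]; [exact: (measurableT_comp (@mtrunc t) (@mY t))|]. Qed.

Let adZ t : gmeas (F t.+1) (Z t).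
Proof.
by apply: measurable_funB => //; apply: (measurableT_comp (@mtrunc t)); exact: (@adY t).
Qed.

Let adM n : gmeas (F n) (M n).
Proof.
apply: measurable_funM => //; apply: measurable_sum => s.
by apply: gmeasS (@adZ s); exact: (filtration_le filF).
Qed.

Let m_bound t : `|m t| <= t.+1%:R.
Proof.
rewrite /m ler_norml; apply/andP; split.
  rewrite -[leLHS](Er_cst P); apply: Er_le => //; first exact: Lint_cst.
  by move=> w; move: (trunc_bound t (Y t w)); rewrite ler_norml => /andP[].
rewrite -[leRHS](Er_cst P); apply: Er_le => //; first exact: Lint_cst.
by move=> w; move: (trunc_bound t (Y t w)); rewrite ler_norml => /andP[].
Qed.

Let Z_bound t w : `|Z t w| <= t.+1%:R + t.+1%:R.
Proof. by apply: (le_trans (ler_normB _ _)); apply: lerD. Qed.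

Let mZ t : measurable_fun setT (Z t).
Proof. exact (gmeas_measurable (@subF t.+1) (@adZ t)). Qed.

Let LZ t : Lint P (Z t).
Proof. exact: Lint_bounded (@mZ t) (Z_bound t). Qed.

Let EZ t : Er P (Z t) = 0.
Proof. rewrite /Z ErB; [by rewrite Er_cst subrr|exact: Ltrunc|exact: Lint_cst]. Qed.

Let mM n : measurable_fun setT (M n).
Proof. exact (gmeas_measurable (@subF n) (@adM n)). Qed.

Let M_bound n : exists K, forall w, `|M n w| <= K.
Proof.
exists (n%:R^-1 * \sum_(s < n) (s.+1%:R + s.+1%:R)) => w.
rewrite normrM ger0_norm ?invr_ge0 // ler_wpM2l ?invr_ge0 //.
by apply: (le_trans (ler_norm_sum _ _ _)); apply: ler_sum => s _; exact: Z_bound.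
Qed.

Let M_step t w : M t.+1 w = (1 - t.+1%:R^-1) * M t w + t.+1%:R^-1 * Z t w.
Proof.
rewrite /M big_ord_recr /= mulrDr; congr (_ + _).
case: t => [|t]; first by rewrite invr1 subrr mul0r big_ord0 mulr0.
rewrite mulrA; congr (_ * _).
have e : (t.+2%:R : R) = t.+1%:R + 1 by rewrite natr1.
rewrite e; have : (0 : R) < t.+1%:R by [].
by move: (t.+1%:R : R) => u u0; field; rewrite !gt_eqF //; lra.
Qed.

(** Where the truncation is inactive, [|Y|^2 <= (t+1)^(2-q) |Y|^q]. After the factor [(t+1)^-2] of
    the averaging step the variance is of order [(t+1)^-q], which is summable. *)
Let EZ2 t : Er P (fun w => Z t w ^+ 2) <= C * t.+1%:R `^ (2 - q).
Proof.
have LT2 : Lint P (fun w => trunc t (Y t w) ^+ 2).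
  apply: (@Lint_bounded _ _ _ _ _ (t.+1%:R ^+ 2)).
    by apply: measurable_funX; exact: (measurableT_comp (@mtrunc t) (@mY t)).
  by move=> w; rewrite normrX ler_pXn2r ?nnegrE.
have E : (fun w => Z t w ^+ 2) = (fun w => (trunc t (Y t w) ^+ 2 + (- (2 * m t)) * trunc t (Y t w)) + m t ^+ 2).
  by apply/funext => w; rewrite /Z; ring.
rewrite E ErD; [|by apply: LintD => //; exact: LintZ|exact: Lint_cst].
rewrite ErD //; last exact: LintZ.
rewrite ErZ // Er_cst -/(m t).
apply: (@le_trans _ _ (Er P (fun w => trunc t (Y t w) ^+ 2))).
  have := sqr_ge0 (m t); rewrite expr2; lra.
apply: (@le_trans _ _ (Er P (fun w => t.+1%:R `^ (2 - q) * `|Y t w| `^ q))).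
  apply: Er_le => //; first exact: LintZ.
  move=> w; rewrite /trunc; case: ifP => h; last by rewrite expr0n mulr_ge0 ?powR_ge0.
  rewrite -(real_normK (num_real (Y t w))) -powR_mulrn //.
  have [y0|y0] := eqVneq `|Y t w| 0.
    by rewrite y0 powR0 ?pnatr_eq0 // mulr_ge0 ?powR_ge0.
  have {1}-> : 2%:R = (2 - q) + q :> R by rewrite subrK.
  rewrite powRD; last by rewrite y0 implybT.
  rewrite ler_wpM2r ?powR_ge0 //; apply: ge0_ler_powR => //; rewrite ?nnegrE ?subr_ge0 //.
by rewrite ErZ // mulrC ler_wpM2r ?powR_ge0.
Qed.

Let LM2 n : Lint P (fun w => M n w ^+ 2).
Proof.
have [K hK] := M_bound n; apply: (@Lint_bounded _ _ _ _ _ (K ^+ 2)).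
  by apply: measurable_funX; exact: (@mM n).
by move=> w; rewrite normrX ler_pXn2r ?nnegrE // (le_trans _ (hK w)).
Qed.

Let LZ2 t : Lint P (fun w => Z t w ^+ 2).
Proof.
apply: (@Lint_bounded _ _ _ _ _ ((t.+1%:R + t.+1%:R) ^+ 2)); first by apply: measurable_funX; exact: (@mZ t).
by move=> w; rewrite normrX ler_pXn2r ?nnegrE.
Qed.

Let orthM t A : F t A -> Er P (fun w => \1_A w * M t w * Z t w) = 0.
Proof.
move=> FA.
have mA : measurable A by exact: subF FA.
have gf : gmeas (F t) (fun w => \1_A w * M t w).
  by apply: measurable_funM; [exact: gmeas_indic|exact: (@adM t)].
have Lf : Lint P (fun w => \1_A w * M t w).
  apply: Lint_indicM => //; have [K hK] := M_bound t; exact: (Lint_bounded P (@mM t) hK).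
rewrite /Z (@indY t (fun w => \1_A w * M t w) (fun y => trunc t y - m t)) //.
- by rewrite -/(Z t) EZ mulr0.
- by apply: measurable_funB => //; exact: (@mtrunc t).
- exact: LZ.
Qed.

Let C0 : 0 <= C.
Proof. by apply: le_trans (EYq 0); apply: Er_ge0 => w; exact: powR_ge0. Qed.

(** Any exponent strictly between [0] and [q - 1] would do: positive to force [M] to [0], and with
    [1 < q - rho] to keep the weighted noise summable. *)
Let rho := (q - 1) / 2.

Let M_cvg0 : {ae P, forall w, M ^~ w @ \oo --> 0}.
Proof.
have rho0 : 0 < rho by rewrite /rho divr_gt0 // subr_gt0.
have rho1 : rho <= 1 by rewrite /rho; move: q1 q2 => ? ?; lra.
have s1 : 1 < q - rho by rewrite /rho; move: q1 q2 => ? ?; lra.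
(* The decay exponent is [1], because [(1 - 1/(t+1))^2 <= 1 - 1/(t+1)]. *)
have := @weighted_supermartingale_bounded F (fun t w => M t w ^+ 2) 0 rho 1 q C filF.
move=> H; have : {ae P, forall w, exists K : R, forall n, (n + 0).+1%:R `^ rho * M (n + 0)%N w ^+ 2 <= K}.
  apply: H => //.
  - by move=> t; apply: measurable_funX; exact: (@adM t).
  - by move=> t w; exact: sqr_ge0.
  - exact: ltW.
  move=> t A _ FA; have mA : measurable A by exact: subF FA.
  have -> : (fun w => \1_A w * M t.+1 w ^+ 2) =
     (fun w => \1_A w * ((1 - t.+1%:R^-1) * M t w + t.+1%:R^-1 * Z t w) ^+ 2).
    by apply/funext => w; rewrite M_step.
  have LgA : Lint P (fun w => \1_A w * M t w ^+ 2) by exact: Lint_indicM.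
  have Lg2 : Lint P (fun w => ((1 - t.+1%:R^-1) * M t w) ^+ 2).
    by under eq_fun do rewrite exprMn; exact: LintZ.
  have := @Er_indic_sqrD A (fun w => (1 - t.+1%:R^-1) * M t w) (Z t) t.+1%:R^-1 (C * t.+1%:R `^ (2 - q)) mA.
  move=> /(_ _ _ Lg2 (LZ2 t) (EZ2 t)) hs.
  have {}hs := hs (measurable_funM (measurable_cst _) (@mM t)) (@mZ t).
  apply: (le_trans (hs _)).
    have -> : (fun w => \1_A w * ((1 - t.+1%:R^-1) * M t w) * Z t w) =
      (fun w => (1 - t.+1%:R^-1) * (\1_A w * M t w * Z t w)).
      by apply/funext => w; ring.
    rewrite ErZ ?orthM ?mulr0 //.
    have -> : (fun w => \1_A w * M t w * Z t w) = (fun w => \1_A w * (M t w * Z t w)).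
      by apply/funext => w; rewrite -mulrA.
    by apply: Lint_indicM => //; exact: Lint_sqr_mul.
  have -> : (fun w => \1_A w * ((1 - t.+1%:R^-1) * M t w) ^+ 2) =
     (fun w => (1 - t.+1%:R^-1) ^+ 2 * (\1_A w * M t w ^+ 2)).
    by apply/funext => w; ring.
  have u0 : 0 <= 1 - t.+1%:R^-1 :> R by rewrite subr_ge0 invf_le1 // ler1n.
  rewrite ErZ // mul1r; apply: lerD.
    apply: ler_wpM2r; last by rewrite expr2 ler_piMr // gerBl invr_ge0.
    by apply: Er_ge0 => w; rewrite mulr_ge0 ?sqr_ge0 // indicE.
  have -> : t.+1%:R `^ (- q) = t.+1%:R^-1 ^+ 2 * t.+1%:R `^ (2 - q).
    have {1}-> : - q = - 2%:R + (2 - q) by ring.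
    by rewrite powRD ?pnatr_eq0 ?implybT // powR_invn // exprVn.
  by apply: eqr_le; ring.
apply: filterS => w [K hK]; apply: (cvg0_of_sqr_weighted rho0 (K := K)) => t.
by have := hK t; rewrite addn0.
Qed.

(** Where the truncation is active, [|Y| > t + 1] gives [|Y| <= (t+1)^-(q-1) |Y|^q]; so the bias of
    the truncated mean vanishes. *)
Let m_err t : `|m t - mu| <= C * t.+1%:R `^ (- (q - 1)).
Proof.
have t1 : (0 : R) < t.+1%:R by [].
have h w : `|trunc t (Y t w) - Y t w| <= t.+1%:R `^ (- (q - 1)) * `|Y t w| `^ q.
  rewrite /trunc; case: ifPn => h.
    by rewrite subrr normr0 mulr_ge0 ?powR_ge0.
  rewrite sub0r normrN; rewrite -ltNge in h.
  have y0 : 0 < `|Y t w| by exact: lt_trans h.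
  rewrite -[leLHS](powRr1 (ltW y0)).
  have {1}-> : 1 = - (q - 1) + q by ring.
  rewrite powRD; last by rewrite (gt_eqF y0) implybT.
  rewrite ler_wpM2r ?powR_ge0 // !powRN.
  rewrite lef_pV2 ?posrE ?powR_gt0 //; apply: ge0_ler_powR; rewrite ?nnegrE ?(ltW h) //.
  by rewrite subr_ge0 ltW.
have LD : Lint P (fun w => trunc t (Y t w) - Y t w) by exact: LintB.
have LR : Lint P (fun w => t.+1%:R `^ (- (q - 1)) * `|Y t w| `^ q) by exact: LintZ.
have e1 : m t - mu = Er P (fun w => trunc t (Y t w) - Y t w) by rewrite ErB // EY.
have e2 : Er P (fun w => t.+1%:R `^ (- (q - 1)) * `|Y t w| `^ q) <= C * t.+1%:R `^ (- (q - 1)).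
  by rewrite ErZ // mulrC ler_wpM2r ?powR_ge0.
rewrite e1 ler_norml; apply/andP; split.
  rewrite lerNl; apply: le_trans e2; rewrite -[X in X <= _]mulN1r -ErZ //.
  apply: Er_le => //; first exact: LintZ.
  by move=> w; rewrite mulN1r; apply: le_trans (h w); rewrite -normrN ler_norm.
apply: le_trans e2; apply: Er_le => // w.
by apply: le_trans (h w); exact: ler_norm.
Qed.

(* [M] averages the centred truncations of [Y s] at level [s + 1]. *)
Theorem slln : {ae P, forall w, (fun n => n%:R^-1 * \sum_(s < n) Y s w - mu) @ \oo --> 0}.
Proof.
have [K [K0 HK]] := powR_series_bounded q1.
(* Convergence to [0] of this normalized power forces [|Y t| <= t + 1] for all large [t], so almost
   every path is truncated only finitely often. *)
have ev : {ae P, forall w, (fun t => t.+1%:R `^ (- q) * `|Y t w| `^ q) @ \oo --> 0}.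
  apply: (@ae_cvg0_of_summable _ _ _ P (fun t w => t.+1%:R `^ (- q) * `|Y t w| `^ q) (C * K)).
  - by move=> n w; rewrite mulr_ge0 ?powR_ge0.
  - by move=> n; exact: LintZ.
  - move=> n; apply: (@le_trans _ _ (\sum_(0 <= k < n) C * k.+1%:R `^ (- q))).
      by apply: ler_sum => k _; rewrite ErZ // mulrC ler_wpM2r ?powR_ge0.
    by rewrite -mulr_sumr ler_wpM2l.
apply: filterS2 M_cvg0 ev => w Mw Yw.
have same : \forall t \near \oo, trunc t (Y t w) = Y t w.
  move/cvgrPdist_lt: Yw => /(_ 1 ltr01); apply: filterS => t.
  rewrite sub0r normrN ger0_norm ?mulr_ge0 ?powR_ge0 // => h.
  have t1 : (0 : R) < t.+1%:R by [].
  rewrite /trunc; case: ifPn => //; rewrite -ltNge => h'; exfalso; move: h.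
  rewrite powRN mulrC ltr_pdivrMr ?powR_gt0 // mul1r ltNge => /negP; apply.
  by apply: ge0_ler_powR; rewrite ?nnegrE ?(ltW h') // (ltW (lt_trans ltr01 q1)).
(* The remaining difference obeys the averaging recursion of weight [1/(t+1)], whose input is the
   truncation error plus the bias. *)
pose y n := n%:R^-1 * \sum_(s < n) Y s w - M n w - mu.
have yc : y @ \oo --> 0.
  apply: (@averaging_cvg0 _ (fun t => t.+1%:R^-1) (fun t => (Y t w - trunc t (Y t w)) + (m t - mu)) y 0%N).
  - by move=> t _; rewrite lexx /= invf_le1 // ler1n.
  - move=> t _; rewrite /y M_step /Z big_ord_recr /=.
    case: t => [|t]; first by rewrite big_ord0 /M big_ord0 invr1; ring.
    move: (\sum_(i < t.+1) _) (M _ _) => S M'.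
    have e : (t.+2%:R : R) = t.+1%:R + 1 by rewrite natr1.
    rewrite e; have : (0 : R) < t.+1%:R by [].
    by move: (t.+1%:R : R) => u u0; field; rewrite !gt_eqF //; lra.
  - rewrite -[0]addr0; apply: cvgD.
      apply: cvg_near_cst; apply: filterS same => t ->; exact: subrr.
    have c0 : (fun t => C * t.+1%:R `^ (- (q - 1))) @ \oo --> 0.
      rewrite -(mulr0 C); apply: cvgMr; by apply: cvg_powRN; rewrite subr_gt0.
    by apply: cvg0_le c0; exact: nearW.
have -> : (fun n => n%:R^-1 * \sum_(s < n) Y s w - mu) = (fun n => y n + M n w).
  by apply/funext => n; rewrite /y; ring.
by rewrite -[0]addr0; apply: cvgD.
Qed.

End SLLN.
End LawOfLargeNumbers.

(** * Measurability and convergence of matrix expressions, inverses included *)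

Section MatrixMeasurability.
Context {d : measure_display} {T : measurableType d} {R : realType}.

Lemma mxmeas_cst m n (A : 'M[R]_(m, n)) : mxmeas (fun _ : T => A).
Proof. by move=> i j; exact: measurable_cst. Qed.

Lemma mxmeas_eq m n (X Y : T -> 'M[R]_(m, n)) : (forall w, X w = Y w) -> mxmeas Y -> mxmeas X.
Proof. by move=> /funext ->. Qed.

Lemma mxmeasD m n (X Y : T -> 'M[R]_(m, n)) : mxmeas X -> mxmeas Y ->
  mxmeas (fun w => X w + Y w).
Proof.
by move=> hX hY i j; under eq_fun do rewrite mxE; apply: measurable_funD; [exact: hX|exact: hY].
Qed.

Lemma mxmeasZf m n (f : T -> R) (X : T -> 'M[R]_(m, n)) : measurable_fun setT f ->
  mxmeas X -> mxmeas (fun w => f w *: X w).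
Proof.
by move=> hf hX i j; under eq_fun do rewrite mxE; apply: measurable_funM; [exact: hf|exact: hX].
Qed.

Lemma mxmeasZ m n c (X : T -> 'M[R]_(m, n)) : mxmeas X -> mxmeas (fun w => c *: X w).
Proof. by move=> hX; apply: mxmeasZf => //; exact: measurable_cst. Qed.

Lemma mxmeasN m n (X : T -> 'M[R]_(m, n)) : mxmeas X -> mxmeas (fun w => - X w).
Proof.
by move=> hX; apply: (mxmeas_eq (Y := fun w => (-1) *: X w)) => [w|];
  [rewrite scaleN1r|exact: mxmeasZ].
Qed.

Lemma mxmeasB m n (X Y : T -> 'M[R]_(m, n)) : mxmeas X -> mxmeas Y ->
  mxmeas (fun w => X w - Y w).
Proof. by move=> hX hY; apply: mxmeasD => //; exact: mxmeasN. Qed.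

Lemma mxmeasT m n (X : T -> 'M[R]_(m, n)) : mxmeas X -> mxmeas (fun w => (X w)^T).
Proof. by move=> hX i j; under eq_fun do rewrite mxE; exact: hX. Qed.

Lemma mxmeasM m n p (X : T -> 'M[R]_(m, n)) (Y : T -> 'M[R]_(n, p)) : mxmeas X -> mxmeas Y ->
  mxmeas (fun w => X w *m Y w).
Proof.
move=> hX hY i j; under eq_fun do rewrite mxE.
by apply: measurable_sum => k; apply: measurable_funM; [exact: hX|exact: hY].
Qed.

Lemma mxmeas_sum m n (I : Type) (r : seq I) (X : I -> T -> 'M[R]_(m, n)) :
  (forall i, mxmeas (X i)) -> mxmeas (fun w => \sum_(i <- r) X i w).
Proof.
move=> hX; elim: r => [|x r IH].
  by apply: (mxmeas_eq (Y := fun=> 0)) => [w|]; [rewrite big_nil|exact: mxmeas_cst].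
apply: (mxmeas_eq (Y := fun w => X x w + \sum_(i <- r) X i w)) => [w|].
  by rewrite big_cons.
exact: mxmeasD.
Qed.

Lemma measurable_mxdot m n (X Y : T -> 'M[R]_(m, n)) : mxmeas X -> mxmeas Y ->
  measurable_fun setT (fun w => mxdot (X w) (Y w)).
Proof.
move=> hX hY; apply: measurable_sum => i; apply: measurable_sum => j.
by apply: measurable_funM; [exact: hX|exact: hY].
Qed.

Lemma measurable_sqrt : measurable_fun setT (@Num.sqrt R).
Proof. by apply: continuous_measurable_fun; exact: sqrt_continuous. Qed.

Lemma measurable_fnorm m n (X : T -> 'M[R]_(m, n)) : mxmeas X ->
  measurable_fun setT (fun w => fnorm (X w)).
Proof.
move=> hX; apply: (measurableT_comp measurable_sqrt).
exact: measurable_mxdot.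
Qed.

Lemma measurable_det n (X : T -> 'M[R]_n) : mxmeas X ->
  measurable_fun setT (fun w => \det (X w)).
Proof.
move=> hX; rewrite /determinant; apply: measurable_sum => s.
apply: measurable_funM; first exact: measurable_cst.
by apply: measurable_prod => i _; exact: hX.
Qed.

Lemma mxmeas_ifb m n (f : T -> bool) (X Y : T -> 'M[R]_(m, n)) : measurable_fun setT f ->
  mxmeas X -> mxmeas Y -> mxmeas (fun w => if f w then X w else Y w).
Proof.
move=> hf hX hY i j.
have -> : (fun w => (if f w then X w else Y w) i j) =
          (fun w => if f w then X w i j else Y w i j).
  by apply/funext => w; case: (f w).
by apply: measurable_fun_ifT.
Qed.

(** The formula [x * (x^2)^-1] reduces the inverse to a power function and keeps the convention that
    the inverse of [0] is [0]. *)
Lemma measurable_invr : measurable_fun setT (fun x : R => x^-1).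
Proof.
have -> : (fun x : R => x^-1) = (fun x => x * (x ^+ 2) `^ (-1)).
  apply/funext => x; rewrite powR_inv1 ?sqr_ge0 //.
  have [->|x0] := eqVneq x 0; first by rewrite mul0r invr0.
  by field.
apply: measurable_funM => //; apply: (measurableT_comp (measurable_powR _)).
exact: measurable_funX.
Qed.

(** Cramer's rule: off the zero set of the determinant the entries are cofactors divided by it. On
    that set [invmx] returns its argument, hence the case distinction. *)
Lemma mxmeas_invmx n (X : T -> 'M[R]_n) : mxmeas X -> mxmeas (fun w => invmx (X w)).
Proof.
move=> hX; rewrite /invmx.
have e w : (X w \in unitmx) = ~~ (\det (X w) == 0) by rewrite unitmxE unitfE.
under eq_fun do rewrite e.
apply: mxmeas_ifb => //.
  apply: measurable_neg; apply: measurable_fun_eqr => //; exact: measurable_det.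
apply: mxmeasZf.
  have -> : (fun w => (\det (X w))^-1) = (fun x : R => x^-1) \o (fun w => \det (X w)) by [].
  apply: measurableT_comp; last exact: measurable_det.
  exact: measurable_invr.
move=> i j; under eq_fun do rewrite mxE /cofactor.
apply: measurable_funM; first exact: measurable_cst.
apply: measurable_det => k l; under eq_fun do rewrite !mxE; exact: hX.
Qed.

End MatrixMeasurability.

Section MatrixConvergence.
Context {R : realType}.

Definition mxcv {m n : nat} (X : nat -> 'M[R]_(m, n)) (A : 'M[R]_(m, n)) :=
  (fun t => fnorm (X t - A)) @ \oo --> 0.

Lemma mxcv_cst m n (A : 'M[R]_(m, n)) : mxcv (fun=> A) A.
Proof.
rewrite /mxcv; have -> : (fun t : nat => fnorm (A - A)) = (fun=> 0).
  by apply/funext => t; rewrite subrr fnorm0.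
exact: cvg0_cst.
Qed.

Lemma mxcv_le m n (X : nat -> 'M[R]_(m, n)) A (v : nat -> R) :
  (\forall t \near \oo, fnorm (X t - A) <= v t) -> v @ \oo --> 0 -> mxcv X A.
Proof.
move=> h hv; apply: cvg0_le hv; apply: filterS h => t.
by rewrite ger0_norm ?fnorm_ge0.
Qed.

Lemma mxcvD m n (X Y : nat -> 'M[R]_(m, n)) A B : mxcv X A -> mxcv Y B ->
  mxcv (fun t => X t + Y t) (A + B).
Proof.
move=> hX hY; apply: (mxcv_le (v := fun t => fnorm (X t - A) + fnorm (Y t - B))).
  apply: nearW => t.
  have -> : X t + Y t - (A + B) = (X t - A) + (Y t - B) by rewrite opprD addrACA.
  exact: ler_fnormD.
exact: cvg0D.
Qed.

Lemma mxcvM m n p (X : nat -> 'M[R]_(m, n)) (Y : nat -> 'M[R]_(n, p)) A B :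
  mxcv X A -> mxcv Y B -> mxcv (fun t => X t *m Y t) (A *m B).
Proof.
move=> hX hY; apply: (mxcv_le (v := fun t => fnorm (X t - A) * fnorm (Y t - B) +
  (fnorm A * fnorm (Y t - B) + fnorm (X t - A) * fnorm B))).
  apply: nearW => t.
  have -> : X t *m Y t - A *m B = (X t - A) *m (Y t - B) + (A *m (Y t - B) + (X t - A) *m B).
    by rewrite addrA -mulmxDl subrK mulmxBr mulmxBl addrA subrK.
  apply: (le_trans (ler_fnormD _ _)); apply: lerD; first exact: ler_fnormM.
  by apply: (le_trans (ler_fnormD _ _)); apply: lerD; exact: ler_fnormM.
apply: cvg0D; first exact: cvg0M.
apply: cvg0D; first exact: cvg0Z.
by under eq_fun do rewrite mulrC; exact: cvg0Z.
Qed.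

Lemma mxcvZ m n (u : nat -> R) (X : nat -> 'M[R]_(m, n)) c A :
  (fun t => u t - c) @ \oo --> 0 -> mxcv X A ->
  mxcv (fun t => u t *: X t) (c *: A).
Proof.
move=> hu hX; apply: (mxcv_le (v := fun t => `|u t - c| * fnorm (X t - A) +
  (`|c| * fnorm (X t - A) + `|u t - c| * fnorm A))).
  apply: nearW => t.
  have -> : u t *: X t - c *: A = (u t - c) *: (X t - A) + (c *: (X t - A) + (u t - c) *: A).
    by apply/matrixP => i j; rewrite !mxE; ring.
  apply: (le_trans (ler_fnormD _ _)); apply: lerD; first by rewrite fnormZ.
  by apply: (le_trans (ler_fnormD _ _)); rewrite !fnormZ.
have hu' := cvg0_norm hu.
apply: cvg0D; first exact: cvg0M.
apply: cvg0D; first exact: cvg0Z.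
by under eq_fun do rewrite mulrC; exact: cvg0Z.
Qed.

Lemma mxcvN m n (X : nat -> 'M[R]_(m, n)) A : mxcv X A -> mxcv (fun t => - X t) (- A).
Proof.
move=> hX; rewrite /mxcv; have -> // : (fun t => fnorm (- X t - - A)) = (fun t => fnorm (X t - A)).
by apply/funext => t; rewrite -opprD fnormN.
Qed.

Lemma mxcvT m n (X : nat -> 'M[R]_(m, n)) A : mxcv X A -> mxcv (fun t => (X t)^T) A^T.
Proof.
move=> hX; rewrite /mxcv; have -> // : (fun t => fnorm ((X t)^T - A^T)) = (fun t => fnorm (X t - A)).
by apply/funext => t; rewrite -linearB /= fnorm_tr.
Qed.

Lemma mxcv_entries m n (X : nat -> 'M[R]_(m, n)) (A : 'M[R]_(m, n)) :
  (forall i j, (fun t => X t i j - A i j) @ \oo --> 0) -> mxcv X A.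
Proof.
move=> h; apply: (mxcv_le (v := fun t => \sum_i \sum_j `|X t i j - A i j|)).
  apply: nearW => t; apply: (le_trans (fnorm_le_sum _)).
  by apply: ler_sum => i _; apply: ler_sum => j _; rewrite !mxE.
by apply: cvg0_sum => i; apply: cvg0_sum => j; exact: cvg0_norm.
Qed.

Lemma mxcv_entry m n (X : nat -> 'M[R]_(m, n)) A i j : mxcv X A ->
  (fun t => X t i j - A i j) @ \oo --> 0.
Proof.
move=> h; apply: cvg0_le h; apply: nearW => t.
by have := ler_fnorm_entry (X t - A) i j; rewrite !mxE.
Qed.

Lemma fnorm_eq0_inv m n (A : 'M[R]_(m, n)) : fnorm A <= 0 -> A = 0.
Proof.
move=> h; apply/matrixP => i j; rewrite mxE; apply/eqP; rewrite -normr_eq0 eq_le normr_ge0 andbT.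
exact: le_trans (ler_fnorm_entry _ _ _) h.
Qed.

(** A row [v] with [v B = 0] satisfies [v = v (1 - B)], so its norm is at most a factor below [1]
    times itself. *)
Lemma unitmx_near_id n (B : 'M[R]_n) : fnorm (1%:M - B) < 1 -> B \in unitmx.
Proof.
move=> h; rewrite -row_free_unit -kermx_eq0; apply/eqP/row_matrixP => i; rewrite row0.
set v := row i (kermx B).
have vB : v *m B = 0 by rewrite -row_mul mulmx_ker row0.
have e : v = v *m (1%:M - B) by rewrite mulmxBr mulmx1 vB subr0.
apply: fnorm_eq0_inv.
have := ler_fnormM v (1%:M - B); rewrite -e => h2.
have := fnorm_ge0 v; rewrite le_eqVlt => /orP[/eqP <- //|v0].
by move: h2; rewrite -[leLHS]mulr1 ler_pM2l // leNgt h.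
Qed.

(** Once [|A^-1| |X - A| <= 1/2], the matrix [A^-1 X] is close enough to the identity for [X] to be
    invertible. The resolvent identity then bounds [Dl = X^-1 - A^-1] by [(|Dl| + a) a |X - A|], and
    the term with [|Dl|] is absorbed on the left. *)
Lemma mxcv_invmx n (X : nat -> 'M[R]_n) A : A \in unitmx -> mxcv X A ->
  mxcv (fun t => invmx (X t)) (invmx A).
Proof.
move=> uA hX; set a := fnorm (invmx A).
have a0 : 0 <= a by exact: fnorm_ge0.
have half : \forall t \near \oo, a * fnorm (X t - A) <= 2^-1.
  have c0 : (fun t => a * fnorm (X t - A)) @ \oo --> 0.
    exact: cvg0Z.
  have h2 : 0 < 2^-1 :> R by rewrite invr_gt0.
  move/cvgrPdist_le: c0 => /(_ _ h2); apply: filterS => t.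
  by rewrite sub0r normrN; apply: le_trans (ler_norm _).
apply: (mxcv_le (v := fun t => 2 * a ^+ 2 * fnorm (X t - A))); last first.
  exact: cvg0Z.
apply: filterS half => t ht.
have uX : X t \in unitmx.
  have : invmx A *m X t \in unitmx.
    apply: unitmx_near_id.
    have -> : 1%:M - invmx A *m X t = - (invmx A *m (X t - A)).
      by rewrite mulmxBr mulVmx // opprB.
    rewrite fnormN; apply: (le_lt_trans (ler_fnormM _ _)); apply: (le_lt_trans ht).
    by rewrite invf_lt1 // ltr1n.
  by rewrite unitmx_mul => /andP[].
set Dl := invmx (X t) - invmx A.
have e : Dl = - (invmx (X t) *m (X t - A) *m invmx A).
  by rewrite /Dl mulmxBr mulVmx // mulmxBl mul1mx mulmxK // opprB.
have h1 : fnorm Dl <= (fnorm Dl + a) * (fnorm (X t - A) * a).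
  rewrite {1}e fnormN; apply: (le_trans (ler_fnormM _ _)).
  rewrite [X in _ <= X]mulrA ler_wpM2r //; apply: (le_trans (ler_fnormM _ _)).
  rewrite ler_wpM2r ?fnorm_ge0 //.
  have -> : invmx (X t) = Dl + invmx A by rewrite subrK.
  exact: ler_fnormD.
have D0 := fnorm_ge0 Dl; have x0 := fnorm_ge0 (X t - A).
have h2 : fnorm Dl * (a * fnorm (X t - A)) <= fnorm Dl * 2^-1 by rewrite ler_wpM2l.
rewrite expr2; lra.
Qed.

Lemma mxcv_bounded m n (X : nat -> 'M[R]_(m, n)) A : mxcv X A ->
  exists K : R, forall t, fnorm (X t) <= K.
Proof.
move=> h.
have : \forall t \near \oo, fnorm (X t - A) <= 1.
  move/cvgrPdist_le: h => /(_ 1 ltr01); apply: filterS => t.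
  by rewrite sub0r normrN; apply: le_trans (ler_norm _).
case=> t0 _ ht0; exists (\sum_(s < t0) fnorm (X s) + (fnorm A + 1)) => t.
have [tt|tt] := ltnP t t0.
  rewrite (bigD1 (Ordinal tt)) //= -addrA lerDl !addr_ge0 ?fnorm_ge0 //.
  by apply: sumr_ge0 => i _; exact: fnorm_ge0.
rewrite -[X in fnorm X <= _](subrK A); apply: (le_trans (ler_fnormD _ _)).
rewrite addrC -[leLHS]add0r; apply: lerD; first by apply: sumr_ge0 => i _; exact: fnorm_ge0.
by rewrite lerD2l; exact: ht0.
Qed.

End MatrixConvergence.

(** * Network average and disagreement *)

Section Averaging.
Context {R : realType}.
Variable N : nat.

Definition avgmx : 'rV[R]_N := N%:R^-1 *: const_mx 1.
Definition perpmx : 'M[R]_N := 1%:M - const_mx 1 *m avgmx.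

Lemma perp_decomp q (Z : 'M[R]_(N, q)) : Z = perpmx *m Z + const_mx 1 *m (avgmx *m Z).
Proof. by rewrite /perpmx mulmxBl mul1mx mulmxA subrK. Qed.

Lemma ones_laplacian (L : 'M[R]_N) : is_simple_laplacian L ->
  (const_mx 1 : 'rV[R]_N) *m L = 0.
Proof.
move=> hL; apply/matrixP => i j; rewrite !mxE -[RHS](simple_laplacian_row hL j).
by apply: eq_bigr => k _; rewrite mxE mul1r; case: (hL k j).
Qed.

Lemma laplacian_ones (L : 'M[R]_N) : is_simple_laplacian L ->
  L *m (const_mx 1 : 'cV[R]_N) = 0.
Proof.
move=> hL; apply/matrixP => i j; rewrite !mxE -[RHS](simple_laplacian_row hL i).
by apply: eq_bigr => k _; rewrite mxE mulr1.
Qed.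

Lemma avg_laplacian (L : 'M[R]_N) : is_simple_laplacian L -> avgmx *m L = 0.
Proof. by move=> hL; rewrite /avgmx -scalemxAl ones_laplacian // scaler0. Qed.

Lemma perp_laplacian (L : 'M[R]_N) : is_simple_laplacian L -> perpmx *m L = L *m perpmx.
Proof.
move=> hL; rewrite /perpmx mulmxBl mul1mx mulmxBr mulmx1 -mulmxA avg_laplacian //.
by rewrite mulmx0 mulmxA laplacian_ones // mul0mx.
Qed.

(** The columns of [L] sum to zero, so communication conserves the network average and only the
    input moves it. *)
Lemma avg_step q (L : 'M[R]_N) (Z U : 'M[R]_(N, q)) b a : is_simple_laplacian L ->
  avgmx *m (Z - b *: (L *m Z) + a *: U) = avgmx *m Z + a *: (avgmx *m U).
Proof.
move=> hL; rewrite mulmxDr mulmxBr -!scalemxAr mulmxA avg_laplacian // mul0mx.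
by rewrite scaler0 subr0.
Qed.

Lemma perp_step q (L : 'M[R]_N) (Z U : 'M[R]_(N, q)) b a : is_simple_laplacian L ->
  perpmx *m (Z - b *: (L *m Z) + a *: U) =
  perpmx *m Z - b *: (L *m (perpmx *m Z)) + a *: (perpmx *m U).
Proof.
by move=> hL; rewrite mulmxDr mulmxBr -!scalemxAr !mulmxA perp_laplacian.
Qed.

Lemma avg_ones : (0 < N)%N -> avgmx *m (const_mx 1 : 'cV[R]_N) = 1%:M.
Proof.
move=> N0; apply/matrixP => i j; rewrite !ord1 /avgmx -scalemxAl !mxE eqxx.
under eq_bigr do rewrite !mxE mulr1.
by rewrite sumr_const card_ord mulVf // pnatr_eq0 -lt0n.
Qed.

Lemma perp_colsum q (Z : 'M[R]_(N, q)) k : (0 < N)%N ->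
  \sum_i (perpmx *m Z) i k = 0.
Proof.
move=> N0.
have h : avgmx *m (perpmx *m Z) = 0.
  by rewrite mulmxA /perpmx mulmxBr mulmx1 mulmxA avg_ones // mul1mx subrr mul0mx.
have := congr1 (fun A : 'rV[R]_q => A 0 k) h; rewrite /avgmx -scalemxAl !mxE.
under eq_bigr do rewrite mxE mul1r.
by move=> /eqP; rewrite mulf_eq0 invr_eq0 pnatr_eq0 eqn0Ngt N0 => /eqP.
Qed.

End Averaging.
Arguments avgmx {R N}.
Arguments perpmx {R N}.

(** * Contraction of the disagreement in the mean *)

Section Contraction.
Context {d : measure_display} {T : measurableType d} {R : realType}.
Variables (P : probability T R) (F : nat -> set_system T) (N : nat).
Local Notation Lpbn p Z c := (Lpb P p (fun w => fnorm (Z w)) c).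
Variable L : nat -> T -> 'M[R]_N.
Hypotheses (filF : is_filtration F) (lapL : forall t w, is_simple_laplacian (L t w)).
Hypotheses (idL : ident_distr P L) (adL : adapted_indep P F L).
Hypothesis lamL : lambda2_pos (Emx P (L 0%N)).

Let subF t : F t `<=` measurable. Proof. by case: (filF t). Qed.
Let sigF t : sigma_algebra setT (F t). Proof. by case: (filF t). Qed.

Lemma laplacian_meas t : mxmeas (L t).
Proof.
move=> i j; apply: (gmeas_measurable (@subF t.+1)); apply: gmeas_preimage.
by case: (adL t) => h _; exact: h.
Qed.

Lemma laplacian_Lint t i j : Lint P (fun w => L t w i j).
Proof.
apply: (@Lint_bounded _ _ _ _ _ N%:R); first exact: laplacian_meas.
by move=> w; exact: simple_laplacian_entry.
Qed.

Lemma Emx_laplacian t i j : Emx P (L 0%N) i j = Er P (fun w => L t w i j).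
Proof.
rewrite mxE unlock.
have [] := @ident_distr_Er _ _ _ P _ _ L id t 0%N i j laplacian_meas idL.
- exact: measurable_id.
- exact: laplacian_Lint.
- by move=> _ /= ->.
Qed.

(** Symmetry, zero row sums and nonpositive off-diagonal entries survive expectation, so the mean is
    a weighted Laplacian and has a spectral gap; matrices are treated column by column. The cap at
    [1] later keeps the factors [1 - k b] positive. *)
Lemma Emx_laplacian_coercive : exists2 c : R, 0 < c <= 1 &
  forall q (Z : 'M[R]_(N, q)), (forall k, \sum_i Z i k = 0) ->
    c * mxdot Z Z <= mxdot Z (Emx P (L 0%N) *m Z).
Proof.
set B := Emx P (L 0%N).
have sB : B^T = B.
  apply/matrixP => i j; rewrite mxE !(Emx_laplacian 0).
  by congr Er; apply/funext => w; rewrite -[in RHS](simple_laplacian_sym (lapL 0 w)) mxE.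
have rB i : \sum_j B i j = 0.
  under eq_bigr do rewrite (Emx_laplacian 0).
  rewrite -Er_sum; last by move=> j; exact: laplacian_Lint.
  by under eq_fun do rewrite (simple_laplacian_row (lapL _ _)); rewrite Er_cst.
have oB i j : i != j -> 0 <= - B i j.
  move=> ij; rewrite (Emx_laplacian 0) -mulN1r -ErZ; last exact: laplacian_Lint.
  by apply: Er_ge0 => w; rewrite mulN1r simple_laplacian_offdiag.
have qB (v : 'cV[R]_N) : qform B v v = mxdot v (B *m v).
  by rewrite /qform mxdot_col mulmxA.
have pB v : 0 <= qform B v v by rewrite qB; exact: laplacian_qform_ge0.
have B1 : B *m const_mx 1 = 0 :> 'cV[R]_N.
  apply/matrixP => i j; rewrite mxE [RHS]mxE -[RHS](rB i).
  by apply: eq_bigr => k _; rewrite [X in _ * X]mxE mulr1.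
have [c c0 hc] := lambda2_pos_coercive sB pB B1 lamL.
exists (Num.min c 1); first by rewrite lt_min c0 ltr01 ge_min lexx orbT.
move=> q Z sZ; apply: (@le_trans _ _ (c * mxdot Z Z)).
  by rewrite ler_wpM2r ?mxdot_ge0 // ge_min lexx.
rewrite /mxdot exchange_big [leRHS]exchange_big mulr_sumr; apply: ler_sum => k _.
have sc : \sum_i (col k Z) i 0 = 0.
  by rewrite -[RHS](sZ k); apply: eq_bigr => i _; rewrite mxE.
have e1 : mxdot (col k Z) (col k Z) = \sum_i Z i k * Z i k.
  by apply: eq_bigr => i _; rewrite big_ord1 !mxE.
have e2 : mxdot (col k Z) (B *m col k Z) = \sum_i Z i k * (B *m Z) i k.
  have -> : B *m col k Z = col k (B *m Z) by rewrite !colE mulmxA.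
  by apply: eq_bigr => i _; rewrite big_ord1 [col k Z i 0]mxE [col k (B *m Z) i 0]mxE.
by have := hc _ sc; rewrite qB e1 e2.
Qed.

(* Pathwise [|(I - b L) Z|^p <= |Z|^(p-2) (|Z|^2 - b <Z, L Z>)]; then [L t] is
   replaced by its mean, being independent of [Z]. *)
Lemma laplacian_contraction_Er c t q (Z : T -> 'M[R]_(N, q)) (p b : R) :
  (forall q (Z : 'M[R]_(N, q)), (forall k, \sum_i Z i k = 0) ->
    c * mxdot Z Z <= mxdot Z (Emx P (L 0%N) *m Z)) ->
  gmxmeas (F t) Z ->
  (forall w k, \sum_i Z w i k = 0) -> 2 <= p -> 0 <= b -> 2 * N%:R * b <= 1 ->
  Lint P (fun w => fnorm (Z w) `^ p) ->
  Lint P (fun w => fnorm (Z w - b *: (L t w *m Z w)) `^ p) /\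
  Er P (fun w => fnorm (Z w - b *: (L t w *m Z w)) `^ p) <=
    (1 - c * b) * Er P (fun w => fnorm (Z w) `^ p).
Proof.
move=> hc gZ sZ p2 b0 b1 LZ.
have mZ : mxmeas Z by move=> i j; apply: (gmeas_measurable (@subF t)); exact: gZ.
have p20 : 0 <= p - 2 by rewrite subr_ge0.
have p0 : 0 <= p by apply: le_trans p2.
pose W w := Z w - b *: (L t w *m Z w).
have mW : mxmeas W.
  apply: mxmeasB => //; apply: mxmeasZ; apply: mxmeasM => //; exact: laplacian_meas.
pose r w := fnorm (Z w) `^ (p - 2).
have r0 w : 0 <= r w by exact: powR_ge0.
have rZ w : r w * mxdot (Z w) (Z w) = fnorm (Z w) `^ p.
  rewrite -fnorm_sqr /r; have [z0|z0] := eqVneq (fnorm (Z w)) 0.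
    by rewrite z0 expr0n mulr0 powR0 // gt_eqF // (lt_le_trans _ p2).
  rewrite -powR_mulrn ?fnorm_ge0 // -powRD ?z0 ?implybT //; congr powR; lra.
(* The weighted energy is linear in the entries of [L t], with these coefficients. They are
   [F t]-measurable and dominated by [|Z|^p], so independence can be used entry by entry. *)
pose X i j k w := r w * (Z w i k * Z w j k).
have X_le i j k w : `|X i j k w| <= fnorm (Z w) `^ p.
  rewrite -rZ /X normrM (ger0_norm (r0 w)) ler_wpM2l // normrM -fnorm_sqr expr2.
  by apply: ler_pM => //; exact: ler_fnorm_entry.
have gX i j k : gmeas (F t) (X i j k).
  apply: measurable_funM.
    apply: (measurableT_comp (measurable_powR (p - 2))).
    exact: (@measurable_fnorm _ (g_sigma_algebraType (F t))).
  by apply: measurable_funM; exact: gZ.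
have LX i j k : Lint P (X i j k).
  by apply: Lint_le LZ => //; apply: (gmeas_measurable (@subF t)).
have indX i j k : Lint P (fun w => X i j k w * L t w i j) /\
    Er P (fun w => X i j k w * L t w i j) = Er P (X i j k) * Emx P (L 0%N) i j.
  rewrite (Emx_laplacian t); apply: (@indep_Er _ _ _ P _ _ (L t) (F t)) => //.
  - exact: laplacian_meas.
  - by case: (adL t).
  - exact: gmeas_entry.
  - exact: laplacian_Lint.
have quadE (B : 'M[R]_N) w :
    r w * mxdot (Z w) (B *m Z w) = \sum_k \sum_i \sum_j X i j k w * B i j.
  rewrite /mxdot exchange_big mulr_sumr; apply: eq_bigr => k _.
  rewrite mulr_sumr; apply: eq_bigr => i _; rewrite mxE !mulr_sumr.
  by apply: eq_bigr => j _; rewrite /X; ring.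
have pw w : fnorm (W w) `^ p <= fnorm (Z w) `^ p - b * (r w * mxdot (Z w) (L t w *m Z w)).
  have st := simple_laplacian_step (Z w) (lapL t w) b0 b1; rewrite -/(W w) in st.
  have q0 := simple_laplacian_qform_ge0 (Z w) (lapL t w).
  have WZ : fnorm (W w) <= fnorm (Z w).
    rewrite ler_wsqrtr //; apply: (le_trans st); rewrite gerBl mulr_ge0 //.
  have -> : fnorm (W w) `^ p = fnorm (W w) `^ (p - 2) * mxdot (W w) (W w).
    rewrite -fnorm_sqr; have [z0|z0] := eqVneq (fnorm (W w)) 0.
      by rewrite z0 expr0n mulr0 powR0 // gt_eqF // (lt_le_trans _ p2).
    rewrite -powR_mulrn ?fnorm_ge0 // -powRD ?z0 ?implybT //; congr powR; lra.
  rewrite -rZ mulrCA -mulrBr.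
  apply: ler_pM => //; [exact: powR_ge0|exact: mxdot_ge0|].
  by apply: ge0_ler_powR => //; rewrite nnegrE fnorm_ge0.
have LQ : Lint P (fun w => r w * mxdot (Z w) (L t w *m Z w)).
  under eq_fun do rewrite quadE.
  by apply: Lint_sum => k; apply: Lint_sum => i; apply: Lint_sum => j; case: (indX i j k).
have LR : Lint P (fun w => fnorm (Z w) `^ p - b * (r w * mxdot (Z w) (L t w *m Z w))).
  by apply: LintB => //; exact: LintZ.
have LW : Lint P (fun w => fnorm (W w) `^ p).
  apply: Lint_le LR; last by move=> w; rewrite ger0_norm ?powR_ge0.
  apply: (measurableT_comp (measurable_powR p)); exact: measurable_fnorm.
split => //; apply: (le_trans (Er_le LW LR pw)).
rewrite ErB //; last exact: LintZ.
rewrite ErZ // mulrBl mul1r lerD2l lerN2 mulrAC mulrC ler_wpM2l //.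
have -> : Er P (fun w => r w * mxdot (Z w) (L t w *m Z w)) =
          Er P (fun w => r w * mxdot (Z w) (Emx P (L 0%N) *m Z w)).
  have L1 k i j : Lint P (fun w => X i j k w * L t w i j) by case: (indX i j k).
  have L2 k i j : Lint P (fun w => X i j k w * Emx P (L 0%N) i j).
    by under eq_fun do rewrite mulrC; exact: LintZ.
  under eq_fun do rewrite quadE; under [in RHS]eq_fun do rewrite quadE.
  rewrite !Er_sum; [|by move=> k; apply: Lint_sum => i; apply: Lint_sum|
                    by move=> k; apply: Lint_sum => i; apply: Lint_sum].
  apply: eq_bigr => k _; rewrite !Er_sum; [|by move=> i; apply: Lint_sum|by move=> i; apply: Lint_sum].
  apply: eq_bigr => i _; rewrite !Er_sum //.
  apply: eq_bigr => j _; case: (indX i j k) => _ ->.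
  by under [in RHS]eq_fun do rewrite mulrC; rewrite ErZ // mulrC.
have LB : Lint P (fun w => r w * mxdot (Z w) (Emx P (L 0%N) *m Z w)).
  under eq_fun do rewrite quadE.
  apply: Lint_sum => k; apply: Lint_sum => i; apply: Lint_sum => j.
  by under eq_fun do rewrite mulrC; exact: LintZ.
rewrite -ErZ //; apply: Er_le => //; first exact: LintZ.
by move=> w; rewrite -rZ mulrCA ler_wpM2l // hc.
Qed.

(** To pass from the [p]-th moment to the norm, take an integer [m >= p] and [k = c/m]: by Bernoulli
    [1 - c b <= (1 - k b)^m], and this is at most [(1 - k b)^p] since the base is at most [1]. *)
Lemma laplacian_contraction (p : R) : 2 <= p -> exists2 k : R, 0 < k <= 1 &
  forall t q (Z : T -> 'M[R]_(N, q)) (b c : R),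
  gmxmeas (F t) Z ->
  (forall w j, \sum_i Z w i j = 0) -> 0 <= b -> b <= 2^-1 -> 2 * N%:R * b <= 1 -> 0 < c ->
  Lpbn p Z c ->
  Lpb P p (fun w => fnorm (Z w - b *: (L t w *m Z w))) ((1 - k * b) * c).
Proof.
move=> p2; have [c /andP[c0 c1] hc] := Emx_laplacian_coercive.
have [m m0 pm] : exists2 m : nat, 0 < m%:R :> R & p <= m%:R.
  by exists (Num.truncn p).+1 => //; apply: ltW; exact: truncnS_gt.
have m1 : 1 <= m%:R :> R by rewrite ler1n -(ltr0n R).
exists (c / m%:R).
  by rewrite divr_gt0 //= ler_pdivrMr // mul1r (le_trans c1).
move=> t q Z b e gZ sZ b0 b1 b2 e0 [mf Lf Ef].
have fE (Y : T -> 'M[R]_(N, q)) : (fun w => `|fnorm (Y w)| `^ p) = (fun w => fnorm (Y w) `^ p).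
  by apply/funext => w; rewrite ger0_norm ?fnorm_ge0.
rewrite fE in Lf Ef.
have [LW EW] := laplacian_contraction_Er hc gZ sZ p2 b0 b2 Lf.
split; rewrite ?fE //.
  apply: measurable_fnorm; apply: mxmeasB.
    by move=> i j; apply: (gmeas_measurable (@subF t)); exact: gZ.
  apply: mxmeasZ; apply: mxmeasM; first exact: laplacian_meas.
  by move=> i j; apply: (gmeas_measurable (@subF t)); exact: gZ.
have k0 : 0 <= c / m%:R * b by rewrite mulr_ge0 // divr_ge0 // ltW.
have k1 : c / m%:R * b <= 2^-1.
  apply: le_trans b1; by rewrite ler_piMl // ler_pdivrMr // mul1r (le_trans c1).
have u0 : 0 < 1 - c / m%:R * b by rewrite subr_gt0 (le_lt_trans k1) // invf_lt1 // ltr1n.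
have cb : 1 - c * b <= (1 - c / m%:R * b) `^ p.
  apply: (@le_trans _ _ ((1 - c / m%:R * b) ^+ m)).
    have <- : m%:R * (c / m%:R * b) = c * b by rewrite mulrA [m%:R * _]mulrC divfK // gt_eqF.
    by apply: bernoulli_le; rewrite k0 /= (le_trans k1) // invf_le1 // ler1n.
  rewrite -powR_mulrn ?(ltW u0) //; apply: ger_powR => //.
  by rewrite u0 /= gerBl.
apply: (le_trans EW); rewrite powRM ?(ltW u0) ?(ltW e0) //.
have E0 : 0 <= Er P (fun w => fnorm (Z w) `^ p) by apply: Er_ge0 => w; exact: powR_ge0.
apply: (le_trans (ler_wpM2r E0 cb)).
by rewrite ler_wpM2l // powR_ge0.
Qed.

End Contraction.

(** * Step sizes, the balance between them, and almost sure rates *)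

Section StepSizes.
Context {R : realType}.
Variables (a b tau2 : R).
Hypotheses (a1 : 1 <= a) (b0 : 0 < b) (t20 : 0 < tau2) (t21 : tau2 < 2^-1).

Lemma alphaE t : step a 1 t = a / t.+1%:R.
Proof. by rewrite /step powRr1. Qed.

Lemma betaE t : step b tau2 t = b * t.+1%:R `^ (- tau2).
Proof. by rewrite /step powRN. Qed.

Lemma beta_gt0 t : 0 < step b tau2 t.
Proof. by rewrite /step divr_gt0 // powR_gt0. Qed.

Lemma alpha_gt0 t : 0 < step a 1 t.
Proof. by rewrite alphaE divr_gt0 // (lt_le_trans ltr01). Qed.

Lemma beta_cvg0 : step b tau2 @ \oo --> 0.
Proof.
have -> : step b tau2 = (fun t => b * t.+1%:R `^ (- tau2)).
  by apply/funext => t; rewrite betaE.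
by apply: cvg0Z; exact: cvg_powRN.
Qed.

Lemma alpha_cvg0 : step a 1 @ \oo --> 0.
Proof.
have -> : step a 1 = (fun t => a * t.+1%:R `^ (- 1)).
  by apply/funext => t; rewrite /step powRN.
by apply: cvg0Z; exact: cvg_powRN.
Qed.

Lemma cvg0_near_le (u : nat -> R) (e : R) : 0 < e -> u @ \oo --> 0 ->
  \forall t \near \oo, u t <= e.
Proof.
move=> e0 /cvgrPdist_le /(_ e e0); apply: filterS => t.
by rewrite sub0r normrN; apply: le_trans; exact: ler_norm.
Qed.

Lemma alpha_small_beta (e : R) : 0 < e ->
  \forall t \near \oo, step a 1 t <= e * step b tau2 t.
Proof.
move=> e0.
have s0 : 0 < 1 - tau2 by move: t20 t21 => ? ?; lra.
have h := cvg0Z (a / b) (cvg_powRN s0).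
apply: filterS (cvg0_near_le e0 h) => t ht.
have tp : 0 < t.+1%:R `^ (- tau2) :> R by rewrite powR_gt0.
rewrite betaE mulrA -ler_pdivrMr //; rewrite -ler_pdivrMr // in ht *.
apply: le_trans ht; rewrite alphaE.
have tn : (t.+1%:R : R) != 0 by [].
have -> : (t.+1%:R : R) `^ (- (1 - tau2)) = t.+1%:R^-1 / t.+1%:R `^ (- tau2).
  rewrite -powR_inv1 // -powRN -powRD ?tn ?implybT //; congr powR; ring.
by apply: eqr_le; field; rewrite !gt_eqF.
Qed.

(** Half of the contraction [k beta_t] absorbs the input, which is the condition [2 a A <= k b C];
    the other half is at least [1/(t+2)] and absorbs the decrease of the weight. The exponent
    [1 - tau2] is that of [alpha_t / beta_t]. *)
Lemma decay_step (k A C : R) t : 0 < k -> 0 <= C -> 2 * a * A <= k * b * C ->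
  t.+2%:R^-1 <= k / 2 * step b tau2 t ->
  (1 - k * step b tau2 t) * (C * t.+1%:R `^ (- (1 - tau2))) + step a 1 t * A <=
  C * t.+2%:R `^ (- (1 - tau2)).
Proof.
move=> k0 C0 hC ht.
have hs : 0 <= 1 - tau2 <= 1 by move: t20 t21 => ? ?; apply/andP; split; lra.
have w0 : 0 <= C * t.+1%:R `^ (- (1 - tau2)) by rewrite mulr_ge0 // powR_ge0.
apply: le_trans (ler_wpM2l C0 (powRN_succ_ge t hs)).
rewrite [leRHS]mulrA.
have tn : (t.+1%:R : R) != 0 by [].
have e1 : C * t.+1%:R `^ (- (1 - tau2)) * step b tau2 t = C * b / t.+1%:R.
  rewrite betaE mulrACA -powRD ?tn ?implybT //.
  have -> : - (1 - tau2) - tau2 = -1 by ring.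
  by rewrite powR_inv1.
have h1 := ler_wpM2l w0 ht.
have h2 : step a 1 t * A <= (k / 2) * (C * b / t.+1%:R).
  rewrite alphaE mulrAC [leRHS]mulrA ler_wpM2r ?invr_ge0 //; lra.
have e2 : C * t.+1%:R `^ (- (1 - tau2)) * (k / 2 * step b tau2 t) = k / 2 * (C * b / t.+1%:R).
  by rewrite -e1; ring.
have e3 : k * step b tau2 t * (C * t.+1%:R `^ (- (1 - tau2))) = 2 * (k / 2 * (C * b / t.+1%:R)).
  by rewrite -e1; field.
rewrite e2 in h1; rewrite mulrBl mul1r e3 mulrBr mulr1.
move: h1 h2; move: (k / 2 * (C * b / t.+1%:R)) (C * t.+1%:R `^ (- (1 - tau2)) / t.+2%:R).
move: (step a 1 t * A) (C * t.+1%:R `^ (- (1 - tau2))) => u v x y h1 h2; lra.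
Qed.

Lemma invS_small_beta (k : R) : 0 < k ->
  \forall t \near \oo, t.+2%:R^-1 <= k / 2 * step b tau2 t.
Proof.
move=> k0; have e0 : 0 < k / 2 by rewrite divr_gt0.
apply: filterS (alpha_small_beta e0) => t; apply: le_trans; rewrite alphaE.
apply: (@le_trans _ _ t.+1%:R^-1).
  by rewrite lef_pV2 ?posrE // ler_nat.
by rewrite ler_peMl ?invr_ge0.
Qed.

End StepSizes.

Section AlmostSureRate.
Context {d : measure_display} {T : measurableType d} {R : realType}.
Variable P : probability T R.

(** The expectations of [(t^tau f)^p] are summable as [1 < p (s - tau)], so these powers tend to [0]
    almost surely, and the [p]-th root is taken path by path. Times before [t1], where no moment is
    assumed, are replaced by [0]. *)
Lemma Lpb_as_rate (p s tau C : R) (t1 : nat) (f : nat -> T -> R) :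
  0 < p -> 0 < C -> 1 < p * (s - tau) ->
  (forall t w, 0 <= f t w) ->
  (forall t, (t1 <= t)%N -> Lpb P p (f t) (C * t.+1%:R `^ (- s))) ->
  {ae P, forall w, (fun t => t.+1%:R `^ tau * f t w) @ \oo --> 0}.
Proof.
move=> p0 C0 ps f0 hf.
have [K [K0 HK]] := powR_series_bounded ps.
pose X t w := if (t1 <= t)%N then (t.+1%:R `^ tau * f t w) `^ p else 0.
have XE t w : (t1 <= t)%N -> X t w = t.+1%:R `^ (tau * p) * `|f t w| `^ p.
  by move=> h; rewrite /X h powRM ?powR_ge0 // -powRrM ger0_norm.
have LX t : Lint P (X t).
  have [h|h] := leqP t1 t.
    rewrite (funext (fun w => XE t w h)); apply: LintZ; by case: (hf t h).
  rewrite (_ : X t = fun=> 0); first exact: Lint_cst.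
  by apply/funext => w; rewrite /X leqNgt h.
have EX t : Er P (X t) <= C `^ p * t.+1%:R `^ (- (p * (s - tau))).
  have [h|h] := leqP t1 t; last first.
    rewrite (_ : X t = fun=> 0); first by rewrite Er_cst mulr_ge0 ?powR_ge0.
    by apply/funext => w; rewrite /X leqNgt h.
  rewrite (funext (fun w => XE t w h)).
  case: (hf t h) => mf Lf Ef; rewrite ErZ //.
  apply: (le_trans (ler_wpM2l (powR_ge0 _ _) Ef)).
  rewrite powRM ?powR_ge0 ?(ltW C0) // -powRrM mulrCA -powRD; last first.
    by rewrite pnatr_eq0 implybT.
  by rewrite ler_wpM2l ?powR_ge0 //; apply: eqr_le; congr powR; ring.
have : {ae P, forall w, X ^~ w @ \oo --> 0}.
  apply: (@ae_cvg0_of_summable _ _ _ P X (C `^ p * K)) => //.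
    by move=> t w; rewrite /X; case: ifP => // _; exact: powR_ge0.
  move=> n; apply: (@le_trans _ _ (\sum_(0 <= k < n) C `^ p * k.+1%:R `^ (- (p * (s - tau))))).
    by apply: ler_sum => k _.
  by rewrite -mulr_sumr ler_wpM2l ?powR_ge0.
apply: filterS => w hX; apply/cvgrPdist_lt => e e0.
have ep : 0 < e `^ p by rewrite powR_gt0.
move/cvgrPdist_lt: hX => /(_ _ ep) hX.
near=> t; rewrite sub0r normrN ger0_norm; last by rewrite mulr_ge0 ?powR_ge0.
have ht : (t1 <= t)%N by near: t; exists t1.
have : `|0 - X t w| < e `^ p by near: t.
rewrite sub0r normrN ger0_norm; last by rewrite /X ht powR_ge0.
rewrite /X ht => h; rewrite ltNge; apply/negP => h'; move: h; rewrite ltNge => /negP; apply.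
apply: ge0_ler_powR; rewrite ?nnegrE ?(ltW p0) ?(ltW e0) //.
by rewrite mulr_ge0 ?powR_ge0.
Unshelve. all: by end_near. Qed.

End AlmostSureRate.

(* Localization: the process restarted at [t1] from a truncated value, with
   truncated inputs, starts with finite moments, and it agrees with the original
   one on events that exhaust the sample space as [t1] and the levels grow. *)
Section Restart.
Context {R : realType} {T : Type}.
Variables (m n : nat) (t1 : nat).
Variables (init : nat -> T -> 'M[R]_(m, n)) (stp : nat -> T -> 'M[R]_(m, n) -> 'M[R]_(m, n)).

Fixpoint restart (t : nat) (w : T) : 'M[R]_(m, n) :=
  match t with
  | 0 => init 0 w
  | s.+1 => if (s < t1)%N then init s.+1 w else stp s w (restart s w)
  end.

Lemma restart_init t w : (t <= t1)%N -> restart t w = init t w.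
Proof. by case: t => [|t] //= ->. Qed.

Lemma restart_step t w : (t1 <= t)%N -> restart t.+1 w = stp t w (restart t w).
Proof. by move=> h; rewrite /= ltnNge h. Qed.

Lemma restart_eq (Z : nat -> T -> 'M[R]_(m, n)) w :
  init t1 w = Z t1 w -> (forall t, (t1 <= t)%N -> stp t w (Z t w) = Z t.+1 w) ->
  forall t, (t1 <= t)%N -> restart t w = Z t w.
Proof.
move=> h0 hs; elim=> [|t IH]; first by rewrite leqn0 => /eqP e; rewrite -e -h0 e.
rewrite leq_eqVlt => /orP[/eqP e|h]; first by rewrite -e restart_init.
by rewrite restart_step // IH // hs.
Qed.

End Restart.

Section Cutoff.
Context {R : realType}.

(** Dropping to [0] above the level, instead of rescaling, suffices: only boundedness and agreement
    below the level matter. *)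
Definition cutoff {m n} (k : R) (Z : 'M[R]_(m, n)) : 'M[R]_(m, n) :=
  if fnorm Z <= k then Z else 0.

Lemma fnorm_cutoff m n (k : R) (Z : 'M[R]_(m, n)) : 0 <= k -> fnorm (cutoff k Z) <= k.
Proof. by rewrite /cutoff; case: ifP => // _ k0; rewrite fnorm0. Qed.

Lemma cutoff_id m n (k : R) (Z : 'M[R]_(m, n)) : fnorm Z <= k -> cutoff k Z = Z.
Proof. by rewrite /cutoff => ->. Qed.

Lemma mxmeas_cutoff d (T : measurableType d) m n (k : R) (Z : T -> 'M[R]_(m, n)) :
  mxmeas Z -> mxmeas (fun w => cutoff k (Z w)).
Proof.
move=> hZ; apply: mxmeas_ifb => //.
by apply: measurable_fun_ler => //; exact: measurable_fnorm.
Qed.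

End Cutoff.

(** * Decay of the disagreement in [L^p] *)

Section ConsensusDecay.
Context {d : measure_display} {T : measurableType d} {R : realType}.
Variables (P : probability T R) (F : nat -> set_system T) (N : nat).
Local Notation Lpbn p Z c := (Lpb P p (fun w => fnorm (Z w)) c).
Variable L : nat -> T -> 'M[R]_N.
Hypotheses (filF : is_filtration F) (adL : adapted_indep P F L).
Variables (a b tau2 : R).
Hypotheses (a1 : 1 <= a) (b0 : 0 < b) (t20 : 0 < tau2) (t21 : tau2 < 2^-1).
Let al := step a 1.
Let be := step b tau2.

Lemma mxmeas_sub t m n (Z : T -> 'M[R]_(m, n)) :
  gmxmeas (F t) Z -> mxmeas Z.
Proof.
by move=> hZ i j; apply: (gmeas_measurable (G := F t)); [case: (filF t)|exact: hZ].
Qed.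

Lemma mxmeasS t m n (Z : T -> 'M[R]_(m, n)) :
  gmxmeas (F t) Z -> gmxmeas (F t.+1) Z.
Proof.
by move=> hZ i j; apply: (gmeasS (G1 := F t)); [case: (filF t)|exact: hZ].
Qed.

Lemma laplacian_adapted t : gmxmeas (F t.+1) (L t).
Proof. by move=> i j; apply: gmeas_preimage; case: (adL t) => h _; exact: h. Qed.

Lemma Lpb_fnorm_bounded p m n (Z : T -> 'M[R]_(m, n)) (c : R) : 0 <= p -> 0 <= c ->
  mxmeas Z -> (forall w, fnorm (Z w) <= c) -> Lpbn p Z c.
Proof.
move=> p0 c0 mZ hZ; apply: Lpb_le (Lpb_cst P p c0) => //; first exact: measurable_fnorm.
by move=> w; rewrite !ger0_norm ?fnorm_ge0.
Qed.

Lemma Lpb_fnormD p m n (Y Z : T -> 'M[R]_(m, n)) (c e : R) : 1 <= p -> 0 < c -> 0 < e ->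
  mxmeas Y -> mxmeas Z -> Lpbn p Y c ->
  Lpbn p Z e -> Lpb P p (fun w => fnorm (Y w + Z w)) (c + e).
Proof.
move=> p1 c0 e0 mY mZ hY hZ; apply: Lpb_le (LpbD p1 c0 e0 hY hZ).
- exact: le_trans p1.
- by apply: measurable_fnorm; exact: mxmeasD.
- by move=> w; rewrite !ger0_norm ?addr_ge0 ?fnorm_ge0 // ler_fnormD.
Qed.

Lemma Lpb_fnormZ p m n (Z : T -> 'M[R]_(m, n)) (k c : R) : 0 <= k -> 0 <= c ->
  Lpbn p Z c -> Lpb P p (fun w => fnorm (k *: Z w)) (k * c).
Proof.
move=> k0 c0 hZ; have := LpbZ k0 c0 hZ.
by under eq_fun do rewrite -[k in k * _](ger0_norm k0) -fnormZ.
Qed.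

Definition contraction_rate (p k : R) :=
  forall t q (Z : T -> 'M[R]_(N, q)) (b c : R),
  gmxmeas (F t) Z ->
  (forall w j, \sum_i Z w i j = 0) -> 0 <= b -> b <= 2^-1 -> 2 * N%:R * b <= 1 -> 0 < c ->
  Lpbn p Z c ->
  Lpb P p (fun w => fnorm (Z w - b *: (L t w *m Z w))) ((1 - k * b) * c).

(** The first two conditions admit the mean contraction, the third is the one of [decay_step], and
    the last makes averaging with weight [al t] convex. *)
Definition late (k : R) (t1 : nat) := forall t, (t1 <= t)%N ->
  [/\ be t <= 2^-1, 2 * N%:R * be t <= 1, t.+2%:R^-1 <= k / 2 * be t & al t <= 1].

Lemma late_near (k : R) : 0 < k -> \forall t1 \near \oo, late k t1.
Proof.
move=> k0.
have h1 : \forall t \near \oo, be t <= 2^-1.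
  by apply: cvg0_near_le; [rewrite invr_gt0|exact: beta_cvg0].
have h2 : \forall t \near \oo, 2 * N%:R * be t <= 1.
  by apply: cvg0_near_le => //; apply: cvg0Z; exact: beta_cvg0.
have h3 := invS_small_beta a1 b0 t20 t21 k0.
have h4 : \forall t \near \oo, al t <= 1.
  by apply: cvg0_near_le => //; exact: alpha_cvg0.
have [t1 _ ht1] : \forall t \near \oo,
  [/\ be t <= 2^-1, 2 * N%:R * be t <= 1, t.+2%:R^-1 <= k / 2 * be t & al t <= 1].
  by near=> t; split; near: t.
exists t1 => // t /= tt s ts; apply: ht1; exact: leq_trans ts.
Unshelve. all: by end_near. Qed.

Lemma contraction_factor_gt0 (k : R) t1 t : 0 < k <= 1 -> late k t1 -> (t1 <= t)%N ->
  0 < 1 - k * be t.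
Proof.
move=> /andP[k0 k1] lt1 tt; have [hb _ _ _] := lt1 t tt.
have : k * be t <= 2^-1.
  by apply: le_trans hb; rewrite ler_piMl // ltW // beta_gt0.
have : (2^-1 : R) < 1 by rewrite invf_lt1 // ltr1n.
by move=> h1 h2; rewrite subr_gt0; exact: le_lt_trans h1.
Qed.

(** Contraction followed by Minkowski's inequality: the input is charged in full, without any
    cancellation, so [U] may depend on the past in any way. *)
Lemma consensus_Lpb_step p k t1 t q (Z U : T -> 'M[R]_(N, q)) (c e : R) :
  1 <= p -> 0 < k <= 1 -> contraction_rate p k -> late k t1 -> (t1 <= t)%N ->
  gmxmeas (F t) Z -> mxmeas U ->
  (forall w j, \sum_i Z w i j = 0) -> 0 < c -> 0 < e ->
  Lpbn p Z c -> Lpbn p U e ->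
  Lpb P p (fun w => fnorm (Z w - be t *: (L t w *m Z w) + al t *: U w))
    ((1 - k * be t) * c + al t * e).
Proof.
move=> p1 k01 hk lt1 tt gZ mU sZ c0 e0 hZ hU.
have [hb1 hb2 _ _] := lt1 t tt.
have al0 : 0 < al t by exact: alpha_gt0.
apply: Lpb_fnormD => //.
- by rewrite mulr_gt0 // (contraction_factor_gt0 k01 lt1 tt).
- by rewrite mulr_gt0.
- have mZ := mxmeas_sub gZ; apply: mxmeasB => //; apply: mxmeasZ; apply: mxmeasM => //.
  by apply: (@mxmeas_sub t.+1); exact: laplacian_adapted.
- exact: mxmeasZ.
- by apply: hk => //; apply: ltW; exact: beta_gt0.
- by apply: Lpb_fnormZ => //; exact: ltW.
Qed.

Lemma consensus_decay p k t1 q (Z U : nat -> T -> 'M[R]_(N, q)) (c e : R) :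
  1 <= p -> 0 < k <= 1 -> contraction_rate p k -> late k t1 ->
  (forall t, gmxmeas (F t) (Z t)) ->
  (forall t, mxmeas (U t)) -> (forall t w j, \sum_i Z t w i j = 0) ->
  (forall t w, (t1 <= t)%N ->
     Z t.+1 w = Z t w - be t *: (L t w *m Z t w) + al t *: U t w) ->
  0 < c -> 0 < e -> Lpbn p (Z t1) c ->
  (forall t, (t1 <= t)%N -> Lpbn p (U t) e) ->
  exists2 C : R, 0 < C & forall t, (t1 <= t)%N ->
    Lpbn p (Z t) (C * t.+1%:R `^ (- (1 - tau2))).
Proof.
move=> p1 k01 hk lt1 gZ mU sZ ZS c0 e0 hZ hU.
have k0 : 0 < k by case/andP: k01.
have p0 : 0 <= p by exact: le_trans p1.
have a0 : 0 < a by exact: lt_le_trans a1.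
(* The first summand makes the bound hold at [t1], the second gives [2 a e <= k b C] for
   [decay_step]. *)
pose C := c / t1.+1%:R `^ (- (1 - tau2)) + 2 * a * e / (k * b).
have kb0 : 0 < k * b by rewrite mulr_gt0.
have w0 : 0 < t1.+1%:R `^ (- (1 - tau2)) :> R by rewrite powR_gt0.
have C0 : 0 < C.
  by rewrite /C addr_gt0 // divr_gt0 // !mulr_gt0.
exists C => //; elim=> [|t IH].
  rewrite leqn0 => /eqP t10; move: hZ w0 C0; rewrite /C t10 powR1 divr1 => hZ _ C0.
  rewrite mulr1; apply: Lpb_mono hZ => //; first exact: ltW.
  by rewrite lerDl divr_ge0 ?(ltW kb0) // !mulr_ge0 // ltW.
rewrite leq_eqVlt => /orP[/eqP <-|tt].
  apply: Lpb_mono hZ => //; first exact: ltW.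
  rewrite /C mulrDl divfK ?gt_eqF // lerDl mulr_ge0 ?(ltW w0) //.
  by rewrite divr_ge0 ?(ltW kb0) // !mulr_ge0 // ltW.
rewrite ltnS in tt.
have hb : t.+2%:R^-1 <= k / 2 * be t by case: (lt1 t tt).
have B0 : 0 < C * t.+1%:R `^ (- (1 - tau2)) by rewrite mulr_gt0 // powR_gt0.
have := consensus_Lpb_step p1 k01 hk lt1 tt (gZ t) (@mU t) (sZ t) B0 e0 (IH tt) (hU t tt).
have -> : (fun w => fnorm (Z t w - be t *: (L t w *m Z t w) + al t *: U t w)) =
          (fun w => fnorm (Z t.+1 w)).
  by apply/funext => w; rewrite ZS.
apply: Lpb_mono => //.
  apply: addr_ge0; apply: mulr_ge0; rewrite ?(ltW B0) ?(ltW e0) //.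
    exact: ltW (contraction_factor_gt0 k01 lt1 tt).
  by apply: ltW; exact: alpha_gt0.
apply: (decay_step t20 t21 k0 (ltW C0) _ hb).
rewrite /C mulrDr.
have -> : k * b * (2 * a * e / (k * b)) = 2 * a * e by rewrite mulrC divfK // gt_eqF.
by rewrite lerDr mulr_ge0 ?(ltW kb0) // divr_ge0 ?ltW.
Qed.

End ConsensusDecay.

(** * Consensus under a pathwise bounded input *)

Section ConsensusTracking.
Context {d : measure_display} {T : measurableType d} {R : realType}.
Variables (P : probability T R) (F : nat -> set_system T) (N : nat).
Local Notation Lpbn p Z c := (Lpb P p (fun w => fnorm (Z w)) c).
Variable L : nat -> T -> 'M[R]_N.
Hypotheses (filF : is_filtration F) (lapL : forall t w, is_simple_laplacian (L t w)).
Hypotheses (idL : ident_distr P L) (adL : adapted_indep P F L).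
Hypothesis lamL : lambda2_pos (Emx P (L 0%N)).
Variables (a b tau2 : R).
Hypotheses (a1 : 1 <= a) (b0 : 0 < b) (t20 : 0 < tau2) (t21 : tau2 < 2^-1).
Hypothesis N0 : (0 < N)%N.
Let al := step a 1.
Let be := step b tau2.

Lemma restart_adapted m n t1 (init : nat -> T -> 'M[R]_(m, n))
    (stp : nat -> T -> 'M[R]_(m, n) -> 'M[R]_(m, n)) :
  (forall t, gmxmeas (F t) (init t)) ->
  (forall t Z, gmxmeas (F t) Z ->
     gmxmeas (F t.+1) (fun w => stp t w (Z w))) ->
  forall t, gmxmeas (F t) (restart t1 init stp t).
Proof.
move=> hi hs; elim=> [|t IH]; first exact: hi.
have [h|h] := leqP t.+1 t1.
  by rewrite (funext (fun w => restart_init init stp w h)); exact: hi.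
by rewrite (funext (fun w => restart_step init stp w (h : (t1 <= t)%N))); exact: hs.
Qed.

Lemma consensus_step_adapted t q (Z U : T -> 'M[R]_(N, q)) (x y : R) :
  gmxmeas (F t) Z ->
  gmxmeas (F t.+1) U ->
  @mxmeas _ (g_sigma_algebraType (F t.+1)) R N q
    (fun w => Z w - x *: (L t w *m Z w) + y *: U w).
Proof.
move=> gZ gU; have gZ' := mxmeasS filF gZ.
apply: mxmeasD; last exact: mxmeasZ.
apply: mxmeasB => //; apply: mxmeasZ; apply: mxmeasM => //.
by have := laplacian_adapted adL (t := t).
Qed.

Lemma Lpb_fnormB p m n (Y Z : T -> 'M[R]_(m, n)) (c e : R) : 1 <= p -> 0 < c -> 0 < e ->
  mxmeas Y -> mxmeas Z -> Lpbn p Y c ->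
  Lpbn p Z e -> Lpb P p (fun w => fnorm (Y w - Z w)) (c + e).
Proof.
move=> p1 c0 e0 mY mZ hY hZ; have hN : Lpb P p (fun w => fnorm (- Z w)) e by rewrite (funext (fun w => fnormN (Z w))).
exact: (Lpb_fnormD p1 c0 e0 mY (mxmeasN mZ) hY hN).
Qed.

(** The input is bounded on each path, but by a random constant, so moments of [Z] may be infinite.
    The copies [Y j] cut both the restart value and the input at level [j]; all of them reach
    consensus outside one null set, and a path is its own copy for [j] above its bound and its value
    at [t1]. *)
Lemma consensus_perp_cvg0 q (Z D : nat -> T -> 'M[R]_(N, q)) :
  (forall t, gmxmeas (F t) (Z t)) ->
  (forall t, gmxmeas (F t) (D t)) ->
  (forall t w, Z t.+1 w = Z t w - be t *: (L t w *m Z t w) + al t *: (D t w - Z t w)) ->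
  {ae P, forall w, exists K : R, forall t, fnorm (D t w) <= K} ->
  {ae P, forall w, (fun t => fnorm (perpmx *m Z t w)) @ \oo --> 0}.
Proof.
move=> gZ gD ZS hD.
have [k k01 hk] := laplacian_contraction filF lapL idL adL lamL (lexx 2).
have k0 : 0 < k by case/andP: k01.
have two1 : (1 : R) <= 2 by rewrite ler1n.
have k20 : 0 < k / 2 by rewrite divr_gt0.
have [t1 ht1] : exists t1, late N a b tau2 k t1 /\
    forall t, (t1 <= t)%N -> al t <= k / 2 * be t.
  have [s1 _ h1] := late_near N a1 b0 t20 t21 k0.
  have [s2 _ h2] := alpha_small_beta a b0 t20 t21 k20.
  exists (maxn s1 s2); split; first by apply: h1; exact: leq_maxl.
  by move=> t ht; apply: h2; apply: leq_trans ht; exact: leq_maxr.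
case: ht1 => lt1 alt1.
pose Y j := restart t1 (fun t w => cutoff j%:R (Z t w))
  (fun t w z => z - be t *: (L t w *m z) + al t *: (cutoff j%:R (D t w) - z)).
have gY j t : gmxmeas (F t) (Y j t).
  apply: restart_adapted => [s|s X gX]; first exact: mxmeas_cutoff.
  apply: consensus_step_adapted => //; apply: mxmeasB; last exact (mxmeasS filF gX).
  have h := @mxmeas_cutoff _ _ (g_sigma_algebraType (F s)) N q j%:R (D s) (gD s).
  exact (mxmeasS filF h).
pose V j t w : 'M[R]_(N, q) := perpmx *m cutoff j%:R (D t w) - perpmx *m Y j t w.
have YS j t w : (t1 <= t)%N -> perpmx *m Y j t.+1 w =
    perpmx *m Y j t w - be t *: (L t w *m (perpmx *m Y j t w)) + al t *: V j t w.
  by move=> tt; rewrite /Y restart_step // perp_step // mulmxBr.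
have gPY j t : gmxmeas (F t) (fun w => perpmx *m Y j t w).
  by apply: mxmeasM; [exact: mxmeas_cst|exact: gY].
have mPD j t : mxmeas (fun w => perpmx *m cutoff j%:R (D t w)).
  apply: mxmeasM; first exact: mxmeas_cst.
  by apply: mxmeas_cutoff; exact (mxmeas_sub filF (gD t)).
have mV j t : mxmeas (V j t) by apply: mxmeasB => //; exact (mxmeas_sub filF (gPY j t)).
pose B (j : nat) : R := fnorm (@perpmx R N) * j%:R + 1.
have B0 j : 0 < B j by rewrite ltr_wpDl // mulr_ge0 // fnorm_ge0.
have cB j (X : 'M[R]_(N, q)) : fnorm (perpmx *m cutoff j%:R X) <= B j.
  apply: (le_trans (ler_fnormM _ _)); rewrite ler_wpDr // ler_wpM2l ?fnorm_ge0 //.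
  exact: fnorm_cutoff.
have LD j t : Lpb P 2 (fun w => fnorm (perpmx *m cutoff j%:R (D t w))) (B j).
  by apply: Lpb_fnorm_bounded => //; exact: ltW.
have L1 j : Lpb P 2 (fun w => fnorm (perpmx *m Y j t1 w)) (B j).
  apply: Lpb_fnorm_bounded => //; first exact: ltW.
    exact (mxmeas_sub filF (gPY j t1)).
  by move=> w; rewrite /Y restart_init.
(* The bound [B j] reproduces itself: the input has size [2 * B j] and [al t <= k / 2 * be t], so it
   restores at most what the contraction removes. *)
have LY j t : (t1 <= t)%N -> Lpb P 2 (fun w => fnorm (perpmx *m Y j t w)) (B j).
  elim: t => [|t IH]; first by rewrite leqn0 => /eqP e; have := L1 j; rewrite e.
  rewrite leq_eqVlt => /orP[/eqP <- //|tt]; rewrite ltnS in tt.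
  have B20 : 0 < B j + B j by rewrite addr_gt0.
  have LV : Lpb P 2 (fun w => fnorm (V j t w)) (B j + B j).
    exact (Lpb_fnormB two1 (B0 j) (B0 j) (mPD j t) (mxmeas_sub filF (gPY j t)) (LD j t) (IH tt)).
  have := consensus_Lpb_step filF adL a1 b0 two1 k01 hk lt1 tt (gPY j t) (mV j t)
    (fun w i => perp_colsum _ _ N0) (B0 j) B20 (IH tt) LV.
  rewrite (_ : (fun w => fnorm (_ + _)) = (fun w => fnorm (perpmx *m Y j t.+1 w))); last first.
    by apply/funext => w; rewrite YS.
  apply: Lpb_mono => //.
    apply: addr_ge0; apply: mulr_ge0; rewrite ?(ltW B20) ?(ltW (B0 j)) //.
      exact: ltW (contraction_factor_gt0 b0 k01 lt1 tt).
    by apply: ltW; exact: alpha_gt0.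
  have := ler_wpM2r (ltW B20) (alt1 t tt).
  rewrite -/be -/al; move: (be t) (al t) (B j) => x y z h.
  apply: (@le_trans _ _ ((1 - k * x) * z + k / 2 * x * (z + z))); first by rewrite lerD2l.
  by apply: eqr_le; field.
have hj j : {ae P, forall w, (fun t => fnorm (perpmx *m Y j t w)) @ \oo --> 0}.
  have B20 : 0 < B j + B j by rewrite addr_gt0.
  have [C C0 hC] := @consensus_decay _ _ _ P F N L filF adL a b tau2 a1 b0 t20 t21 2 k t1 q
    (fun t w => perpmx *m Y j t w) (V j) (B j) (B j + B j) two1 k01 hk lt1 (gPY j)
    (mV j) (fun t w i => perp_colsum _ _ N0) (fun t w tt => YS j t w tt) (B0 j) B20 (L1 j)
    (fun t tt => Lpb_fnormB two1 (B0 j) (B0 j) (mPD j t) (mxmeas_sub filF (gPY j t)) (LD j t) (LY j t tt)).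
  (* Second moments suffice here, since only convergence is wanted ([tau = 0]) and [tau2 < 1/2]. *)
  have rt : 1 < 2 * ((1 - tau2) - 0) by move: t21 => ?; lra.
  have hr := @Lpb_as_rate _ _ _ P 2 (1 - tau2) 0 C t1 (fun t w => fnorm (perpmx *m Y j t w))
    (ltr0Sn _ 1) C0 rt (fun t w => fnorm_ge0 _) hC.
  apply: filterS hr => w.
  by apply: cvg0_ext => t; rewrite powRr0 mul1r.
apply: filterS2 hD (ae_foralln hj) => w [K hK] hw.
pose c := Num.max K (fnorm (Z t1 w)).
pose j := (Num.truncn c).+1.
have cj : c <= j%:R by apply: ltW; exact: truncnS_gt.
have e t : (t1 <= t)%N -> Y j t w = Z t w.
  apply: (@restart_eq _ _ N q t1 _ _ Z w).
    by apply: cutoff_id; apply: le_trans cj; rewrite le_max lexx orbT.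
  move=> s ss; rewrite cutoff_id ?ZS //; apply: le_trans (hK s) _.
  by apply: le_trans cj; rewrite le_max lexx.
apply: cvg0_le (hw j); exists t1 => // t /= tt.
by rewrite ger0_norm ?fnorm_ge0 // e.
Qed.

End ConsensusTracking.

(** * Joint recursion of the disagreement [Y] and the average [X] *)

Section TwoScale.
Context {d : measure_display} {T : measurableType d} {R : realType}.
Variables (P : probability T R) (F : nat -> set_system T) (N : nat).
Local Notation Lpbn p Z c := (Lpb P p (fun w => fnorm (Z w)) c).
Variable L : nat -> T -> 'M[R]_N.
Hypotheses (filF : is_filtration F) (adL : adapted_indep P F L).
Variables (a b tau2 : R).
Hypotheses (a1 : 1 <= a) (b0 : 0 < b) (t20 : 0 < tau2) (t21 : tau2 < 2^-1).
Let al := step a 1.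
Let be := step b tau2.
Local Notation adm t Z := (gmxmeas (F t) Z).

Variables (p k C rho Cz B : R) (t1 q : nat).
Hypotheses (p2 : 2 <= p) (k01 : 0 < k <= 1) (hk : contraction_rate P F L p k).
Hypotheses (lt1 : late N a b tau2 k t1) (C1 : 1 <= C) (rho2 : 2^-1 <= rho) (rho1 : rho < 1).
Hypotheses (Cz0 : 0 < Cz) (B0 : 0 < B).
(* With this gain the bounds [A] for [X] and [A / (4 C)] for [Y] in [L^p]
   reproduce themselves. *)
Hypothesis small_gain : forall t, (t1 <= t)%N -> 12 * C ^+ 2 * al t <= k * be t.
Variables (Y U : nat -> T -> 'M[R]_(N, q)) (X g V : nat -> T -> 'rV[R]_q) (nz : nat -> T -> R).
Hypotheses (gY : forall t, adm t (Y t)) (gX : forall t, adm t (X t)) (gg : forall t, adm t (g t)).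
Hypotheses (mU : forall t, mxmeas (U t)) (mV : forall t, mxmeas (V t)).
Hypothesis sY : forall t w j, \sum_i Y t w i j = 0.
Hypothesis YS : forall t w, (t1 <= t)%N ->
  Y t.+1 w = Y t w - be t *: (L t w *m Y t w) + al t *: U t w.
Hypothesis XS : forall t w, (t1 <= t)%N -> X t.+1 w = g t w + al t *: V t w.
Hypothesis nz0 : forall t w, 0 <= nz t w.
Hypothesis Unorm : forall t w, (t1 <= t)%N ->
  fnorm (U t w) <= C * (fnorm (Y t w) + fnorm (X t w) + nz t w).
Hypothesis gnorm : forall t w, (t1 <= t)%N ->
  fnorm (g t w) <= (1 - al t * rho) * fnorm (X t w) + al t * C * fnorm (Y t w).
Hypothesis Vnorm : forall t w, (t1 <= t)%N -> fnorm (V t w) <= C * nz t w.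
Hypothesis Vorth : forall t (f : T -> R) i, (t1 <= t)%N -> gmeas (F t) f -> Lint P (fun w => f w ^+ 2) ->
  Er P (fun w => f w * V t w 0 i) = 0.
Hypothesis Lnz : forall t, (t1 <= t)%N -> Lpb P p (nz t) Cz.
Hypothesis LY1 : Lpbn p (Y t1) B.
Hypothesis LX1 : Lpbn p (X t1) B.

(** The forcing of [X] per unit of [al t] is [C (B + Cz) + C Cz], at most [2 C (B + Cz) = A / 2],
    and [rho >= 1/2] makes this at most [rho A]. The input of [Y] is then at most [3 C A], whence
    the [12 C^2] in [small_gain]. *)
Let A : R := 4 * C * (B + Cz).
Let C0 : 0 < C. Proof. exact: lt_le_trans C1. Qed.
Let p1 : 1 <= p. Proof. by apply: le_trans p2; rewrite ler1n. Qed.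
Let p0 : 0 <= p. Proof. exact: le_trans p1. Qed.
Let BC0 : 0 < B + Cz. Proof. exact: addr_gt0. Qed.
Let A0 : 0 < A. Proof. by rewrite /A !mulr_gt0. Qed.
Let al0 t : 0 < al t. Proof. exact: alpha_gt0. Qed.
Let mY t : mxmeas (Y t). Proof. exact (mxmeas_sub filF (@gY t)). Qed.
Let mX t : mxmeas (X t). Proof. exact (mxmeas_sub filF (@gX t)). Qed.
Let mg t : mxmeas (g t). Proof. exact (mxmeas_sub filF (@gg t)). Qed.
Let BC_le_A : B + Cz <= A.
Proof.
rewrite /A ler_peMl ?(ltW BC0) //; apply: (@le_trans _ _ (4 * 1)); first by rewrite mulr1 ler1n.
by rewrite ler_pM2l.
Qed.

Let alrho t : (t1 <= t)%N -> 0 < 1 - al t * rho.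
Proof.
move=> tt; have [_ _ _ al1] := lt1 tt; rewrite subr_gt0.
by apply: le_lt_trans rho1; rewrite ler_piMl // (le_trans _ rho2) // invr_ge0.
Qed.

Let LU t : (t1 <= t)%N -> Lpbn p (X t) A ->
  Lpbn p (Y t) (B + Cz) -> Lpbn p (U t) (3 * C * A).
Proof.
move=> tt hX hY.
have h := LpbZ (ltW C0) (ltW (addr_gt0 (addr_gt0 BC0 A0) Cz0))
  (LpbD p1 (addr_gt0 BC0 A0) Cz0 (LpbD p1 BC0 A0 hY hX) (Lnz tt)).
apply: (@Lpb_mono _ _ _ _ _ _ (C * (B + Cz + A + Cz)) _ p0).
- by rewrite mulr_ge0 ?(ltW C0) // !addr_ge0 // ltW.
- have e3 (x : R) : 3 * C * x = C * (x + x + x) by ring.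
  rewrite e3.
  have hz : Cz <= A by apply: le_trans BC_le_A; rewrite lerDr ltW.
  by apply: (ler_wpM2l (ltW C0)); apply: lerD hz; apply: lerD BC_le_A (lexx A).
- apply: Lpb_le h => //; first exact: measurable_fnorm.
  move=> w; rewrite (ger0_norm (fnorm_ge0 _)) ger0_norm ?Unorm //.
  by rewrite mulr_ge0 ?(ltW C0) // !addr_ge0 ?fnorm_ge0.
Qed.

(** Each bound needs the other, since [U] contains [X] and [g] contains [Y]; hence a single
    induction. Minkowski is enough even for [X]: its noise of size [al t] is offset by the decay
    [al t * rho]. *)
Lemma two_scale_moments t : (t1 <= t)%N ->
  Lpbn p (X t) A /\ Lpbn p (Y t) (B + Cz).
Proof.
have base : Lpbn p (X t1) A /\ Lpbn p (Y t1) (B + Cz).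
  split; [apply: Lpb_mono LX1 => //|apply: Lpb_mono LY1 => //]; rewrite ?(ltW B0) ?lerDl ?(ltW Cz0) //.
  by apply: le_trans BC_le_A; rewrite lerDl ltW.
elim: t => [|t IH]; first by rewrite leqn0 => /eqP e; move: base; rewrite e.
rewrite leq_eqVlt => /orP[/eqP e|tt]; first by move: base; rewrite e.
rewrite ltnS in tt; have [hX hY] := IH tt; split.
- have c1 : 0 < (1 - al t * rho) * A by rewrite mulr_gt0 ?alrho.
  have c2 : 0 < al t * C * (B + Cz) by exact: mulr_gt0 (mulr_gt0 (al0 t) C0) BC0.
  have c3 : 0 < al t * C * Cz by exact: mulr_gt0 (mulr_gt0 (al0 t) C0) Cz0.
  have h := LpbD p1 (addr_gt0 c1 c2) c3
    (LpbD p1 c1 c2 (LpbZ (ltW (alrho tt)) (ltW A0) hX)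
       (LpbZ (ltW (mulr_gt0 (al0 t) C0)) (ltW BC0) hY))
    (LpbZ (ltW (mulr_gt0 (al0 t) C0)) (ltW Cz0) (Lnz tt)).
  apply: (@Lpb_mono _ _ _ _ _ _ ((1 - al t * rho) * A + al t * C * (B + Cz) + al t * C * Cz) _ p0).
    by rewrite !addr_ge0 // ltW.
    have h1 : C * (B + Cz) + C * Cz <= 2^-1 * A.
      have : C * Cz <= C * (B + Cz) by rewrite ler_pM2l // lerDr ltW.
      by rewrite /A; move: (C * Cz) => x; rewrite -[4 * C * _]mulrA; move: (C * (B + Cz)) => y ?; lra.
    have h2 : 2^-1 * A <= rho * A by rewrite ler_pM2r.
    have := ler_wpM2l (ltW (al0 t)) (le_trans h1 h2).
    have gen (u v c x y z : R) : u * (c * x + c * y) <= u * (v * z) ->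
        (1 - u * v) * z + u * c * x + u * c * y <= z.
      rewrite -subr_ge0 => h'; rewrite -subr_ge0.
      by have <- : u * (v * z) - u * (c * x + c * y) =
        z - ((1 - u * v) * z + u * c * x + u * c * y) by ring.
    exact: gen.
  apply: Lpb_le h => //; first exact: measurable_fnorm.
  move=> w; rewrite (ger0_norm (fnorm_ge0 _)) ger0_norm; last first.
    rewrite !addr_ge0 //; apply: mulr_ge0; rewrite ?fnorm_ge0 ?(ltW (alrho tt)) //;
    by rewrite mulr_ge0 // ltW.
  rewrite XS //; apply: (le_trans (ler_fnormD _ _)); apply: lerD; first exact: gnorm.
  rewrite fnormZ (gtr0_norm (al0 t)) -(mulrA (al t) C).
  by apply: (ler_wpM2l (ltW (al0 t))); exact: Vnorm.
- have e0 : 0 < 3 * C * A by rewrite !mulr_gt0.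
  have := consensus_Lpb_step filF adL a1 b0 p1 k01 hk lt1 tt (@gY t) (@mU t)
    (sY t) BC0 e0 hY (LU tt hX hY).
  rewrite (_ : (fun w => fnorm (_ + _)) = (fun w => fnorm (Y t.+1 w))); last first.
    by apply/funext => w; rewrite YS.
  apply: Lpb_mono => //.
    apply: addr_ge0; apply: mulr_ge0; rewrite ?(ltW e0) ?(ltW BC0) ?(ltW (al0 t)) //.
    exact: ltW (contraction_factor_gt0 b0 k01 lt1 tt).
  have := ler_wpM2r (ltW BC0) (small_gain tt).
  rewrite mulrBl mul1r -/be -/al /A expr2.
  have -> : 12 * (C * C) * al t * (B + Cz) = al t * (3 * C * (4 * C * (B + Cz))) by ring.
  by move: (k * be t * _) (al t * _) => x y; lra.
Qed.

Lemma two_scale_perp_decay : exists2 C' : R, 0 < C' & forall t, (t1 <= t)%N ->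
  Lpbn p (Y t) (C' * t.+1%:R `^ (- (1 - tau2))).
Proof.
have e0 : 0 < 3 * C * A by rewrite !mulr_gt0.
apply: (@consensus_decay _ _ _ P F N L filF adL a b tau2 a1 b0 t20 t21 p k t1 q
    Y U B (3 * C * A)) => //.
by move=> t tt; have [hX hY] := two_scale_moments tt; exact: LU.
Qed.

Let convex_sqr (s x y : R) : 0 <= s <= 1 -> ((1 - s) * x + s * y) ^+ 2 <= (1 - s) * x ^+ 2 + s * y ^+ 2.
Proof.
move=> /andP[s0 s1]; rewrite -subr_ge0.
have -> : (1 - s) * x ^+ 2 + s * y ^+ 2 - ((1 - s) * x + s * y) ^+ 2 =
  s * (1 - s) * (x - y) ^+ 2 by ring.
by rewrite mulr_ge0 ?sqr_ge0 // mulr_ge0 // subr_ge0.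
Qed.

(** Convexity of the square with weight [al t * rho] between [|X|] and [(C / rho) |Y|] keeps the
    factor [1 - al t * rho] intact, where expanding the square would spoil it. The [2] bounds
    [1 / rho]. *)
Let gsqr t w : (t1 <= t)%N -> fnorm (g t w) ^+ 2 <=
  (1 - al t * rho) * fnorm (X t w) ^+ 2 + 2 * C ^+ 2 * al t * fnorm (Y t w) ^+ 2.
Proof.
move=> tt; have r0 : 0 < rho by apply: lt_le_trans rho2; rewrite invr_gt0.
have s0 : 0 < al t * rho by rewrite mulr_gt0.
have s01 : 0 <= al t * rho <= 1 by rewrite (ltW s0) /= -subr_ge0 ltW ?alrho.
have h := gnorm w tt.
have h0 : 0 <= fnorm (g t w) by exact: fnorm_ge0.
have := convex_sqr (fnorm (X t w)) (C / rho * fnorm (Y t w)) s01.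
have e : al t * rho * (C / rho * fnorm (Y t w)) = al t * C * fnorm (Y t w).
  by field; rewrite gt_eqF.
rewrite e => hc; apply: (@le_trans _ _ (((1 - al t * rho) * fnorm (X t w) + al t * C * fnorm (Y t w)) ^+ 2)).
  by rewrite ler_pXn2r ?nnegrE // (le_trans h0).
apply: (le_trans hc); rewrite lerD2l.
have -> : al t * rho * (C / rho * fnorm (Y t w)) ^+ 2 = rho^-1 * (C ^+ 2 * al t * fnorm (Y t w) ^+ 2).
  by field; rewrite gt_eqF.
have -> : 2 * C ^+ 2 * al t * fnorm (Y t w) ^+ 2 = 2 * (C ^+ 2 * al t * fnorm (Y t w) ^+ 2) by ring.
rewrite ler_wpM2r //.
  exact: mulr_ge0 (mulr_ge0 (sqr_ge0 C) (ltW (al0 t))) (sqr_ge0 _).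
by rewrite -[leRHS]invrK lef_pV2 ?posrE ?invr_gt0.
Qed.

Let indicM_le (E : set T) (f : T -> R) : measurable E -> (forall w, 0 <= f w) -> Lint P f ->
  Er P (fun w => \1_E w * f w) <= Er P f.
Proof.
move=> mE f0 Lf; apply: Er_le => //; first exact: Lint_indicM.
by move=> w; rewrite ler_piMl // indicE; case: (_ \in _).
Qed.

Let LX2 t : (t1 <= t)%N -> Lint P (fun w => fnorm (X t w) ^+ 2).
Proof. by move=> tt; have [hX _] := two_scale_moments tt; case: (Lpb_sqr p2 A0 hX). Qed.

Let LV2 t i : (t1 <= t)%N -> Lint P (fun w => V t w 0 i ^+ 2) /\
  Er P (fun w => V t w 0 i ^+ 2) <= 2 * (C * Cz) ^+ 2.
Proof.
move=> tt; apply: Lpb_sqr p2 _ _; first by rewrite mulr_gt0.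
apply: Lpb_le (LpbZ (ltW C0) (ltW Cz0) (Lnz tt)) => //; first exact: mV.
move=> w; rewrite [leRHS]ger0_norm ?mulr_ge0 ?(ltW C0) //.
exact: le_trans (ler_fnorm_entry _ _ _) (Vnorm _ tt).
Qed.

(** Here the cancellation of the noise is used: in each coordinate the cross term with [V] vanishes
    because [g] and the event [E] belong to [F t], so the noise costs [al t ^+ 2] instead of [al t].
    Summing over coordinates brings in [q]. *)
Lemma two_scale_avg_step C' t E : (t1 <= t)%N -> 0 < C' ->
  Lpbn p (Y t) (C' * t.+1%:R `^ (- (1 - tau2))) -> F t E ->
  Er P (fun w => \1_E w * fnorm (X t.+1 w) ^+ 2) <=
  (1 - al t * rho) * Er P (fun w => \1_E w * fnorm (X t w) ^+ 2) +
  (4 * C ^+ 2 * al t * (C' * t.+1%:R `^ (- (1 - tau2))) ^+ 2 + 2 * q%:R * (C * Cz) ^+ 2 * al t ^+ 2).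
Proof.
move=> tt C'0 hY FE.
have mE : measurable E by case: (filF t) => _ h _; exact: h.
set c := C' * _; have c0 : 0 < c by rewrite mulr_gt0 // powR_gt0.
have [LY2 EY2] := Lpb_sqr p2 c0 hY.
have LB : Lint P (fun w => (1 - al t * rho) * fnorm (X t w) ^+ 2 + 2 * C ^+ 2 * al t * fnorm (Y t w) ^+ 2).
  by apply: LintD; apply: LintZ => //; exact: LX2.
have fsq (Z : 'rV[R]_q) : fnorm Z ^+ 2 = \sum_i Z 0 i ^+ 2.
  by rewrite fnorm_sqr /mxdot big_ord1; apply: eq_bigr => i _; rewrite expr2.
have Lg2 : Lint P (fun w => fnorm (g t w) ^+ 2).
  apply: Lint_le LB; first by apply: measurable_funX; exact: measurable_fnorm.
  by move=> w; rewrite ger0_norm ?sqr_ge0 // gsqr.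
have Lgi i : Lint P (fun w => g t w 0 i ^+ 2).
  apply: Lint_le Lg2; first by apply: measurable_funX; exact: mg.
  move=> w; rewrite ger0_norm ?sqr_ge0 // fsq (bigD1 i) //= lerDl.
  by apply: sumr_ge0 => j _; exact: sqr_ge0.
have Lgv i : Lint P (fun w => (g t w 0 i + al t * V t w 0 i) ^+ 2).
  have -> : (fun w => (g t w 0 i + al t * V t w 0 i) ^+ 2) =
     (fun w => g t w 0 i ^+ 2 + (2 * al t * (g t w 0 i * V t w 0 i) + al t ^+ 2 * V t w 0 i ^+ 2)).
    by apply/funext => w; ring.
  have [LVi _] := LV2 i tt.
  apply: LintD => //; apply: LintD; apply: LintZ => //.
  by apply: Lint_sqr_mul => //; [exact: mg|exact: mV].
have i1 i : Er P (fun w => \1_E w * (g t w 0 i + al t * V t w 0 i) ^+ 2) <=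
    Er P (fun w => \1_E w * g t w 0 i ^+ 2) + al t ^+ 2 * (2 * (C * Cz) ^+ 2).
  have [LVi EVi] := LV2 i tt.
  apply: Er_indic_sqrD => //; [exact: mg|exact: mV|].
  apply: Vorth => //.
    apply: measurable_funM; [exact: gmeas_indic|exact: gg].
  have -> : (fun w => (\1_E w * g t w 0 i) ^+ 2) = (fun w => \1_E w * g t w 0 i ^+ 2).
    by apply/funext => w; rewrite exprMn indicE; case: (_ \in _); rewrite ?expr1n ?expr0n.
  exact: Lint_indicM.
have -> : (fun w => \1_E w * fnorm (X t.+1 w) ^+ 2) =
          (fun w => \sum_i \1_E w * (g t w 0 i + al t * V t w 0 i) ^+ 2).
  apply/funext => w; rewrite fsq mulr_sumr; apply: eq_bigr => i _.
  by rewrite XS // !mxE.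
rewrite Er_sum; last by move=> i; apply: Lint_indicM.
apply: (le_trans (ler_sum _ (fun i _ => i1 i))).
rewrite big_split /= sumr_const card_ord -Er_sum; last by move=> i; apply: Lint_indicM.
have -> : (fun w => \sum_i \1_E w * g t w 0 i ^+ 2) = (fun w => \1_E w * fnorm (g t w) ^+ 2).
  by apply/funext => w; rewrite fsq mulr_sumr.
have h1 : Er P (fun w => \1_E w * fnorm (g t w) ^+ 2) <=
    (1 - al t * rho) * Er P (fun w => \1_E w * fnorm (X t w) ^+ 2) +
    2 * C ^+ 2 * al t * Er P (fun w => \1_E w * fnorm (Y t w) ^+ 2).
  have LXE : Lint P (fun w => \1_E w * fnorm (X t w) ^+ 2).
    by apply: Lint_indicM => //; exact: LX2.
  have LYE : Lint P (fun w => \1_E w * fnorm (Y t w) ^+ 2) by apply: Lint_indicM.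
  rewrite -!ErZ // -ErD; [|exact: LintZ|exact: LintZ].
  apply: Er_le; [exact: Lint_indicM|by apply: LintD; exact: LintZ|].
  move=> w; have := ler_wpM2l (_ : 0 <= \1_E w) (gsqr w tt).
  rewrite mulrDr ![\1_E w * (_ * fnorm _ ^+ 2)]mulrCA; apply.
  by rewrite indicE; case: (_ \in _).
have h2 : Er P (fun w => \1_E w * fnorm (Y t w) ^+ 2) <= 2 * c ^+ 2.
  by apply: le_trans EY2; apply: indicM_le => // w; exact: sqr_ge0.
have c20 : 0 <= 2 * C ^+ 2 * al t.
  exact: mulr_ge0 (mulr_ge0 (ler0n _ 2) (sqr_ge0 C)) (ltW (al0 t)).
rewrite addrA; apply: lerD.
  apply: (le_trans h1); rewrite lerD2l; apply: (le_trans (ler_wpM2l c20 h2)).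
  by apply: eqr_le; ring.
by rewrite -mulr_natr; apply: eqr_le; ring.
Qed.

Lemma two_scale_perp_rate tau : 1 < p * ((1 - tau2) - tau) ->
  {ae P, forall w, (fun t => t.+1%:R `^ tau * fnorm (Y t w)) @ \oo --> 0}.
Proof.
move=> ht; have [C' C'0 hC'] := two_scale_perp_decay.
have pp : 0 < p by exact: lt_le_trans p1.
exact: (@Lpb_as_rate _ _ _ P p (1 - tau2) tau C' t1 (fun t w => fnorm (Y t w)) pp C'0 ht
  (fun t w => fnorm_ge0 _) hC').
Qed.

(** Both error terms are [O(t^-2)]: the squared noise directly, and the disagreement because
    [t^-1 t^(-2 (1 - tau2)) <= t^-2] for [tau2 < 1/2]. The hypothesis [1 <= a] turns [al t * rho]
    into at least [rho / (t+1)]. *)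
Lemma two_scale_avg_bounded r : 0 <= r -> r < 1 -> r <= rho ->
  {ae P, forall w, exists K : R, forall n,
     (n + t1).+1%:R `^ r * fnorm (X (n + t1) w) ^+ 2 <= K}.
Proof.
move=> r0 r1 rrho; have [C' C'0 hC'] := two_scale_perp_decay.
have a0 : 0 < a by exact: lt_le_trans a1.
pose K := 4 * C ^+ 2 * a * C' ^+ 2 + 2 * q%:R * (C * Cz) ^+ 2 * a ^+ 2.
have K0 : 0 <= K by rewrite /K addr_ge0 // !mulr_ge0 ?sqr_ge0 // ltW.
have s1 : 1 < 2 - r by rewrite ltrBrDr -[2]/(1 + 1) ltrD2l.
apply: (@weighted_supermartingale_bounded _ _ _ P F (fun t w => fnorm (X t w) ^+ 2) t1 r rho 2 K) => //.
- move=> t; apply: measurable_funX; apply: (@measurable_fnorm _ (g_sigma_algebraType (F t))).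
  exact: gX.
- by move=> t w; exact: sqr_ge0.
- exact: ltW.
move=> t E tt FE; apply: (le_trans (two_scale_avg_step tt C'0 (hC' t tt) FE)); apply: lerD.
  apply: ler_wpM2r.
    by apply: Er_ge0 => w; rewrite mulr_ge0 ?sqr_ge0 // indicE; case: (_ \in _).
  rewrite lerD2l lerN2 mulrC /al alphaE ler_wpM2r //; first by rewrite (le_trans r0).
  by rewrite ler_peMl // invr_ge0.
rewrite /K [leRHS]mulrDl; apply: lerD.
  have -> : 4 * C ^+ 2 * al t * (C' * t.+1%:R `^ (- (1 - tau2))) ^+ 2 =
      4 * C ^+ 2 * C' ^+ 2 * a * (t.+1%:R^-1 * t.+1%:R `^ (- (1 - tau2)) ^+ 2).
    by rewrite /al alphaE; ring.
  have -> : 4 * C ^+ 2 * a * C' ^+ 2 = 4 * C ^+ 2 * C' ^+ 2 * a by ring.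
  rewrite ler_wpM2l ?mulr_ge0 ?sqr_ge0 ?(ltW a0) ?(ltW C0) ?(ltW C'0) //.
  rewrite -powR_inv1 // -powR_mulrn ?powR_ge0 // -powRrM -powRD ?pnatr_eq0 ?implybT //.
  rewrite ler_powR //; first by rewrite ler1n.
  by move: t21 => ?; lra.
have -> : t.+1%:R `^ (- 2) = t.+1%:R^-1 ^+ 2 :> R by rewrite powRN (powR_mulrn 2) // exprVn.
by apply: eqr_le; rewrite /al alphaE; ring.
Qed.

(** The gap between [r] and [2 tau] turns boundedness of the weighted square into convergence to
    [0]. *)
Lemma two_scale_avg_rate r tau : 0 <= r -> r < 1 -> r <= rho -> tau * 2 < r ->
  {ae P, forall w, (fun t => t.+1%:R `^ tau * fnorm (X t w)) @ \oo --> 0}.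
Proof.
move=> r0 r1 rrho hr; apply: filterS (two_scale_avg_bounded r0 r1 rrho) => w [K hK].
have d0 : 0 < r - tau * 2 by rewrite subr_gt0.
have h : (fun n => (n + t1).+1%:R `^ tau * fnorm (X (n + t1) w)) @ \oo --> 0.
  apply: (cvg0_of_sqr_weighted (K := K) d0) => n; apply: le_trans (hK n).
  rewrite exprMn mulrA ler_wpM2r ?sqr_ge0 //.
  rewrite -powR_mulrn ?powR_ge0 // -powRrM.
  apply: (@le_trans _ _ ((n + t1).+1%:R `^ (r - tau * 2) * (n + t1).+1%:R `^ (tau * 2))).
    rewrite ler_wpM2r ?powR_ge0 //; apply: ge0_ler_powR; rewrite ?nnegrE ?(ltW d0) //.
    by rewrite ler_nat ltnS leq_addr.
  by rewrite -powRD ?pnatr_eq0 ?implybT // subrK.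
move/cvgrPdist_lt: h => h; apply/cvgrPdist_lt => e e0; have [n _ hn] := h e e0.
exists (n + t1)%N => // t /= nt.
have := hn (t - t1)%N; rewrite /= subnK; last exact: leq_trans (leq_addl _ _) nt.
by apply; rewrite leq_subRL ?(leq_trans (leq_addl _ _) nt) // addnC.
Qed.

Lemma two_scale_rate r tau : 0 <= r -> r < 1 -> r <= rho -> tau * 2 < r ->
  1 < p * ((1 - tau2) - tau) ->
  {ae P, forall w, (fun t => t.+1%:R `^ tau * fnorm (Y t w)) @ \oo --> 0} /\
  {ae P, forall w, (fun t => t.+1%:R `^ tau * fnorm (X t w)) @ \oo --> 0}.
Proof. by move=> *; split; [exact: two_scale_perp_rate|exact: (@two_scale_avg_rate r)]. Qed.

End TwoScale.

(** * Innovations stacked over the agents *)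

Section Innovation.
Context {R : realType}.
Variables (N M : nat) (Mn : 'I_N -> nat).
Variable H : forall n, 'M[R]_(Mn n, M).
Implicit Types (K : forall n, 'M[R]_(M, Mn n)) (z : forall n, 'cV[R]_(Mn n)).

(** Row [n] belongs to agent [n]; although the dimensions [Mn n] differ, the images all lie in
    dimension [M], and communication becomes left multiplication by [L]. *)
Definition noisemx K z : 'M[R]_(N, M) := \matrix_(n, i) (K n *m z n) i 0.
Definition driftmx K (e : 'M[R]_(N, M)) : 'M[R]_(N, M) :=
  \matrix_(n, i) (K n *m H n *m (row n e)^T) i 0.

Lemma fnorm_rows_le (v : 'I_N -> 'cV[R]_M) :
  fnorm (\matrix_(n, i) v n i 0) <= M%:R * \sum_n fnorm (v n).
Proof.
apply: (le_trans (fnorm_le_sum _)); rewrite mulr_sumr; apply: ler_sum => n _.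
apply: (@le_trans _ _ (\sum_(i < M) fnorm (v n))).
  by apply: ler_sum => i _; rewrite mxE; exact: ler_fnorm_entry.
by rewrite sumr_const card_ord mulr_natl.
Qed.

Lemma fnorm_row_le (e : 'M[R]_(N, M)) n : fnorm (row n e) <= fnorm e.
Proof.
apply: ler_wsqrtr; rewrite {1}/mxdot big_ord1 /mxdot (bigD1 n) //=.
under eq_bigr do rewrite !mxE.
by rewrite lerDl; apply: sumr_ge0 => i _; apply: sumr_ge0 => j _; rewrite -expr2 sqr_ge0.
Qed.

Lemma fnorm_noisemx_le K z (c : R) : (forall n, fnorm (K n) <= c) ->
  fnorm (noisemx K z) <= M%:R * c * \sum_n \sum_i `|z n i 0|.
Proof.
move=> hc; apply: (le_trans (fnorm_rows_le _)); rewrite -mulrA ler_wpM2l //.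
rewrite mulr_sumr; apply: ler_sum => n _; apply: (le_trans (ler_fnormM _ _)).
apply: ler_pM; rewrite ?fnorm_ge0 //; apply: (le_trans (fnorm_le_sum _)).
by apply: ler_sum => i _; rewrite big_ord1.
Qed.

Lemma fnorm_driftmx_le K e (c : R) : (forall n, fnorm (K n) <= c) ->
  fnorm (driftmx K e) <= M%:R * c * (\sum_n fnorm (H n)) * fnorm e.
Proof.
move=> hc; apply: (le_trans (fnorm_rows_le _)); rewrite -!mulrA ler_wpM2l //.
rewrite mulr_suml mulr_sumr; apply: ler_sum => n _; apply: (le_trans (ler_fnormM _ _)).
rewrite mulrA; apply: ler_pM; rewrite ?fnorm_ge0 //; last by rewrite fnorm_tr fnorm_row_le.
by apply: (le_trans (ler_fnormM _ _)); apply: ler_wpM2r; rewrite ?fnorm_ge0.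
Qed.

Lemma driftmxD K e e' : driftmx K (e + e') = driftmx K e + driftmx K e'.
Proof.
apply/matrixP => n i; rewrite [RHS]mxE ![driftmx _ _ n i]mxE.
by rewrite linearD /= linearD /= mulmxDr [LHS]mxE.
Qed.

(** All rows of a consensus state coincide, so averaging sees only the mean of the [K n *m H n]; the
    transpose appears because agents' vectors are stored as rows. *)
Lemma avg_driftmx_const K (x : 'rV[R]_M) :
  avgmx *m driftmx K (const_mx 1 *m x) = x *m (N%:R^-1 *: \sum_n K n *m H n)^T.
Proof.
have rowE n : row n ((const_mx 1 : 'cV[R]_N) *m x) = x.
  by rewrite row_mul; apply/matrixP => i j; rewrite !ord1 !mxE big_ord1 !mxE mul1r.
apply/matrixP => i j; rewrite !ord1 [LHS]mxE.
rewrite -[x in RHS]trmxK -trmx_mul mxE -scalemxAl mxE mulmx_suml summxE mulr_sumr.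
apply: eq_bigr => n _; by rewrite /avgmx !mxE mulr1 rowE; congr (_ * _); apply: eq_bigr => l _; rewrite !mxE.
Qed.

Lemma innovation_split K z e : \matrix_(n, i) (K n *m (z n - H n *m (row n e)^T)) i 0 =
  noisemx K z - driftmx K e.
Proof.
have subE p q (A B : 'M[R]_(p, q)) i j : (A - B) i j = A i j - B i j by rewrite !mxE.
apply/matrixP => n i; rewrite [LHS]mxE mulmxBr mulmxA !subE.
by rewrite [noisemx _ _ n i]mxE [driftmx _ _ n i]mxE.
Qed.

End Innovation.

Lemma noisemx_meas d (T : measurableType d) (R : realType) N M (Mn : 'I_N -> nat)
    (K : forall n, T -> 'M[R]_(M, Mn n)) (z : forall n, T -> 'cV[R]_(Mn n)) :
  (forall n, mxmeas (K n)) -> (forall n, mxmeas (z n)) ->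
  mxmeas (fun w => noisemx (fun n => K n w) (fun n => z n w)).
Proof.
move=> hK hz n i; rewrite (_ : (fun w => _) = (fun w => (K n w *m z n w) i 0)); last first.
  by apply/funext => w; rewrite mxE.
exact: (mxmeasM (hK n) (hz n)).
Qed.

Lemma driftmx_meas d (T : measurableType d) (R : realType) N M (Mn : 'I_N -> nat)
    (H : forall n, 'M[R]_(Mn n, M)) (K : forall n, T -> 'M[R]_(M, Mn n)) (e : T -> 'M[R]_(N, M)) :
  (forall n, mxmeas (K n)) -> mxmeas e -> mxmeas (fun w => driftmx H (fun n => K n w) (e w)).
Proof.
move=> hK he n i; rewrite (_ : (fun w => _) = (fun w => (K n w *m H n *m (row n (e w))^T) i 0)); last first.
  by apply/funext => w; rewrite mxE.
apply: (mxmeasM (X := fun w => K n w *m H n)).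
  by apply: mxmeasM; [exact: hK|exact: mxmeas_cst].
by apply: mxmeasT => k l; under eq_fun do rewrite mxE; exact: he.
Qed.

(** * The error recursion with adapted, convergent gains *)

Section GainTracking.
Context {d : measure_display} {T : measurableType d} {R : realType}.
Variables (P : probability T R) (F : nat -> set_system T).
Variables (N M : nat) (Mn : 'I_N -> nat).
Variable L : nat -> T -> 'M[R]_N.
Hypotheses (filF : is_filtration F) (lapL : forall t w, is_simple_laplacian (L t w)).
Hypotheses (idL : ident_distr P L) (adL : adapted_indep P F L).
Hypothesis lamL : lambda2_pos (Emx P (L 0%N)).
Variables (a b tau2 p : R).
Hypotheses (a1 : 1 <= a) (b0 : 0 < b) (t20 : 0 < tau2) (t21 : tau2 < 2^-1).
Hypotheses (p2 : 2 <= p) (pcond : 1 < p * ((1 - tau2) - 2^-1)).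
Hypothesis N0 : (0 < N)%N.
Let al := step a 1.
Let be := step b tau2.
Local Notation adm t Z := (gmxmeas (F t) Z).

Variable H : forall n, 'M[R]_(Mn n, M).
Variable zeta : forall n, nat -> T -> 'cV[R]_(Mn n).
Variable Cz : R.
Hypotheses (adZ : forall n, adapted_indep P F (zeta n)) (Cz0 : 0 < Cz).
Hypothesis LZ : forall n t i, Lint P (fun w => zeta n t w i 0).
Hypothesis EZ : forall n t i, Er P (fun w => zeta n t w i 0) = 0.
Hypothesis momZ : forall n t i, Lpb P p (fun w => zeta n t w i 0) Cz.
Variables (Kg : forall n, nat -> T -> 'M[R]_(M, Mn n)) (Kinf : forall n, 'M[R]_(M, Mn n)).
Hypothesis gK : forall n t, adm t (Kg n t).
Hypothesis cvgK : {ae P, forall w, forall n, mxcv (fun t => Kg n t w) (Kinf n)}.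
Hypothesis avgK : N%:R^-1 *: \sum_n Kinf n *m H n = 1%:M.
Variable E : nat -> T -> 'M[R]_(N, M).
Hypothesis gE : forall t, adm t (E t).
Hypothesis ES : forall t w, E t.+1 w = E t w - be t *: (L t w *m E t w) +
  al t *: (noisemx (fun n => Kg n t w) (fun n => zeta n t w)
           - driftmx H (fun n => Kg n t w) (E t w)).

Let gZ n t : adm t.+1 (zeta n t).
Proof. by move=> i j; apply: gmeas_preimage; case: (adZ n t) => h _; exact: h. Qed.
Let mZ n t : mxmeas (zeta n t).
Proof. exact (mxmeas_sub filF (@gZ n t)). Qed.

Variable tau : R.
Hypotheses (tau0 : 0 <= tau) (tau1 : tau < 2^-1).

(** Since [0 <= tau < 1/2], this lies strictly between [2 tau] and [1], and it is at least [1/2]. *)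
Let rho : R := tau + 2^-1.
Let eta : R := (1 - rho) / (1 + \sum_n fnorm (H n)).
Let SH : R := \sum_n fnorm (H n).
Let SH0 : 0 <= SH. Proof. by apply: sumr_ge0 => n _; exact: fnorm_ge0. Qed.
Let rho1 : rho < 1. Proof. by rewrite /rho; move: tau1 => ?; lra. Qed.
Let eta0 : 0 < eta. Proof. by rewrite /eta divr_gt0 ?subr_gt0 // ltr_wpDr. Qed.

(* Gains kept within [eta] of their limits: then the average of [Kt n *m H n] is
   within [1 - rho] of the identity. *)
Let Kt n t w : 'M[R]_(M, Mn n) :=
  if fnorm (Kg n t w - Kinf n) <= eta then Kg n t w else Kinf n.

Let gKt n t : adm t (Kt n t).
Proof.
apply: mxmeas_ifb; [|exact: gK|exact: mxmeas_cst].
apply: measurable_fun_ler; last exact: measurable_cst.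
apply: (@measurable_fnorm _ (g_sigma_algebraType (F t))).
by apply: mxmeasB; [exact: gK|exact: mxmeas_cst].
Qed.

Let Kt_near n t w : fnorm (Kt n t w - Kinf n) <= eta.
Proof. by rewrite /Kt; case: ifP => // _; rewrite subrr fnorm0 ltW. Qed.

Let Kmax : R := eta + \sum_n fnorm (Kinf n).
Let Kmax0 : 0 <= Kmax.
Proof. by rewrite addr_ge0 ?(ltW eta0) //; apply: sumr_ge0 => n _; exact: fnorm_ge0. Qed.

Let Kt_bound t w n : fnorm (Kt n t w) <= Kmax.
Proof.
rewrite -[Kt n t w](subrK (Kinf n)); apply: (le_trans (ler_fnormD _ _)); apply: lerD => //.
by rewrite (bigD1 n) //= lerDl; apply: sumr_ge0 => k _; exact: fnorm_ge0.
Qed.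

Let avgKt t w : fnorm (N%:R^-1 *: (\sum_n Kt n t w *m H n) - 1%:M) <= 1 - rho.
Proof.
rewrite -avgK -scalerBr -sumrB fnormZ.
have Ninv : `|N%:R^-1| <= 1 :> R.
  by rewrite ger0_norm ?invr_ge0 // invf_le1 ?ltr0n // ler1n.
apply: (@le_trans _ _ (1 * (eta * SH))); last first.
  rewrite mul1r /eta mulrAC ler_pdivrMr; last by rewrite ltr_wpDr.
  by rewrite ler_wpM2l ?subr_ge0 ?(ltW rho1) // lerDr.
apply: ler_pM => //; first exact: fnorm_ge0.
apply: (le_trans (ler_fnorm_sum _ _ _)); rewrite /SH mulr_sumr; apply: ler_sum => n _.
rewrite -mulmxBl; apply: (le_trans (ler_fnormM _ _)).
by apply: ler_wpM2r; rewrite ?fnorm_ge0.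
Qed.

Let stp t w (e : 'M[R]_(N, M)) := e - be t *: (L t w *m e) +
  al t *: (noisemx (fun n => Kt n t w) (fun n => zeta n t w)
           - driftmx H (fun n => Kt n t w) e).
Let Eh t1 (j : nat) := restart t1 (fun t w => cutoff j%:R (E t w)) stp.

Let gEh t1 j t : adm t (Eh t1 j t).
Proof.
apply: restart_adapted => [s|s Z gZ']; first by apply: mxmeas_cutoff; exact: gE.
apply: consensus_step_adapted => //.
have gK' n : adm s.+1 (Kt n s) by exact (mxmeasS filF (@gKt n s)).
apply: mxmeasB.
  exact: (@noisemx_meas _ (g_sigma_algebraType (F s.+1)) R N M Mn (fun n => Kt n s) (fun n => zeta n s)).
apply: (@driftmx_meas _ (g_sigma_algebraType (F s.+1)) R N M Mn H (fun n => Kt n s) Z) => //.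
exact (mxmeasS filF gZ').
Qed.

Let Cn := M%:R * Kmax.
Let Cd := M%:R * Kmax * SH.
Let Cn0 : 0 <= Cn. Proof. exact: mulr_ge0. Qed.
Let Cd0 : 0 <= Cd. Proof. exact: mulr_ge0. Qed.
Let ones : R := fnorm (const_mx 1 : 'cV[R]_N).
Let fp : R := fnorm (@perpmx R N).
Let fa : R := fnorm (@avgmx R N).
Let ones0 : 0 <= ones. Proof. exact: fnorm_ge0. Qed.
Let fp0 : 0 <= fp. Proof. exact: fnorm_ge0. Qed.
Let fa0 : 0 <= fa. Proof. exact: fnorm_ge0. Qed.
(** One constant for all the linear bounds of the joint recursion; the summand [1] secures
    [1 <= C]. *)
Let C := 1 + (fp * Cn + fp * Cd * (1 + ones) + fa * Cd + fa * Cn).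
Let nz t w : R := \sum_n \sum_i `|zeta n t w i 0|.
Let nz0 t w : 0 <= nz t w.
Proof. by apply: sumr_ge0 => n _; apply: sumr_ge0. Qed.

Let Cbounds : [/\ 1 <= C, fp * Cn <= C, fp * Cd * (1 + ones) <= C, fa * Cd <= C & fa * Cn <= C].
Proof.
have h1 := mulr_ge0 fp0 Cn0; have h4 := mulr_ge0 fa0 Cn0; have h3 := mulr_ge0 fa0 Cd0.
have h2 := mulr_ge0 (mulr_ge0 fp0 Cd0) (addr_ge0 ler01 ones0).
rewrite /C; move: (fp * Cn) (fp * Cd * (1 + ones)) (fa * Cd) (fa * Cn) h1 h2 h3 h4.
by move=> x y z u ? ? ? ?; split; lra.
Qed.

Let Cnz : R := 1 + \sum_(n < N) (1 + \sum_(i < Mn n) Cz).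

Let Lnz t : Lpb P p (nz t) Cnz.
Proof.
have p1 : 1 <= p by apply: le_trans p2; rewrite ler1n.
apply: Lpb_sum => // [n|n]; first by rewrite ltr_wpDr // sumr_ge0 // => i _; exact: ltW.
apply: Lpb_sum => // i.
apply: (@Lpb_le _ _ _ P p (fun w => zeta n t w i 0) (fun w => `|zeta n t w i 0|)) => //; first exact: le_trans p1.
  by apply: (measurableT_comp (@normr_measurable R setT)); exact: mZ.
by move=> w; rewrite normr_id.
Qed.

(** Expanded into entries, each term is an [F t]-measurable factor times a centred noise entry
    independent of [F t]. The factor is integrable because the truncated gains are bounded. *)
Let Vorth t (f : T -> R) i : gmeas (F t) f -> Lint P (fun w => f w ^+ 2) ->
  Er P (fun w => f w * (avgmx *m noisemx (fun n => Kt n t w) (fun n => zeta n t w)) 0 i) = 0.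
Proof.
move=> gf Lf2.
have [sG subG _] := filF t.
have mf : measurable_fun setT f by exact (gmeas_measurable subG gf).
have Lf : Lint P f.
  have := @Lint_sqr_mul _ _ _ P f (fun=> 1) mf (measurable_cst _) Lf2 (Lint_cst _ _).
  by under eq_fun do rewrite mulr1.
pose h n j w := avgmx 0 n * (f w * Kt n t w i j).
have gh n j : gmeas (F t) (h n j).
  apply: measurable_funM; first exact: measurable_cst.
  by apply: measurable_funM => //; exact: gKt.
have Lh n j : Lint P (h n j).
  apply: LintZ; apply: Lint_le (LintZ Kmax (Lint_norm Lf)).
    apply: measurable_funM => //; exact: (mxmeas_sub filF (@gKt n t)).
  move=> w; rewrite normrM mulrC ler_wpM2r //.
  exact: le_trans (ler_fnorm_entry _ _ _) (Kt_bound _ _ _).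
have ind n j : Lint P (fun w => h n j w * zeta n t w j 0) /\
    Er P (fun w => h n j w * zeta n t w j 0) = 0.
  have [|Lz ->] := @indep_Er _ _ _ P _ _ (zeta n t) (F t) (h n j) (fun w => zeta n t w j 0)
    sG subG (@mZ n t) _ (gh n j) (@gmeas_entry _ _ _ _ _ (zeta n t) j 0) (Lh n j) (@LZ n t j).
    by case: (adZ n t).
  by split => //; rewrite EZ mulr0.
rewrite (_ : (fun w => _) = (fun w => \sum_n \sum_j h n j w * zeta n t w j 0)).
  rewrite Er_sum; last by move=> n; apply: Lint_sum => j; case: (ind n j).
  apply: big1 => n _; rewrite Er_sum; last by move=> j; case: (ind n j).
  by apply: big1 => j _; case: (ind n j).
apply/funext => w; rewrite mxE mulr_sumr; apply: eq_bigr => n _.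
rewrite [noisemx _ _ n i]mxE [(Kt n t w *m _) i 0]mxE !mulr_sumr; apply: eq_bigr => j _.
by rewrite /h; ring.
Qed.

(** The threshold [T0] is deterministic, but all later restart times are needed, as the time from
    which the gains stay near their limits is random. Integer times and levels keep the exceptional
    sets countable in number. *)
Lemma localized_rate : exists T0, forall s j,
  {ae P, forall w, (fun t => t.+1%:R `^ tau * fnorm (Eh (s + T0) j t w)) @ \oo --> 0}.
Proof.
have [k k01 hk] := laplacian_contraction filF lapL idL adL lamL p2.
have k0 : 0 < k by case/andP: k01.
have [C1 c1 c2 c3 c4] := Cbounds.
have C0 : 0 < C by exact: lt_le_trans C1.
have C20 : 0 < 12 * C ^+ 2 by rewrite mulr_gt0 // exprn_gt0.
have kC0 : 0 < k / (12 * C ^+ 2) by rewrite divr_gt0.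
have [T1 _ hT1] := late_near N a1 b0 t20 t21 k0.
have [T2 _ hT2] := alpha_small_beta a b0 t20 t21 kC0.
exists (maxn T1 T2) => s j; set t1 := (s + maxn T1 T2)%N.
have lt1 : late N a b tau2 k t1.
  by apply: hT1; rewrite /= /t1 (leq_trans (leq_maxl T1 T2)) ?leq_addl.
have sg t : (t1 <= t)%N -> 12 * C ^+ 2 * al t <= k * be t.
  move=> tt; have := hT2 t; rewrite /= mulrAC ler_pdivlMr // mulrC; apply.
  by apply: leq_trans tt; rewrite /t1 (leq_trans (leq_maxr T1 T2)) ?leq_addl.
pose e t w := Eh t1 j t w.
have eS t w : (t1 <= t)%N -> e t.+1 w = stp t w (e t w) by exact: restart_step.
pose nm t w := noisemx (fun n => Kt n t w) (fun n => zeta n t w).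
pose dm t w x := driftmx H (fun n => Kt n t w) x.
have mnm t : mxmeas (nm t).
  apply: noisemx_meas => n; [exact (mxmeas_sub filF (@gKt n t))|exact: mZ].
have mdm t : mxmeas (fun w => dm t w (e t w)).
  apply: driftmx_meas => [n|]; [exact (mxmeas_sub filF (@gKt n t))|exact (mxmeas_sub filF (@gEh t1 j t))].
pose B : R := 1 + (fp + fa) * j%:R.
have B0 : 0 < B by rewrite ltr_wpDr // mulr_ge0 // addr_ge0.
have Cz'0 : 0 < Cnz.
  rewrite ltr_wpDr // sumr_ge0 // => n _; rewrite addr_ge0 // sumr_ge0 // => i _; exact: ltW.
have ge' t : adm t (e t) by exact: gEh.
have gP m (A : 'M[R]_(m, N)) t : adm t (fun w => A *m e t w).
  by apply: mxmeasM; [exact: mxmeas_cst|exact: ge'].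
pose g t w := avgmx *m e t w - al t *: (avgmx *m dm t w (e t w)).
have gg t : adm t (g t).
  apply: mxmeasB => //; apply: mxmeasZ; apply: mxmeasM; first exact: mxmeas_cst.
  by apply: driftmx_meas => // n; exact: gKt.
pose U t w := perpmx *m (nm t w - dm t w (e t w)).
have mU t : mxmeas (U t).
  by apply: mxmeasM; [exact: mxmeas_cst|exact: mxmeasB].
pose V t w := avgmx *m nm t w.
have mV t : mxmeas (V t) by apply: mxmeasM; [exact: mxmeas_cst|exact: mnm].
have nmle t w : fnorm (nm t w) <= Cn * nz t w by exact: fnorm_noisemx_le.
have dmle t w x : fnorm (dm t w x) <= Cd * fnorm x by exact: fnorm_driftmx_le.
have YS t w : (t1 <= t)%N -> perpmx *m e t.+1 w =
    perpmx *m e t w - be t *: (L t w *m (perpmx *m e t w)) + al t *: U t w.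
  by move=> tt; rewrite eS // /stp perp_step.
have XS t w : (t1 <= t)%N -> avgmx *m e t.+1 w = g t w + al t *: V t w.
  move=> tt; rewrite eS // /stp avg_step // /g /V mulmxBr scalerBr -!addrA.
  by congr (_ + _); rewrite addrC.
have Un t w : fnorm (U t w) <=
    C * (fnorm (perpmx *m e t w) + fnorm (avgmx *m e t w) + nz t w).
  have Y0 : 0 <= fnorm (perpmx *m e t w) by exact: fnorm_ge0.
  have X0 : 0 <= fnorm (avgmx *m e t w) by exact: fnorm_ge0.
  have he : fnorm (e t w) <= (1 + ones) * (fnorm (perpmx *m e t w) + fnorm (avgmx *m e t w)).
    rewrite [e t w in leLHS]perp_decomp; apply: (le_trans (ler_fnormD _ _)).
    rewrite mulrDr; apply: lerD; first by rewrite ler_peMl // lerDl.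
    by apply: (le_trans (ler_fnormM _ _)); apply: ler_wpM2r => //; rewrite lerDr.
  apply: (le_trans (ler_fnormM _ _)).
  apply: (@le_trans _ _ (fp * (Cn * nz t w + Cd * ((1 + ones) *
      (fnorm (perpmx *m e t w) + fnorm (avgmx *m e t w)))))).
    apply: (ler_wpM2l fp0); apply: (le_trans (ler_fnormB _ _)); apply: lerD => //.
    exact: le_trans (dmle t w _) (ler_wpM2l Cd0 he).
  rewrite mulrDr addrC [leRHS]mulrDr; apply: lerD.
    rewrite (mulrA fp Cd) (mulrA (fp * Cd)); apply: ler_wpM2r => //; exact: addr_ge0.
  by rewrite (mulrA fp Cn); apply: ler_wpM2r.
have gn t w : (t1 <= t)%N -> fnorm (g t w) <=
    (1 - al t * rho) * fnorm (avgmx *m e t w) + al t * C * fnorm (perpmx *m e t w).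
  move=> tt; have [_ _ _ al1] := lt1 t tt.
  have al0 : 0 < al t by exact: alpha_gt0.
  set x := avgmx *m e t w; set y := perpmx *m e t w.
  set Bt := N%:R^-1 *: (\sum_n Kt n t w *m H n).
  (* The drift is split over the disagreement [y] and the consensus part [x], and [Bt] is compared
     with the identity: [(1 - al t) + al t * (1 - rho)] is the required [1 - al t * rho]. *)
  have gE' : g t w = (1 - al t) *: x - al t *: (x *m (Bt - 1%:M)^T) - al t *: (avgmx *m dm t w y).
    have de : avgmx *m dm t w (e t w) = avgmx *m dm t w y + x *m Bt^T.
      by rewrite -avg_driftmx_const -mulmxDr -driftmxD -perp_decomp.
    rewrite /g de [(Bt - _)^T]linearB /= trmx1 mulmxBr mulmx1 !scalerBr scalerDr scalerBl scale1r.
    move: (al t *: (avgmx *m dm t w y)) (al t *: (x *m Bt^T)) (al t *: x) => u v z.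
    by rewrite -/x opprD opprB !addrA subrK addrAC.
  have n1 : fnorm (x *m (Bt - 1%:M)^T) <= (1 - rho) * fnorm x.
    apply: (le_trans (ler_fnormM _ _)); rewrite mulrC; apply: ler_wpM2r; first exact: fnorm_ge0.
    by rewrite fnorm_tr; exact: avgKt.
  have n2 : fnorm (avgmx *m dm t w y) <= C * fnorm y.
    apply: (le_trans (ler_fnormM _ _)); apply: (le_trans (ler_wpM2l fa0 (dmle t w y))).
    by rewrite mulrA; apply: ler_wpM2r; first exact: fnorm_ge0.
  rewrite gE'; apply: (le_trans (ler_fnormB _ _)).
  apply: (le_trans (lerD (ler_fnormB _ _) (lexx _))).
  rewrite !fnormZ (gtr0_norm al0) ger0_norm ?subr_ge0 //.
  apply: (le_trans (lerD (lerD (lexx _) (ler_wpM2l (ltW al0) n1)) (ler_wpM2l (ltW al0) n2))).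
  move: (al t) (fnorm x) (fnorm y) => u v z.
  by apply: eqr_le; ring.
have Vn t w : fnorm (V t w) <= C * nz t w.
  apply: (le_trans (ler_fnormM _ _)); apply: (le_trans (ler_wpM2l fa0 (nmle t w))).
  by rewrite mulrA ler_wpM2r.
have Li m (A : 'M[R]_(m, N)) : fnorm A <= fp + fa -> Lpb P p (fun w => fnorm (A *m e t1 w)) B.
  move=> hA; apply: Lpb_fnorm_bounded; [exact: le_trans p2|exact: ltW| |].
    exact (mxmeas_sub filF (gP m A t1)).
  move=> w; rewrite /e /Eh restart_init //; apply: (le_trans (ler_fnormM _ _)).
  apply: (@le_trans _ _ ((fp + fa) * j%:R)); last by rewrite /B lerDr.
  by apply: ler_pM; rewrite ?fnorm_ge0 // fnorm_cutoff.
have LY1 : Lpb P p (fun w => fnorm (perpmx *m e t1 w)) B by apply: Li; rewrite lerDl.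
have LX1 : Lpb P p (fun w => fnorm (avgmx *m e t1 w)) B by apply: Li; rewrite lerDr.
have rho2 : 2^-1 <= rho by rewrite lerDr.
have sY t w i : \sum_l (perpmx *m e t w) l i = 0 by exact: perp_colsum.
have Lz t : (t1 <= t)%N -> Lpb P p (nz t) Cnz.
  by move=> _; exact: Lnz.
have Vo t (f : T -> R) i : (t1 <= t)%N -> gmeas (F t) f -> Lint P (fun w => f w ^+ 2) ->
   Er P (fun w => f w * V t w 0 i) = 0 by move=> _; exact: Vorth.
have ht : 1 < p * (1 - tau2 - tau).
  apply: (lt_le_trans pcond); rewrite ler_wpM2l ?(le_trans _ p2) // lerD2l lerN2; exact: ltW.
have r0 : 0 <= rho by rewrite (le_trans _ rho2) // invr_ge0.
have hr : tau * 2 < rho by rewrite /rho; move: tau1 => ?; lra.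
have [RY RX] := @two_scale_rate _ _ _ P F N L filF adL a b tau2 a1 b0 t20 t21 p k C rho Cnz B t1 M
  p2 k01 hk lt1 C1 rho2 rho1 Cz'0 B0 sg (fun t w => perpmx *m e t w) U (fun t w => avgmx *m e t w)
  g V nz (gP _ _) (gP _ _) gg mU mV sY YS XS nz0 (fun t w _ => Un t w) gn (fun t w _ => Vn t w)
  Vo Lz LY1 LX1 rho tau r0 rho1 (lexx _) hr ht.
apply: filterS2 RY RX => w hY hX.
apply: cvg0_le (cvg0D hY (cvg0Z ones hX)); apply: nearW => t.
rewrite ger0_norm; last by rewrite mulr_ge0 ?powR_ge0 ?fnorm_ge0.
rewrite mulrCA -mulrDr; apply: ler_wpM2l; first exact: powR_ge0.
rewrite -/(e t w) [e t w in leLHS]perp_decomp; apply: (le_trans (ler_fnormD _ _)).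
by rewrite lerD2l ler_fnormM.
Qed.

(** Outside countably many null sets, a path fixes first a time [s] after which its gains stay
    within [eta] of their limits, then an integer level [j] above its error at [s + T0]; from there
    on the localized copy is the path itself. *)
Theorem tracking_rate :
  {ae P, forall w, (fun t => t.+1%:R `^ tau * fnorm (E t w)) @ \oo --> 0}.
Proof.
have [T0 hT] := localized_rate.
have h2 := ae_foralln (fun s => ae_foralln (hT s)).
apply: filterS2 cvgK h2 => w hK hw.
have [s _ hs] : \forall t \near \oo, forall n, fnorm (Kg n t w - Kinf n) <= eta.
  by apply: filter_forall => n; apply: cvg0_near_le; [exact: eta0|exact: hK].
pose t1 := (s + T0)%N; pose j := (Num.truncn (fnorm (E t1 w))).+1.
have cj : fnorm (E t1 w) <= j%:R by apply: ltW; exact: truncnS_gt.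
have KE t n : (t1 <= t)%N -> Kt n t w = Kg n t w.
  move=> tt; rewrite /Kt ifT //; apply: hs.
  by apply: leq_trans tt; exact: leq_addr.
have e t : (t1 <= t)%N -> Eh t1 j t w = E t w.
  apply: (@restart_eq _ _ N M t1 _ _ E w); first exact: cutoff_id.
  move=> t' tt; rewrite ES /stp.
  have -> // : (fun n => Kt n t' w) = (fun n => Kg n t' w).
  by apply/functional_extensionality_dep => n; exact: KE.
apply: cvg0_le (hw s j); exists t1 => // t /= tt.
by rewrite ger0_norm ?mulr_ge0 ?powR_ge0 ?fnorm_ge0 // e.
Qed.

End GainTracking.

(** * Neighbour sums, sample covariances and events of convergence *)

Section Neighbours.
Context {R : realType}.

(** The diagonal of [L] is the degree, which collects the copies of [X i]. The values lie in any
    module so that both the estimates and the matrices [G_n] are covered. *)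
Lemma laplacian_nbr_sum (V : lmodType R) n (L : 'M[R]_n) (X : 'I_n -> V) i :
  is_simple_laplacian L ->
  \sum_(l < n | L i l == -1) (X i - X l) = \sum_l L i l *: X l.
Proof.
move=> hL; rewrite [RHS](bigD1 i) //=; case: (hL i i) => _ _ ->.
rewrite scaleNr scaler_suml -sumrN -big_split /= big_mkcond [RHS]big_mkcond /=.
apply: eq_bigr => l _; have [->|li] := eqVneq l i; first by rewrite subrr /=; case: ifP.
rewrite eq_sym in li; case: (hL i l) => /(_ li) [] -> _ _ /=.
  by rewrite eq_sym oppr_eq0 oner_eq0 !scale0r oppr0 addr0.
by rewrite eqxx !scaleN1r opprK.
Qed.

End Neighbours.

Section NoiseLimit.
Context {R : realType}.

Lemma cvg0_shift (u : nat -> R) : u @ \oo --> 0 -> (fun t => u t.+1) @ \oo --> 0.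
Proof.
move=> /cvgrPdist_lt h; apply/cvgrPdist_lt => e e0; have [n _ hn] := h e e0.
by exists n => // t /= nt; apply: hn; exact: leqW.
Qed.

Lemma cvg0_unshift (u : nat -> R) : (fun t => u t.+1) @ \oo --> 0 -> u @ \oo --> 0.
Proof.
move=> /cvgrPdist_lt h; apply/cvgrPdist_lt => e e0; have [n _ hn] := h e e0.
by exists n.+1 => // -[//|t] /= nt; apply: hn.
Qed.

(** With [S1] and [S2] the averages of the noise and of its outer products, the expression is a
    polynomial in them in which the terms [h h^T] cancel in the limit. *)
Lemma sample_covariance_cvg m (h : 'cV[R]_m) (z : nat -> 'cV[R]_m) (S : 'M[R]_m) :
  mxcv (fun k => k%:R^-1 *: \sum_(s < k) z s) 0 ->
  mxcv (fun k => k%:R^-1 *: \sum_(s < k) (z s *m (z s)^T)) S ->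
  mxcv (fun k => k%:R^-1 *: \sum_(s < k.+1) ((h + z s) *m (h + z s)^T)
    - (k%:R^-1 *: \sum_(s < k) (h + z s)) *m (k%:R^-1 *: \sum_(s < k) (h + z s))^T) S.
Proof.
move=> hz hzz.
pose S1 k := k%:R^-1 *: \sum_(s < k) z s; pose S2 k := k%:R^-1 *: \sum_(s < k) (z s *m (z s)^T).
have mean k : (0 < k)%N -> k%:R^-1 *: \sum_(s < k) (h + z s) = h + S1 k.
  move=> k0; rewrite big_split /= scalerDr sumr_const card_ord -[h *+ k]scaler_nat scalerA.
  by rewrite mulVf ?scale1r // pnatr_eq0 -lt0n.
have second k : (0 < k)%N -> k%:R^-1 *: \sum_(s < k) ((h + z s) *m (h + z s)^T) =
    h *m h^T + h *m (S1 k)^T + (S1 k *m h^T + S2 k).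
  move=> k0.
  have -> : \sum_(s < k) ((h + z s) *m (h + z s)^T) =
     \sum_(s < k) (h *m h^T) + h *m (\sum_(s < k) z s)^T
     + ((\sum_(s < k) z s) *m h^T + \sum_(s < k) (z s *m (z s)^T)).
    rewrite linear_sum /= mulmx_sumr mulmx_suml -!big_split /=.
    by apply: eq_bigr => s _; rewrite linearD /= mulmxDr !mulmxDl addrACA [X in _ + X]addrC addrACA addrA [_ + z s *m h^T]addrC !addrA.
  rewrite !scalerDr sumr_const card_ord -[(h *m h^T) *+ k]scaler_nat scalerA mulVf ?pnatr_eq0 -?lt0n // scale1r.
  by rewrite /S1 /S2 [in RHS]linearZ /= -scalemxAr -scalemxAl.
pose X k := (k.+1%:R / k%:R) *: (h *m h^T + h *m (S1 k.+1)^T + (S1 k.+1 *m h^T + S2 k.+1))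
   - (h + S1 k) *m (h + S1 k)^T.
have XE k : (0 < k)%N -> k%:R^-1 *: \sum_(s < k.+1) ((h + z s) *m (h + z s)^T)
    - (k%:R^-1 *: \sum_(s < k) (h + z s)) *m (k%:R^-1 *: \sum_(s < k) (h + z s))^T = X k.
  move=> k0; rewrite mean // /X -second // scalerA; congr (_ *: _ - _).
  by rewrite mulrAC mulfV ?pnatr_eq0 // mul1r.
(* The sum of outer products has [k + 1] terms but is divided by [k], so this ratio multiplies
   it. *)
have r1 : (fun k : nat => k.+1%:R / k%:R - 1 : R) @ \oo --> 0.
  apply: cvg0_unshift.
  have -> : (fun k : nat => k.+2%:R / k.+1%:R - 1 : R) = (fun k => k.+1%:R `^ (- 1)).
    apply/funext => k; rewrite powR_inv1 // -[k.+2%:R]natr1 mulrDl mulfV ?pnatr_eq0 // mul1r.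
    by rewrite addrC addKr.
  exact: cvg_powRN.
have S1' : mxcv (fun k => S1 k.+1) 0 by exact: (cvg0_shift hz).
have S2' : mxcv (fun k => S2 k.+1) S by exact: (cvg0_shift hzz).
have cX : mxcv X S.
  have e : S = 1 *: (h *m h^T + h *m 0^T + (0 *m h^T + S)) + - ((h + 0) *m (h + 0)^T).
    by rewrite scale1r trmx0 mulmx0 mul0mx !addr0 add0r addrAC subrr add0r.
  rewrite e; apply: mxcvD.
    apply: mxcvZ => //; apply: mxcvD; apply: mxcvD => //.
    - exact: mxcv_cst.
    - by apply: mxcvM; [exact: mxcv_cst|exact: mxcvT].
    - by apply: mxcvM => //; exact: mxcv_cst.
  apply: mxcvN; apply: mxcvM; last apply: mxcvT; by apply: mxcvD => //; exact: mxcv_cst.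
apply: mxcv_le cX; exists 1%N => // k /= k0; by rewrite XE.
Qed.

End NoiseLimit.

Lemma ae_forall_fin d (T : measurableType d) (R : realType) (P : probability T R)
    (I : finType) (Q : I -> T -> Prop) :
  (forall i, {ae P, forall w, Q i w}) -> {ae P, forall w, forall i, Q i w}.
Proof. by move=> h; apply: filter_forall. Qed.

Lemma le_1Dsum (R : realType) (I : finType) (e : I -> R) i : (forall i, 0 <= e i) ->
  e i <= 1 + \sum_j e j.
Proof.
move=> e0; rewrite (bigD1 i) //= addrCA lerDl addr_ge0 //.
by apply: sumr_ge0 => k _; exact: e0.
Qed.

(** The final claim is about the probability of the event of convergence itself, so an almost
    everywhere statement has to be completed by measurability, read off from the countable form of
    the limit. *)
Lemma measurable_cvg0 d (T : measurableType d) (R : realType) (u : nat -> T -> R) :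
  (forall t, measurable_fun setT (u t)) -> measurable [set w | u ^~ w @ \oo --> 0].
Proof.
move=> mu.
rewrite (_ : [set w | _] = \bigcap_k \bigcup_m \bigcap_t
    (if (m <= t)%N then [set w | `|u t w| < k.+1%:R^-1] else setT)).
  apply: bigcapT_measurable => k; apply: bigcupT_measurable => m.
  apply: bigcapT_measurable => t; case: ifP => // _.
  have -> : [set w | `|u t w| < k.+1%:R^-1] = setT `&` (fun w => `|u t w|) @^-1` `]-oo, k.+1%:R^-1[.
    by rewrite setTI; apply/seteqP; split => w /=; rewrite in_itv.
  by apply: (measurableT_comp (@normr_measurable R setT)) => //; exact: mu.
apply/seteqP; split => w /= h.
- move=> k _; move/cvgrPdist_lt: h => /(_ k.+1%:R^-1); rewrite invr_gt0 => /(_ (ltr0Sn _ _))[m _ hm].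
  exists m => // t _; case: ifP => // mt /=.
  by have := hm t mt; rewrite /= sub0r normrN.
- apply/cvgrPdist_lt => e e0.
  have [m _ hm] := h (Num.truncn e^-1) I.
  exists m => // t /= mt; have := hm t I; rewrite mt /= sub0r normrN => /lt_trans; apply.
  by rewrite invf_plt ?posrE // truncnS_gt.
Qed.

Lemma ae_probability1 d (T : measurableType d) (R : realType) (P : probability T R)
    (Q : T -> Prop) :
  measurable [set w | Q w] -> {ae P, forall w, Q w} -> P [set w | Q w] = 1%E.
Proof.
move=> mQ [B [mB PB QB]].
have P0 : P (~` [set w | Q w]) = 0%E.
  by apply/eqP; rewrite eq_le measure_ge0 andbT -PB le_measure ?inE //; exact: measurableC.
by have := probability_setC P mQ; rewrite P0 => /esym/eqP; rewrite sube_eq ?add0e // => /eqP <-.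
Qed.

(** * The adaptive scheme: noise, sample covariances, gains and errors *)

Section Scheme.
Context {d : measure_display} {T : measurableType d} {R : realType}.
Variables (P : probability T R) (F : nat -> set_system T).
Variables (N M : nat) (Mn : 'I_N -> nat).
Variables (H : forall n, 'M[R]_(Mn n, M)) (theta : 'cV[R]_M).
Variables (zeta : forall n, nat -> T -> 'cV[R]_(Mn n)) (Rcov : forall n, 'M[R]_(Mn n)).
Variables (L : nat -> T -> 'M[R]_N) (a b tau2 : R) (gamma : nat -> R).
Variables (x0 : 'I_N -> 'cV[R]_M) (G0 : 'I_N -> 'M[R]_M) (Q0 : forall n, 'M[R]_(Mn n)).
Hypothesis filF : is_filtration F.
Hypothesis adZ : forall n, adapted_indep P F (zeta n).
Hypothesis idZ : forall n, ident_distr P (zeta n).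
Hypothesis meanZ : forall n t i, P.-integrable setT (fun w => (zeta n t w i ord0)%:E) /\
                 ('E_P[fun w => zeta n t w i ord0] = 0%:E)%E.
Hypothesis covZ : forall n t i j,
     P.-integrable setT (fun w => (zeta n t w i ord0 * zeta n t w j ord0)%:E) /\
     ('E_P[(fun w => zeta n t w i ord0 * zeta n t w j ord0)%R] = (Rcov n i j)%:E)%E.
Hypothesis unitR : forall n, Rcov n \in unitmx.
Hypothesis lapL : forall t w, is_simple_laplacian (L t w).
Let Sig : 'M[R]_M := (N%:R)^-1 *: \sum_(n < N) ((H n)^T *m invmx (Rcov n) *m H n).
Hypothesis unitS : Sig \in unitmx.
Hypotheses (idL : ident_distr P L) (adL : adapted_indep P F L).
Hypothesis lamL : lambda2_pos (Emx P (L 0%N)).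
Variable eps1 : R.
Hypothesis eps0 : 0 < eps1.
Hypothesis momZ : forall n t, ('E_P[(fun w => vnorm (zeta n t w) `^ (2 + eps1))%R] < +oo)%E.
Hypothesis tau_cond : tau2 + (2 + eps1)^-1 + 2^-1 < 1.
Hypotheses (a1 : 1 <= a) (b0 : 0 < b) (t20 : 0 < tau2).
Hypothesis gamma0 : gamma @ \oo --> 0.
Hypothesis N0 : (0 < N)%N.

Let p : R := 2 + eps1.
Let al := step a 1.
Let be := step b tau2.

Let subF t : F t `<=` measurable. Proof. by case: (filF t). Qed.
Let sigF t : sigma_algebra setT (F t). Proof. by case: (filF t). Qed.

Let p2 : 2 < p. Proof. by rewrite ltrDl. Qed.
Let p1 : 1 <= p. Proof. by apply: le_trans (ltW p2); rewrite ler1n. Qed.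
Let p0 : 0 <= p. Proof. exact: le_trans p1. Qed.
Let pp : 0 < p. Proof. exact: lt_trans p2. Qed.

Lemma tau2_lt_half : tau2 < 2^-1.
Proof.
have : 0 < (2 + eps1)^-1 by rewrite invr_gt0 addr_gt0.
by move: tau_cond => h1 h2; lra.
Qed.

Lemma noise_adapted n t : gmxmeas (F t.+1) (zeta n t).
Proof. by move=> i j; apply: gmeas_preimage; case: (adZ n t) => h _; exact: h. Qed.

Lemma noise_meas n t : mxmeas (zeta n t).
Proof. exact (mxmeas_sub filF (@noise_adapted n t)). Qed.

Lemma noise_Lint n t i : Lint P (fun w => zeta n t w i 0).
Proof. by case: (@meanZ n t i). Qed.

Lemma noise_mean n t i : Er P (fun w => zeta n t w i 0) = 0.
Proof. by case: (@meanZ n t i) => _; rewrite unlock /Er => ->. Qed.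

Lemma noise_cov_Lint n t i j : Lint P (fun w => zeta n t w i 0 * zeta n t w j 0).
Proof. by case: (@covZ n t i j). Qed.

Lemma noise_cov n t i j : Er P (fun w => zeta n t w i 0 * zeta n t w j 0) = Rcov n i j.
Proof. by case: (@covZ n t i j) => _; rewrite unlock /Er => ->. Qed.

(** Finite moments at each time give no uniform bound; identical distribution transfers the bound at
    time [0] to all times, and a sum over the finitely many agents makes it common. *)
Lemma noise_moment : exists2 C : R, 0 < C &
  forall n t i, Lpb P p (fun w => zeta n t w i 0) C.
Proof.
have Lv n : Lint P (fun w => fnorm (zeta n 0%N w) `^ p).
  apply: Lint_ge0_lty.
  - apply: (measurableT_comp (measurable_powR p)); apply: measurable_fnorm; exact: noise_meas.
  - by move=> w; exact: powR_ge0.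
  - have := momZ n 0; rewrite unlock.
    by under eq_integral do rewrite fnorm_vnorm.
pose e n := Er P (fun w => fnorm (zeta n 0%N w) `^ p).
have e0 n : 0 <= e n by apply: Er_ge0 => w; exact: powR_ge0.
have S0 : 0 <= \sum_n e n by apply: sumr_ge0.
have S1 : 0 < 1 + \sum_n e n by rewrite ltr_wpDr.
have CE : ((1 + \sum_n e n) `^ p^-1) `^ p = 1 + \sum_n e n.
  by rewrite -powRrM mulVf ?(gt_eqF pp) // powRr1 // ltW.
exists ((1 + \sum_n e n) `^ p^-1); first exact: powR_gt0.
move=> n t i; rewrite /Lpb CE.
have mh : measurable_fun setT (fun x : R => `|x| `^ p).
  by apply: measurable_normpow.
have le0 w : `|zeta n 0%N w i 0| `^ p <= fnorm (zeta n 0%N w) `^ p.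
  by apply: ge0_ler_powR; rewrite ?nnegrE ?fnorm_ge0 // ler_fnorm_entry.
have L0 : Lint P (fun w => `|zeta n 0%N w i 0| `^ p).
  apply: Lint_le (Lv n); first by apply: measurable_normpow; exact: noise_meas.
  by move=> w; rewrite ger0_norm ?powR_ge0.
have [Lt Et] := @ident_distr_Er _ _ _ P _ _ (zeta n) (fun x => `|x| `^ p) t 0%N i 0
  (@noise_meas n) (@idZ n) mh L0.
split; [exact: noise_meas|exact: Lt|].
rewrite Et; apply: (@le_trans _ _ (e n)); first exact: (Er_le L0 (Lv n) le0).
exact: le_1Dsum e0.
Qed.

Lemma powR_le1DpowR (x r s : R) : 0 <= x -> 0 <= r -> r <= s -> x `^ r <= 1 + x `^ s.
Proof.
move=> x0' r0 rs; have [x1|x1] := leP x 1.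
  apply: (@le_trans _ _ 1); last by rewrite lerDl powR_ge0.
  by have := ge0_ler_powR r0 x0' (ler01 : 1 \is Num.nneg) x1; rewrite powR1.
apply: (@le_trans _ _ (x `^ s)); last by rewrite lerDr.
by apply: ler_powR => //; exact: ltW.
Qed.

(** Products of two noise entries have moments of order [p / 2 > 1], and the strong law takes orders
    up to [2]. *)
Let q : R := Num.min (p / 2) 2.
Let q1 : 1 < q.
Proof. by rewrite lt_min ltr1n andbT ltr_pdivlMr // mul1r. Qed.
Let q2 : q <= 2. Proof. by rewrite ge_min lexx orbT. Qed.
Let q0 : 0 <= q. Proof. exact: ltW (lt_trans ltr01 q1). Qed.
Let qp2 : q * 2 <= p. Proof. by rewrite -ler_pdivlMr // ge_min lexx. Qed.
Let qp : q <= p.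
Proof. by apply: le_trans qp2; rewrite ler_peMr // ler1n. Qed.

Lemma mx_events_sub m n (X : T -> 'M[R]_(m, n)) (G : set_system T) :
  sigma_algebra setT G -> gmxmeas G X -> mx_events X `<=` G.
Proof.
move=> sG mX A hA; have := @mx_events_measurable _ (g_sigma_algebraType G) R m n X mX A hA.
by rewrite /measurable /= (sigma_algebra_id sG).
Qed.

Lemma noise_average n (Y : nat -> T -> R) (mu K : R) :
  (forall t, gmeas (mx_events (zeta n t)) (Y t)) ->
  (forall t, Lint P (fun w => `|Y t w| `^ q)) ->
  (forall t, Er P (fun w => `|Y t w| `^ q) <= K) ->
  (forall t, Lint P (Y t)) -> (forall t, Er P (Y t) = mu) ->
  {ae P, forall w, (fun k => k%:R^-1 * \sum_(s < k) Y s w - mu) @ \oo --> 0}.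
Proof.
move=> gY LYq EYq LY EY; apply: (slln filF q1 q2 _ _ LYq EYq LY EY).
- move=> t; apply: (gmeasS (G1 := mx_events (zeta n t))); last exact: gY.
  by apply: mx_events_sub => //; exact: noise_adapted.
- move=> t f h gf mh Lf Lh.
  have [] := @indep_Er _ _ _ P _ _ (zeta n t) (F t) f (fun w => h (Y t w)) (@sigF t) (@subF t) (@noise_meas n t) _ gf _ Lf Lh => //.
  + by case: (adZ n t).
  + by apply: (measurableT_comp mh); exact: gY.
Qed.

Lemma noise_average_cvg n : {ae P, forall w,
  mxcv (fun k => k%:R^-1 *: \sum_(s < k) zeta n s w) 0 /\
  mxcv (fun k => k%:R^-1 *: \sum_(s < k) (zeta n s w *m (zeta n s w)^T)) (Rcov n)}.
Proof.
have [C C0 hC] := noise_moment.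
have Ep t i : Er P (fun w => `|zeta n t w i 0| `^ p) <= C `^ p by case: (hC n t i).
have Lp t i : Lint P (fun w => `|zeta n t w i 0| `^ p) by case: (hC n t i).
have h1 i : {ae P, forall w, (fun k => k%:R^-1 * \sum_(s < k) zeta n s w i 0 - 0) @ \oo --> 0}.
  have le w t : `|zeta n t w i 0| `^ q <= 1 + `|zeta n t w i 0| `^ p by exact: powR_le1DpowR.
  have LR t : Lint P (fun w => 1 + `|zeta n t w i 0| `^ p) by apply: LintD => //; exact: Lint_cst.
  have LY t : Lint P (fun w => `|zeta n t w i 0| `^ q).
    apply: Lint_le (LR t); first by apply: measurable_normpow; exact: noise_meas.
    by move=> w; rewrite ger0_norm ?powR_ge0.
  apply: (@noise_average n (fun t w => zeta n t w i 0) 0 (1 + C `^ p)) => //.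
  - by move=> t; exact: gmeas_entry.
  - move=> t; apply: (le_trans (Er_le (LY t) (LR t) (fun w => le w t))).
    by rewrite ErD ?Er_cst ?lerD2l //; exact: Lint_cst.
  - by move=> t; exact: noise_Lint.
  - by move=> t; exact: noise_mean.
have h2 i j : {ae P, forall w, (fun k => k%:R^-1 * \sum_(s < k) (zeta n s w i 0 * zeta n s w j 0) - Rcov n i j) @ \oo --> 0}.
  have le1 (x : R) : 0 <= x -> x `^ (q * 2) <= 1 + x `^ p.
    by move=> x00; apply: powR_le1DpowR => //; rewrite mulr_ge0.
  have le w t : `|zeta n t w i 0 * zeta n t w j 0| `^ q <=
      (1 + `|zeta n t w i 0| `^ p) + (1 + `|zeta n t w j 0| `^ p).
    (* The product is at most the square of the larger factor, and [2 q <= p]. *)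
    have key (x y : R) : 0 <= x -> 0 <= y -> x <= y -> (x * y) `^ q <= 1 + y `^ p.
      move=> x00 y00 xy; apply: le_trans (le1 y y00); rewrite mulrC powRrM powRAC.
      apply: ge0_ler_powR => //; rewrite ?nnegrE ?mulr_ge0 ?powR_ge0 //.
      by rewrite -[2]/(2%:R) powR_mulrn // expr2 ler_wpM2l.
    rewrite normrM; have [xy|xy] := leP `|zeta n t w i 0| `|zeta n t w j 0|.
      apply: (le_trans (key _ _ _ _ xy)) => //; rewrite lerDr addr_ge0 ?powR_ge0 //.
    rewrite mulrC; apply: (le_trans (key _ _ _ _ (ltW xy))) => //.
    by rewrite lerDl addr_ge0 ?powR_ge0.
  have LR t : Lint P (fun w => (1 + `|zeta n t w i 0| `^ p) + (1 + `|zeta n t w j 0| `^ p)).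
    by apply: LintD; apply: LintD => //; exact: Lint_cst.
  have LY t : Lint P (fun w => `|zeta n t w i 0 * zeta n t w j 0| `^ q).
    apply: Lint_le (LR t).
      by apply: measurable_normpow; apply: measurable_funM; exact: noise_meas.
    by move=> w; rewrite ger0_norm ?powR_ge0.
  apply: (@noise_average n (fun t w => zeta n t w i 0 * zeta n t w j 0) _ ((1 + C `^ p) + (1 + C `^ p))) => //.
  - by move=> t; apply: measurable_funM; exact: gmeas_entry.
  - move=> t; apply: (le_trans (Er_le (LY t) (LR t) (fun w => le w t))).
    have L1 k : Lint P (fun w => 1 + `|zeta n t w k 0| `^ p).
      by apply: LintD => //; exact: Lint_cst.
    rewrite ErD // !ErD ?Er_cst //; [|exact: Lint_cst|exact: Lint_cst].
    by apply: lerD; rewrite lerD2l.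
  - by move=> t; exact: noise_cov_Lint.
  - by move=> t; exact: noise_cov.
have H1 := ae_forall_fin h1.
have H2 := ae_forall_fin (fun i => ae_forall_fin (h2 i)).
apply: filterS2 H1 H2 => w hw1 hw2; split; apply: mxcv_entries => i j.
  by apply: cvg0_ext (hw1 i) => k; rewrite !ord1 !mxE summxE.
apply: cvg0_ext (hw2 i j) => k; rewrite mxE summxE; congr (_ * _ - _).
by apply: eq_bigr => s _; rewrite mxE big_ord1 mxE.
Qed.

Lemma Qest_cvg n : {ae P, forall w,
  mxcv (fun t => Qest H theta zeta Q0 n t w) (Rcov n)}.
Proof.
apply: filterS (noise_average_cvg n) => w [h1 h2].
have h := @sample_covariance_cvg _ _ (H n *m theta) (fun s => zeta n s w) _ h1 h2.
apply: cvg0_unshift; apply: mxcv_le h; exists 1%N => // -[//|k] _ /=.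
by rewrite /Qest /=.
Qed.

Local Notation Ge n t w := (Gest H theta zeta L al be gamma x0 G0 Q0 n t w).
Local Notation xe n t w := (xest H theta zeta L al be gamma x0 G0 Q0 n t w).
Local Notation Qe n t w := (Qest H theta zeta Q0 n t w).

Definition Kseq n t w : 'M[R]_(M, Mn n) :=
  invmx (Ge n t w + (gamma t)%:M) *m (H n)^T *m invmx (Qe n t w + (gamma t)%:M).
Definition Dseq n t w : 'M[R]_M := (H n)^T *m invmx (Qe n t w + (gamma t)%:M) *m H n.

Lemma Gest_step n t w : Ge n t.+1 w =
  Ge n t w - be t *: (\sum_l L t w n l *: Ge l t w) + al t *: (Dseq n t w - Ge n t w).
Proof.
by rewrite -laplacian_nbr_sum // /Dseq /Gest /=; case: (state _ _ _ _ _ _ _ _ _ _ _ _).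
Qed.

Lemma xest_step n t w : xe n t.+1 w =
  xe n t w - be t *: (\sum_l L t w n l *: xe l t w)
  + al t *: (Kseq n t w *m (yobs H theta zeta n t w - H n *m xe n t w)).
Proof.
by rewrite -laplacian_nbr_sum // /Kseq /Kgain /xest /Gest /=; case: (state _ _ _ _ _ _ _ _ _ _ _ _).
Qed.

Lemma mxmeas_le s t m n (Z : T -> 'M[R]_(m, n)) : (s <= t)%N ->
  gmxmeas (F s) Z ->
  gmxmeas (F t) Z.
Proof.
by move=> st hZ i j; apply: (gmeasS (G1 := F s)); [exact: (filtration_le filF)|exact: hZ].
Qed.

Lemma yobs_adapted n s t : (s < t)%N ->
  gmxmeas (F t) (yobs H theta zeta n s).
Proof.
move=> st; apply: mxmeasD; first exact: mxmeas_cst.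
exact (mxmeas_le st (@noise_adapted n s)).
Qed.

(** Only observations at times [s < t] occur, each [F s.+1]-measurable. Hence the gains at time [t]
    are fixed before the noise of time [t], which [tracking_rate] relies on. *)
Lemma Qest_adapted n t :
  gmxmeas (F t) (fun w => Qe n t w).
Proof.
rewrite /Qest; case: t => [|[|t]] /=; [exact: mxmeas_cst|exact: mxmeas_cst|].
have hs (k : nat) : (k <= t.+2)%N -> @mxmeas _ (g_sigma_algebraType (F t.+2)) R _ _
    (fun w => \sum_(s < k) yobs H theta zeta n s w).
  move=> kt; apply: mxmeas_sum => s; apply: yobs_adapted.
  exact: leq_trans kt.
apply: mxmeasB.
  apply: mxmeasZ; apply: mxmeas_sum => s.
  by apply: mxmeasM; last apply: mxmeasT; exact: yobs_adapted.
by apply: mxmeasM; last apply: mxmeasT; apply: mxmeasZ; exact: hs.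
Qed.

Lemma invQ_adapted n t : @mxmeas _ (g_sigma_algebraType (F t)) R _ _
  (fun w => invmx (Qe n t w + (gamma t)%:M)).
Proof.
apply: mxmeas_invmx; apply: mxmeasD; [exact: Qest_adapted|exact: mxmeas_cst].
Qed.

Lemma Dseq_adapted n t : gmxmeas (F t) (Dseq n t).
Proof.
apply: mxmeasM; last exact: mxmeas_cst.
by apply: mxmeasM; [exact: mxmeas_cst|exact: invQ_adapted].
Qed.

Lemma laplacian_sum_adapted t m k (X : 'I_N -> T -> 'M[R]_(m, k)) n :
  (forall l, gmxmeas (F t) (X l)) ->
  gmxmeas (F t.+1) (fun w => \sum_l L t w n l *: X l w).
Proof.
move=> hX; apply: mxmeas_sum => l; apply: mxmeasZf.
  by have := laplacian_adapted adL (t := t) n l.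
exact (mxmeasS filF (hX l)).
Qed.

Lemma Gest_adapted n t : gmxmeas (F t) (fun w => Ge n t w).
Proof.
elim: t n => [|t IH] n; first exact: mxmeas_cst.
rewrite (funext (fun w => Gest_step n t w)); apply: mxmeasD.
  apply: mxmeasB; first exact (mxmeasS filF (@IH n)).
  by apply: mxmeasZ; apply: laplacian_sum_adapted.
apply: mxmeasZ; apply: mxmeasB; last exact (mxmeasS filF (@IH n)).
exact (mxmeasS filF (@Dseq_adapted n t)).
Qed.

Lemma Kseq_adapted n t : gmxmeas (F t) (Kseq n t).
Proof.
apply: mxmeasM; last exact: invQ_adapted.
apply: mxmeasM; last exact: mxmeas_cst.
by apply: mxmeas_invmx; apply: mxmeasD; [exact: Gest_adapted|exact: mxmeas_cst].
Qed.

Lemma xest_adapted n t : gmxmeas (F t) (fun w => xe n t w).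
Proof.
elim: t n => [|t IH] n; first exact: mxmeas_cst.
rewrite (funext (fun w => xest_step n t w)); apply: mxmeasD.
  apply: mxmeasB; first exact (mxmeasS filF (@IH n)).
  by apply: mxmeasZ; apply: laplacian_sum_adapted.
apply: mxmeasZ; apply: mxmeasM; first exact (mxmeasS filF (@Kseq_adapted n t)).
apply: mxmeasB; first exact: yobs_adapted.
by apply: mxmeasM; [exact: mxmeas_cst|exact (mxmeasS filF (@IH n))].
Qed.

Lemma mxcv_regularized m (X : nat -> 'M[R]_m) A :
  mxcv X A -> mxcv (fun t => X t + (gamma t)%:M) A.
Proof.
move=> h; rewrite -[A]addr0; apply: mxcvD => //.
have -> : 0 = 0 *: 1%:M :> 'M[R]_m by rewrite scale0r.
under eq_fun do rewrite -scalemx1.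
by apply: mxcvZ; [apply: cvg0_ext gamma0 => t; rewrite subr0|exact: mxcv_cst].
Qed.

Lemma invQ_cvg n : {ae P, forall w,
  mxcv (fun t => invmx (Qe n t w + (gamma t)%:M)) (invmx (Rcov n))}.
Proof.
apply: filterS (Qest_cvg n) => w h; apply: mxcv_invmx => //.
exact: mxcv_regularized.
Qed.

Lemma Dseq_cvg n : {ae P, forall w,
  mxcv (fun t => Dseq n t w) ((H n)^T *m invmx (Rcov n) *m H n)}.
Proof.
apply: filterS (invQ_cvg n) => w h.
by apply: mxcvM; [apply: mxcvM => //; exact: mxcv_cst|exact: mxcv_cst].
Qed.

(* Row [n] of [Gmat j] is the [j]-th column of [G_n], so that one consensus step
   is a left multiplication by [L]. *)
Definition Gmat j t w : 'M[R]_(N, M) := \matrix_(n, i) Ge n t w i j.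
Definition Dmat j t w : 'M[R]_(N, M) := \matrix_(n, i) Dseq n t w i j.

Lemma Gmat_step j t w : Gmat j t.+1 w =
  Gmat j t w - be t *: (L t w *m Gmat j t w) + al t *: (Dmat j t w - Gmat j t w).
Proof.
apply/matrixP => n i.
have e : (\sum_l L t w n l *: Ge l t w) i j = (L t w *m Gmat j t w) n i.
  by rewrite summxE mxE; apply: eq_bigr => l _; rewrite !mxE.
move: e; move: (L t w *m Gmat j t w) => B e.
by rewrite [LHS]mxE Gest_step !mxE e.
Qed.

Let Dinf n : 'M[R]_M := (H n)^T *m invmx (Rcov n) *m H n.

Lemma Dmat_cvg : {ae P, forall w, forall j, mxcv (fun t => Dmat j t w) (\matrix_(n, i) Dinf n i j)}.
Proof.
apply: filterS (ae_forall_fin Dseq_cvg) => w hw j; apply: mxcv_entries => n i.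
by apply: cvg0_ext (mxcv_entry i j (hw n)) => t; rewrite !mxE.
Qed.

Lemma matrix_columns_adapted j t (X : 'I_N -> T -> 'M[R]_M) :
  (forall n, gmxmeas (F t) (X n)) ->
  gmxmeas (F t) (fun w => \matrix_(n < N, i < M) X n w i j).
Proof.
by move=> hX n i; under eq_fun do rewrite mxE; exact: hX.
Qed.

Lemma Gest_perp_cvg j : {ae P, forall w, (fun t => fnorm (perpmx *m Gmat j t w)) @ \oo --> 0}.
Proof.
apply: (@consensus_perp_cvg0 _ _ _ P F N L filF lapL idL adL lamL a b tau2 a1 b0 t20 tau2_lt_half
  N0 M (Gmat j) (Dmat j)).
- by move=> t; apply: matrix_columns_adapted => n; exact: Gest_adapted.
- by move=> t; apply: matrix_columns_adapted => n; exact: Dseq_adapted.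
- by move=> t w; exact: Gmat_step.
- by apply: filterS Dmat_cvg => w /(_ j) /mxcv_bounded.
Qed.

Lemma Gest_avg_cvg : {ae P, forall w, forall i j,
  (fun t => (avgmx *m Gmat j t w) 0 i - Sig i j) @ \oo --> 0}.
Proof.
apply: filterS Dmat_cvg => w hD i j.
(* Since [a] may exceed [1], averaging is convex only from some time on; the lower bound [1/(t+1)]
   on the weight comes from [1 <= a]. *)
have [t1 _ ht1] : \forall t \near \oo, al t <= 1.
  by apply: cvg0_near_le => //; exact: alpha_cvg0.
apply: (@averaging_cvg0 _ al (fun t => (avgmx *m Dmat j t w) 0 i - Sig i j) _ t1).
- move=> t tt; rewrite (ht1 t tt) andbT /al alphaE.
  by rewrite ler_peMl ?invr_ge0.
- move=> t tt; rewrite Gmat_step avg_step // mulmxBr.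
  have e (x y z : 'rV[R]_M) c : (x + c *: (y - z)) 0 i = x 0 i + c * (y 0 i - z 0 i).
    by rewrite !mxE.
  by rewrite e; ring.
have e : Sig i j = (avgmx *m (\matrix_(n, i) Dinf n i j)) 0 i.
  rewrite /Sig mxE summxE mulr_sumr [RHS]mxE; apply: eq_bigr => n _.
  by rewrite /avgmx !mxE mulr1.
by rewrite e; apply: mxcv_entry; apply: mxcvM; [exact: mxcv_cst|exact: hD].
Qed.

Lemma Gest_cvg : {ae P, forall w, forall n, mxcv (fun t => Ge n t w) Sig}.
Proof.
apply: filterS2 (ae_forall_fin Gest_perp_cvg) Gest_avg_cvg => w hp ha n.
apply: mxcv_entries => i j.
have hp' : (fun t => (perpmx *m Gmat j t w) n i) @ \oo --> 0.
  by apply: cvg0_le (hp j); apply: nearW => t; exact: ler_fnorm_entry.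
apply: cvg0_ext (cvg0D hp' (ha i j)) => t.
rewrite addrA; congr (_ - _).
transitivity (Gmat j t w n i); last by rewrite mxE.
rewrite [in RHS](perp_decomp (Gmat j t w)) [RHS]mxE; congr (_ + _).
by rewrite [RHS]mxE big_ord1 [const_mx 1 n 0]mxE mul1r.
Qed.

Let Kinf n : 'M[R]_(M, Mn n) := invmx Sig *m (H n)^T *m invmx (Rcov n).

Lemma Kseq_cvg : {ae P, forall w, forall n, mxcv (fun t => Kseq n t w) (Kinf n)}.
Proof.
apply: filterS2 Gest_cvg (ae_forall_fin invQ_cvg) => w hG hQ n.
apply: mxcvM => //; apply: mxcvM; last exact: mxcv_cst.
apply: mxcv_invmx => //; exact: mxcv_regularized.
Qed.

(** The factor [invmx Sig] normalizes the gains: single agents may miss directions, but their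
    information matrices average to [Sig]. In the limit the average error therefore drifts by
    exactly [- al t] times itself. *)
Lemma Kinf_avg : N%:R^-1 *: \sum_n Kinf n *m H n = 1%:M.
Proof.
rewrite -(mulVmx unitS) {2}/Sig -scalemxAr mulmx_sumr; congr (_ *: _).
by apply: eq_bigr => n _; rewrite /Kinf !mulmxA.
Qed.

Definition Emat t w : 'M[R]_(N, M) := \matrix_(n, i) (xe n t w - theta) i 0.

Lemma Emat_row n t w : (row n (Emat t w))^T = xe n t w - theta.
Proof. by apply/matrixP => i j; rewrite !ord1 !mxE. Qed.

Lemma Emat_step t w : Emat t.+1 w = Emat t w - be t *: (L t w *m Emat t w) +
  al t *: (noisemx (fun n => Kseq n t w) (fun n => zeta n t w)
           - driftmx H (fun n => Kseq n t w) (Emat t w)).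
Proof.
rewrite -innovation_split; apply/matrixP => n i; rewrite [LHS]mxE xest_step.
have e1 : yobs H theta zeta n t w - H n *m xe n t w =
    zeta n t w - H n *m (row n (Emat t w))^T.
  by rewrite Emat_row mulmxBr opprB addrA /yobs [H n *m theta + _]addrC.
have e2 : (\sum_l L t w n l *: xe l t w) i 0 = (L t w *m Emat t w) n i.
  (* Zero row sums: communication does not see the common shift by [theta]. *)
  have r0 : \sum_l L t w n l * theta i 0 = 0.
    by rewrite -mulr_suml simple_laplacian_row // mul0r.
  rewrite summxE [RHS]mxE -[LHS]subr0 -[X in _ - X]r0 -sumrB.
  by apply: eq_bigr => l _; rewrite !mxE mulrBr.
rewrite e1; move: e2; move: (L t w *m Emat t w) (\sum_l _) => X Y e2.
set Z := Kseq n t w *m _.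
have -> : (xe n t w - be t *: Y + al t *: Z - theta) i 0 =
   (xe n t w - theta) i 0 - be t * Y i 0 + al t * Z i 0 by rewrite !mxE; ring.
rewrite e2 [RHS]mxE; congr (_ + _); last by rewrite [RHS]mxE [X in _ = _ * X]mxE.
by rewrite [RHS]mxE [Emat t w n i]mxE; congr (_ + _); rewrite !mxE.
Qed.

Lemma Emat_adapted t : gmxmeas (F t) (Emat t).
Proof.
move=> n i; rewrite (_ : (fun w => _) = (fun w => (xe n t w - theta) i 0)); last first.
  by apply/funext => w; rewrite mxE.
exact: (mxmeasB (@xest_adapted n t) (mxmeas_cst _)).
Qed.

Lemma Emat_rate tau : 0 <= tau -> tau < 2^-1 ->
  {ae P, forall w, (fun t => t.+1%:R `^ tau * fnorm (Emat t w)) @ \oo --> 0}.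
Proof.
move=> tau0 tau1; have [C C0 hC] := noise_moment.
(* A rearrangement of [tau2 + 1/p + 1/2 < 1]: the Borel-Cantelli condition at the critical exponent
   [1/2], hence at every smaller [tau]. *)
have pcond : 1 < p * ((1 - tau2) - 2^-1).
  rewrite mulrC -ltr_pdivrMr // mul1r; move: tau_cond; rewrite -/p.
  by move: p^-1 => y ?; lra.
apply: (@tracking_rate _ _ _ P F N M Mn L filF lapL idL adL lamL a b tau2 p a1 b0 t20 tau2_lt_half
  (ltW p2) pcond N0 H zeta C adZ C0 noise_Lint noise_mean hC Kseq Kinf) => //.
- by move=> n t; exact: Kseq_adapted.
- exact: Kseq_cvg.
- exact: Kinf_avg.
- exact: Emat_adapted.
- exact: Emat_step.
Qed.

Theorem xest_rate n tau : 0 <= tau -> tau < 2^-1 ->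
  P [set w | (fun t : nat => t.+1%:R `^ tau * vnorm (xe n t w - theta)) @ \oo --> 0] = 1%E.
Proof.
move=> tau0 tau1; apply: (@ae_probability1 _ _ _ P (fun w => (fun t : nat => t.+1%:R `^ tau * vnorm (xe n t w - theta)) @ \oo --> 0)).
  apply: (measurable_cvg0 (u := fun t w => t.+1%:R `^ tau * vnorm (xe n t w - theta))) => t.
  apply: measurable_funM; first exact: measurable_cst.
  rewrite (funext (fun w => fnorm_vnorm _)); apply: measurable_fnorm.
  apply: mxmeasB; last exact: mxmeas_cst.
  exact (mxmeas_sub filF (@xest_adapted n t)).
apply: filterS (Emat_rate tau0 tau1) => w; apply: cvg0_le; apply: nearW => t.
rewrite fnorm_vnorm ger0_norm ?mulr_ge0 ?powR_ge0 ?fnorm_ge0 //.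
by rewrite ler_wpM2l ?powR_ge0 // -Emat_row fnorm_tr fnorm_row_le.
Qed.

End Scheme.

Theorem theorem3p2
  (d : measure_display) (T : measurableType d) (R : realType)
  (P : probability T R) (F : nat -> set_system T)
  (N M : nat) (Mn : 'I_N -> nat)
  (H : forall n, 'M[R]_(Mn n, M)) (theta : 'cV[R]_M)
  (zeta : forall n, nat -> T -> 'cV[R]_(Mn n))
  (Rcov : forall n, 'M[R]_(Mn n))
  (L : nat -> T -> 'M[R]_N)
  (a b tau2 : R) (gamma : nat -> R)
  (x0 : 'I_N -> 'cV[R]_M) (G0 : 'I_N -> 'M[R]_M)
  (Q0 : forall n, 'M[R]_(Mn n)) :
  is_filtration F ->
  (* noise: zero mean, temporally i.i.d., covariance R_n nonsingular *)
  (forall n, adapted_indep P F (zeta n)) ->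
  (forall n, ident_distr P (zeta n)) ->
  (forall n t i, P.-integrable setT (fun w => (zeta n t w i ord0)%:E) /\
                 ('E_P[fun w => zeta n t w i ord0] = 0%:E)%E) ->
  (forall n t i j,
     P.-integrable setT (fun w => (zeta n t w i ord0 * zeta n t w j ord0)%:E) /\
     ('E_P[(fun w => zeta n t w i ord0 * zeta n t w j ord0)%R] = (Rcov n i j)%:E)%E) ->
  (forall n, Rcov n \in unitmx) ->
  (* noise sequences of different agents are mutually uncorrelated *)
  (forall n l, n != l -> forall t s i j,
     ('E_P[(fun w => zeta n t w i ord0 * zeta l s w j ord0)%R] = 0%:E)%E) ->
  (* communication: random Laplacians of simple undirected graphs *)
  (forall t w, is_simple_laplacian (L t w)) ->
  (* (A.1) *)
  ((N%:R)^-1 *: \sum_(n < N) ((H n)^T *m invmx (Rcov n) *m H n)) \in unitmx ->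
  (* (A.2) *)
  ident_distr P L -> adapted_indep P F L ->
  (forall t, lambda2_pos (Emx P (L t))) ->
  (* (A.3) {L_t} and the noise sequences are mutually independent *)
  (forall (K : nat) (BL : nat -> 'I_N -> 'I_N -> set R)
          (BZ : forall n, nat -> 'I_(Mn n) -> 'I_1 -> set R),
     (forall t, mx_borel (BL t)) -> (forall n t, mx_borel (BZ n t)) ->
     let A := [set w | forall t, (t < K)%N -> rect_event (L t) (BL t) w] in
     let B := [set w | forall n t, (t < K)%N -> rect_event (zeta n t) (BZ n t) w] in
     P (A `&` B) = (P A * P B)%E) ->
  (* (A.4) and (A.5) with tau1 = 1 and a >= 1, sharing eps1 *)
  (exists eps1 : R, 0 < eps1 /\
     (forall n t, ('E_P[(fun w => vnorm (zeta n t w) `^ (2 + eps1))%R] < +oo)%E) /\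
     1 > tau2 + (2 + eps1)^-1 + 2^-1) ->
  1 <= a -> 0 < b -> 0 < tau2 -> tau2 <= 1 ->
  (forall t, 0 < gamma t) -> gamma @ \oo --> 0 ->
  (forall n, psd (G0 n)) -> (forall n, psd (Q0 n)) ->
  forall (n : 'I_N) (tau : R), 0 <= tau -> tau < 2^-1 ->
  P [set w | (fun t : nat => (t.+1)%:R `^ tau *
       vnorm (xest H theta zeta L (step a 1) (step b tau2) gamma x0 G0 Q0 n t w
              - theta)) @ \oo --> 0] = 1%E.
Proof.
move=> filF adZ idZ meanZ covZ unitR _ lapL unitS idL adL lamL _ [eps1 [eps0 [momZ tc]]].
move=> a1 b0 t20 _ _ gamma0 _ _ n tau tau0 tau1.
have N0 : (0 < N)%N by case: n => [m /(leq_ltn_trans (leq0n m))].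
exact: (xest_rate theta x0 G0 Q0 filF adZ idZ meanZ covZ unitR lapL unitS idL adL (lamL 0%N) eps0 momZ
  tc a1 b0 t20 gamma0 N0).
Qed.
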